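(* Let $O\subseteq \mathbb{R}^d$ be open, let $D\subseteq \partial O$, $p\in(0,\infty)$ and $s\in(0,1)$. Suppose that $O$ satisfies the interior thickness condition in $\partial O\setminus D$, i.e. there is a constant $c>0$ such that $$|\mathrm{B}(x,r)\cap O|\ \ge\ c\,|\mathrm{B}(x,r)|\qquad\text{for all } x\in \partial O\setminus D,\ r\in(0,1].$$ Then there exists a bounded extension mapping $$\mathrm{E}\colon \mathrm{W}^{s,p}(O)\cap \mathrm{L}^p(O,\mathrm{d}_D^{-sp})\ \to\ \mathrm{W}^{s,p}_D(\mathbb{R}^d),$$ that is, a mapping with $(\mathrm{E}f)|_O=f$ almost everywhere on $O$ for every $f$, and for which there is a constant $C\ge 0$ with $\|\mathrm{E}f\|_{\mathrm{W}^{s,p}_D(\mathbb{R}^d)}\le C\,\|f\|_{\mathrm{W}^{s,p}_D(O)}$ for every $f\in \mathrm{W}^{s,p}_D(O)=\mathrm{W}^{s,p}(O)\cap \mathrm{L}^p(O,\mathrm{d}_D^{-sp})$. If $p\ge 1$, then $\mathrm{E}$ is moreover linear (i.e. it can be chosen linear).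
   Context: $\mathrm{B}(x,r)$ is the open Euclidean ball with center $x$ and radius $r$, and $|A|$ is the Lebesgue measure of $A$. For a set $D\subseteq\mathbb{R}^d$, $\mathrm{d}_D(x)=\inf_{z\in D}|x-z|$ is the Euclidean distance function to $D$; for $D=\emptyset$ put $\mathrm{d}_D\equiv\infty$ and $\mathrm{d}_D^{-sp}\equiv 0$ (so the weighted condition below is void). For an open set $U\subseteq\mathbb{R}^d$, $s\in(0,1)$ and $p\in(0,\infty)$, the fractional Sobolev space $\mathrm{W}^{s,p}(U)$ consists of those $f\in \mathrm{L}^p(U)$ for which $$[f]_{\mathrm{W}^{s,p}(U)}=\Bigl(\iint_{x,y\in U,\ |x-y|<1}\frac{|f(x)-f(y)|^p}{|x-y|^{sp+d}}\,dy\,dx\Bigr)^{1/p}$$ is finite, with (quasi-)norm $\|f\|_{\mathrm{W}^{s,p}(U)}=\|f\|_{\mathrm{L}^p(U)}+[f]_{\mathrm{W}^{s,p}(U)}$. The condition $f\in \mathrm{L}^p(U,\mathrm{d}_D^{-sp})$ means that $\|f\|_{\mathrm{L}^p(U,\mathrm{d}_D^{-sp})}=\bigl(\int_U |f(x)|^p\,\mathrm{d}_D(x)^{-sp}\,dx\bigr)^{1/p}$ is finite (with $0^{-sp}=\infty$ and $0\cdot\infty=0$). The space $\mathrm{W}^{s,p}_D(U)$ is $\mathrm{W}^{s,p}(U)\cap \mathrm{L}^p(U,\mathrm{d}_D^{-sp})$, with (quasi-)norm $\|f\|_{\mathrm{W}^{s,p}_D(U)}=\|f\|_{\mathrm{W}^{s,p}(U)}+\|f\|_{\mathrm{L}^p(U,\mathrm{d}_D^{-sp})}$.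 The mapping $\mathrm{E}$ is not required to be linear when $p<1$. *)

(* Defs.v *)
From HB Require Import structures.
From mathcomp Require Import all_boot all_order all_algebra.
From mathcomp Require Import all_classical all_reals all_analysis.
From mathcomp Require Import measurable_realfun lra.

Set Implicit Arguments.
Unset Strict Implicit.
Unset Printing Implicit Defensive.

Import Order.TTheory GRing.Theory Num.Theory.
Import numFieldNormedType.Exports.

Local Open Scope classical_set_scope.
Local Open Scope ring_scope.

Fact borel_rV_display : measure_display.
Proof. exact: default_measure_display. Qed.

Section borel_rV.
Context {R : realType} (n : nat).

Let borel : set (set 'rV[R]_n) := <<s open >>.

Let borel0 : borel set0. Proof. exact: sigma_algebra0. Qed.

Let borelC A : borel A -> borel (~` A). Proof. exact: sigma_algebraC. Qed.

Let borel_bigcup (F : (set 'rV[R]_n)^nat) :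
  (forall i, borel (F i)) -> borel (\bigcup_i F i).
Proof. exact: sigma_algebra_bigcup. Qed.

HB.instance Definition _ := @isMeasurable.Build borel_rV_display
  'rV[R]_n borel borel0 borelC borel_bigcup.

End borel_rV.

Section borel_rV_theory.
Context {R : realType}.

Lemma open_measurable_rV n (A : set 'rV[R]_n) : open A -> measurable A.
Proof. exact: sub_sigma_algebra. Qed.

Lemma continuous_measurable_rV n (f : 'rV[R]_n -> R) :
  continuous f -> measurable_fun setT f.
Proof.
move=> /continuousP cf; apply: (measurability _ (RGenOpens.measurableE R)).
move=> _ [_ [a [b ->]] <-]; rewrite setTI; apply: open_measurable_rV.
by apply: cf; exact: interval_open.
Qed.

Lemma measurable_coord n (i : 'I_n) :
  measurable_fun setT (fun v : 'rV[R]_n => v ord0 i).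
Proof. by apply: continuous_measurable_rV; exact: coord_continuous. Qed.

Let ratball n (q : {ffun 'I_n -> rat} * rat) : set 'rV[R]_n :=
  [set v : 'rV[R]_n | forall i, ball (ratr (q.1 i) : R) (ratr q.2) (v ord0 i)].

Let ratball_open n (A : set 'rV[R]_n) : open A ->
  A = \bigcup_(q in [set q | ratball q `<=` A]) ratball q.
Proof.
move=> oA; apply/seteqP; split=> [v Av|v [q /= + qv]]; last exact.
have /nbhs_ballP[e /= e0 eA] := open_nbhs_nbhs (conj oA Av).
have [r] := rat_in_itvoo (divr_gt0 e0 (@ltr0n R 2)).
rewrite in_itv/= => /andP[r0 re].
have qP (i : 'I_n) : exists q : rat, ball (ratr q : R) (ratr r) (v ord0 i).
  have [q] := @rat_in_itvoo R (v ord0 i - ratr r) (v ord0 i) ltac:(by rewrite gtrBl).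
  rewrite in_itv/= => /andP[q1 q2]; exists q.
  rewrite /ball/= ltr_norml; apply/andP; split; lra.
pose q := [ffun i => projT1 (cid (qP i))].
exists (q, r); last by move=> i /=; rewrite ffunE; case: cid.
move=> w qw; apply: eA; split=> // i j; rewrite ord1.
apply: (@le_ball _ _ _ (ratr r + ratr r)); first lra.
apply: (ball_triangle _ (qw j)).
by apply: ball_sym; rewrite /= ffunE; case: cid.
Qed.

Lemma measurable_fun_rV d (T : measurableType d) n (f : T -> 'rV[R]_n) :
  (forall i, measurable_fun setT (fun t => f t ord0 i)) ->
  measurable_fun setT f.
Proof.
move=> mf; apply: (measurability (open : set (set 'rV[R]_n))) => //.
move=> _ [A oA <-]; rewrite setTI (ratball_open oA) preimage_bigcup.
rewrite bigcup_mkcond; apply: countable_bigcupT_measurable => [|q].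
  exact: countableP.
case: ifPn => _; last exact: measurable0.
have -> : f @^-1` ratball q = \bigcap_(i in [set: 'I_n])
    ((fun t => f t ord0 i) @^-1` (ball (ratr (q.1 i) : R) (ratr q.2))).
  by apply/seteqP; split=> t /= ft i => [_|]; exact: ft.
apply: fin_bigcap_measurable => // i _.
by rewrite -[X in measurable X]setTI; apply: mf => //; exact: measurable_ball.
Qed.

End borel_rV_theory.

Section lebesgue_rV.
Context {R : realType}.

Definition rV_cons n (p : measurableTypeR R * 'rV[R]_n) : 'rV[R]_n.+1 :=
  row_mx (p.1%:M : 'rV[R]_1) p.2 : 'rV[R]_(1 + n).

Lemma rV_cons0 n p : @rV_cons n p ord0 ord0 = p.1.
Proof.
have -> : rV_cons p ord0 ord0 = row_mx (p.1%:M : 'rV_1) p.2 ord0 (lshift n ord0).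
  by congr (rV_cons p ord0 _); exact: val_inj.
by rewrite row_mxEl mxE eqxx mulr1n.
Qed.

Lemma rV_consS n p (i : 'I_n) : rV_cons p ord0 (lift ord0 i) = p.2 ord0 i.
Proof.
have -> : rV_cons p ord0 (lift ord0 i) =
    row_mx (p.1%:M : 'rV_1) p.2 ord0 (rshift 1 i).
  by congr (rV_cons p ord0 _); exact: val_inj.
by rewrite row_mxEr.
Qed.

Lemma measurable_rV_cons n : measurable_fun setT (@rV_cons n).
Proof.
apply: measurable_fun_rV => i; case: (unliftP ord0 i) => [j|] ->.
  rewrite (_ : (fun _ => _) = (fun v : 'rV[R]_n => v ord0 j) \o snd).
    by apply: measurableT_comp; [exact: measurable_coord|exact: measurable_snd].
  by apply/funext => p; rewrite rV_consS.
rewrite (_ : (fun _ => _) = fst); first exact: measurable_fst.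
by apply/funext => p; rewrite rV_cons0.
Qed.

Definition rV_uncons n (v : 'rV[R]_n.+1) : measurableTypeR R * 'rV[R]_n :=
  (v ord0 ord0, \row_i v ord0 (lift ord0 i)).

Lemma rV_consK n : cancel (@rV_cons n) (@rV_uncons n).
Proof.
move=> [x v]; rewrite /rV_uncons rV_cons0; congr pair.
by apply/rowP => i; rewrite mxE rV_consS.
Qed.

Lemma measurable_rV_uncons n : measurable_fun setT (@rV_uncons n).
Proof.
apply/measurable_fun_pairP; split; first exact: measurable_coord.
apply: measurable_fun_rV => i.
rewrite (_ : (fun _ => _) = (fun v : 'rV[R]_n.+1 => v ord0 (lift ord0 i))).
  exact: measurable_coord.
by apply/funext => v; rewrite /= mxE.
Qed.

Section step.
Context (n : nat) (mu : {sigma_finite_measure set 'rV[R]_n -> \bar R}).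
Local Open Scope ereal_scope.

Definition lebesgue_rV_step : set 'rV[R]_n.+1 -> \bar R :=
  pushforward (lebesgue_measure \x mu) (@rV_cons n).

Let step0 : lebesgue_rV_step set0 = 0.
Proof. by rewrite /lebesgue_rV_step /pushforward preimage_set0 measure0. Qed.

Let step_ge0 A : 0 <= lebesgue_rV_step A.
Proof. by rewrite /lebesgue_rV_step /pushforward measure_ge0. Qed.

Let step_sigma_additive : semi_sigma_additive lebesgue_rV_step.
Proof.
have mpre (A : set 'rV[R]_n.+1) : measurable A ->
    measurable (@rV_cons n @^-1` A).
  by move=> mA; rewrite -[X in measurable X]setTI; exact: measurable_rV_cons.
move=> F mF tF mUF; rewrite /lebesgue_rV_step /pushforward preimage_bigcup.
apply: measure_semi_sigma_additive.
- by move=> i; exact: mpre.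
- apply/trivIsetP => /= i j _ _ ij; rewrite -preimage_setI.
  by move/trivIsetP : tF => /(_ _ _ _ _ ij) ->//; rewrite preimage_set0.
- by rewrite -preimage_bigcup; exact: mpre.
Qed.

HB.instance Definition _ := isMeasure.Build _ _ _ lebesgue_rV_step
  step0 step_ge0 step_sigma_additive.

Let step_sigma_finite : sigma_finite setT lebesgue_rV_step.
Proof.
have /sigma_finiteP[F [TF ndF Foo]] :=
  sigma_finiteT (@lebesgue_measure R : {sigma_finite_measure set _ -> \bar R}).
have /sigma_finiteP[G [TG ndG Goo]] := sigma_finiteT mu.
exists (fun k => @rV_uncons n @^-1` (F k `*` G k)).
  rewrite -preimage_bigcup -(preimage_setT (@rV_uncons n)); congr (_ @^-1` _).
  rewrite -setXTT TF TG predeqE => -[x y]; split.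
    move=> [/= [k _ Fkx] [l _ Gly]]; exists (maxn k l) => //; split.
    - by move: x Fkx; exact/subsetPset/ndF/leq_maxl.
    - by move: y Gly; exact/subsetPset/ndG/leq_maxr.
  by move=> [k _ []/= ? ?]; split; exists k.
move=> k; have [? ?] := Foo k; have [? ?] := Goo k; split.
  rewrite -[X in measurable X]setTI; apply: measurable_rV_uncons => //.
  exact: measurableX.
rewrite /lebesgue_rV_step /pushforward -comp_preimage.
rewrite (_ : _ \o _ = id); last by apply/funext => p /=; rewrite rV_consK.
by rewrite product_measure1E// lte_mul_pinfty// ge0_fin_numE.
Qed.

HB.instance Definition _ := @Measure_isSigmaFinite.Build _ _ _
  lebesgue_rV_step step_sigma_finite.

End step.

Fixpoint lebesgue_rV n : {sigma_finite_measure set 'rV[R]_n -> \bar R} :=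
  match n with
  | 0 => dirac (0 : 'rV[R]_0)
  | n'.+1 => lebesgue_rV_step (lebesgue_rV n')
  end.

Lemma lebesgue_rV_box n (a b : 'rV[R]_n) :
  (forall i, a ord0 i <= b ord0 i) ->
  lebesgue_rV n [set v : 'rV[R]_n | forall i, a ord0 i <= v ord0 i <= b ord0 i] =
  (\prod_(i < n) (b ord0 i - a ord0 i))%:E.
Proof.
elim: n a b => [|n IHn] a b ab /=.
  rewrite big_ord0 /dirac indicE mem_set//.
  by case.
rewrite big_ord_recl EFinM.
rewrite /lebesgue_rV_step /pushforward.
pose a' : 'rV[R]_n := (rV_uncons a).2; pose b' : 'rV[R]_n := (rV_uncons b).2.
rewrite (_ : _ @^-1` _ = `[a ord0 ord0, b ord0 ord0] `*`
    [set v : 'rV[R]_n | forall i, a' ord0 i <= v ord0 i <= b' ord0 i]).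
  rewrite product_measure1E/=; last 2 first.
  - exact: measurable_itv.
  - rewrite (_ : mkset _ = \bigcap_(i in [set: 'I_n])
        ((fun v : 'rV[R]_n => v ord0 i) @^-1` `[a' ord0 i, b' ord0 i])).
      apply: fin_bigcap_measurable => // i _.
      rewrite -[X in measurable X]setTI.
      exact: (@measurable_coord R n i measurableT _ (measurable_itv _)).
    apply/seteqP; split=> v /= abv i; last first.
      by have := abv i I; rewrite /= in_itv.
    by move=> _; rewrite /= in_itv; exact: abv.
  congr mule.
    rewrite lebesgue_measure_itv/= lte_fin; case: ltP => // ba.
    by rewrite (@le_anti _ _ (a ord0 ord0) (b ord0 ord0)) ?subrr// ab ba.
  rewrite IHn; last by move=> i; rewrite !mxE.
  by congr EFin; apply: eq_bigr => i _; rewrite !mxE.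
apply/seteqP; split=> -[x v] /=.
  move=> abv; split; first by have := abv ord0; rewrite rV_cons0 in_itv.
  by move=> i; have := abv (lift ord0 i); rewrite rV_consS !mxE.
rewrite in_itv/= => -[abx abv] i; case: (unliftP ord0 i) => [j|] ->.
  by rewrite rV_consS; have := abv j; rewrite !mxE.
by rewrite rV_cons0.
Qed.

End lebesgue_rV.

Section fractional_sobolev.
Context {R : realType} (d : nat).
Implicit Types (x y : 'rV[R]_d) (U D O : set 'rV[R]_d) (f : 'rV[R]_d -> R).

Local Notation mu := (lebesgue_rV d).

(* The norm `|x| that the library puts on 'rV[R]_d is the sup norm; it induces
   the same topology, so open and closure below are the usual ones. *)
Definition enorm x : R := Num.sqrt (\sum_(i < d) x ord0 i ^+ 2).

Definition eball x (r : R) : set 'rV[R]_d := [set y | enorm (x - y) < r].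

Definition boundary O : set 'rV[R]_d := closure O `\` interior O.

Local Open Scope ereal_scope.

Definition edist_set D x : \bar R := ereal_inf [set (enorm (x - z))%:E | z in D].

Definition interior_thick O D : Prop :=
  exists2 c : R, (0 < c)%R & forall x r, (boundary O `\` D) x ->
    (0 < r <= 1)%R -> c%:E * mu (eball x r) <= mu (eball x r `&` O).

Definition Lp_norm (p : R) U f : \bar R :=
  (\int[mu]_(x in U) (`|f x| `^ p)%:E) `^ p^-1.

(* On the diagonal the integrand is 0 / 0 = 0. *)
Definition Wsp_seminorm (s p : R) U f : \bar R :=
  (\int[mu]_(x in U) \int[mu]_(y in U `&` eball x 1)
     (`|f x - f y| `^ p / enorm (x - y) `^ (s * p + d%:R))%:E) `^ p^-1.

(* With the library's inverse on \bar R, 0^-1 = +oo and +oo^-1 = 0; a negative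
   exponent would not do, since 0 `^ r = 0 for every r != 0. *)
Definition weighted_Lp_norm (s p : R) D U f : \bar R :=
  (\int[mu]_(x in U) ((`|f x| `^ p)%:E * (edist_set D x `^ (s * p))^-1)) `^ p^-1.

Definition Wsp_norm (s p : R) U f : \bar R :=
  Lp_norm p U f + Wsp_seminorm s p U f.

Definition WspD_norm (s p : R) D U f : \bar R :=
  Wsp_norm s p U f + weighted_Lp_norm s p D U f.

(* A function on U is represented by a total function whose values outside U
   are irrelevant; representatives of the same class of L^p(U) are those with
   f = g %[ae lebesgue_rV d in U]. *)
Definition Lp_space (p : R) U : set ('rV[R]_d -> R) :=
  [set f | measurable_fun U f /\ Lp_norm p U f < +oo].

Definition Wsp (s p : R) U : set ('rV[R]_d -> R) :=
  [set f | Lp_space p U f /\ Wsp_seminorm s p U f < +oo].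

Definition WspD (s p : R) D U : set ('rV[R]_d -> R) :=
  [set f | Wsp s p U f /\ weighted_Lp_norm s p D U f < +oo].

End fractional_sobolev.

(* Main.v *)
Require Import Defs.
From mathcomp Require Import all_boot all_order all_algebra.
From mathcomp Require Import all_classical all_reals all_analysis.
From mathcomp Require Import measurable_realfun ring lra.
Import Order.TTheory GRing.Theory Num.Theory.
Import numFieldNormedType.Exports.
Local Open Scope classical_set_scope.
Local Open Scope ring_scope.
Set Implicit Arguments.
Unset Strict Implicit.
Unset Printing Implicit Defensive.

(** The extension keeps f on O and is an average of f at a variable scale
    outside. Let G be the part of the boundary of O outside D, and
    g = min (dist (., G)) 1, h = min (dist (., D)) (1/100). Where h <= g the
    extension is 0: such points are controlled by the weight d_D^{-sp}. Where
    0 < g < h, a point x sees G before it sees D, and the thickness of O at G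
    says that O fills a fixed proportion of the ball B(x, 3 g(x)). There the
    extension is a Lipschitz average, at scale g(x), of values that best
    approximate f on pieces of O of size g(x) near x. The points with g = 0
    form a null set, because they lie outside O while O has density bounded
    below at each of them.

    For p >= 1 the approximating value on a piece is the mean of f, hence the
    linearity; for p < 1, where f need not be integrable, it is any value whose
    mean deviation from f is at most the mean oscillation of f; one exists, as
    otherwise every value f(w) would do strictly worse than the average over w
    (near_value_nonempty).

    The proof that the norm is bounded compares everything with the energy
      J + B = [f]^p on O x O  +  int_O |f|^p h^{-sp}.
    A local error err(x), built from the oscillation of f on O in B(x, 6 g(x))
    and, close to D, from its size there, controls both the deviation of the
    extension at x from f (extend_dev) and its Lipschitz constant at scale g(x)
    (extend_lip). Integrated against g^{-sp} over the set where 0 < g < h, it is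
    at most a multiple of the energy (err_energy): for a pair w, w' in O the x
    that see both satisfy g(x) >= max(|w - w'|, |x - w|) / 12, so that the
    integral in x is a convergent tail.

    To compare the value at x with f at far away points, f near x must be
    replaced by actual values of f without overloading any point of O. This is
    the task of the shadows: S(x) is a subset of O in B(x, 3 g(x)) with
    measure at least a multiple of g(x)^d (shadow_volume), such that no w in O
    lies in the shadows of too many x, measured by g(x)^{-d} dx
    (shadow_overlap). It consists of the w that few smaller balls have already
    used; by a packing estimate at least half of the available volume qualifies. It takes the place
    of a family of disjoint reflected cubes.

    The double integral of the extension is then split by position of the pair
    x, y (pair_cases). If h(x) or h(y) is at most comparable to |x - y|, both
    are, and the weight bounds each of the two values separately (far_energy).
    Otherwise a pair in O x O belongs to J, a pair x outside, y inside has
    g(x) <= |x - y| because the segment meets the boundary, and shadows turn it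
    into pairs of O x O (cross_energy); two outside points are either close at
    scale g(x) (near_energy), or shadows turn the pair into one of the previous
    kind (both_energy), or the extension vanishes at both. *)

(** * Integrals, indicators and the Euclidean norm *)

(** Indicators as ring elements: case distinctions under an integral become
    factors, of which measurability and sign are decided by the syntax. *)
Notation "\1[ b ]" := (GRing.natmul (GRing.one _) (nat_of_bool b%R))
  (at level 0, b at level 200, format "\1[ b ]") : ring_scope.

Section integral_tools.
Context d (T : measurableType d) (R : realType).
Local Open Scope ereal_scope.

(** A simple function below f is below g, so that this holds for all nonnegative
    functions; almost all upper bounds below can thus be checked pointwise. *)
Lemma integral_le (mu : {measure set T -> \bar R}) (f g : T -> \bar R) :
  (forall x, 0 <= f x) -> (forall x, f x <= g x) ->
  \int[mu]_x f x <= \int[mu]_x g x.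
Proof.
move=> f0 fg.
rewrite !ge0_integralTE//; last by move=> x; apply: le_trans (fg x).
apply: le_ereal_sup => _ [h hf <-]; exists h => // x.
by apply: le_trans (fg x).
Qed.

Lemma integral_scale (mu : {measure set T -> \bar R}) (k : R) (f : T -> \bar R) :
  measurable_fun setT f -> (0 <= k)%R -> (forall x, 0 <= f x) ->
  \int[mu]_x (k%:E * f x) = k%:E * \int[mu]_x f x.
Proof. by move=> mf k0 f0; rewrite ge0_integralZl//. Qed.

Lemma integral_add (mu : {measure set T -> \bar R}) (f g : T -> \bar R) :
  measurable_fun setT f -> measurable_fun setT g ->
  (forall x, 0 <= f x) -> (forall x, 0 <= g x) ->
  \int[mu]_x (f x + g x) = \int[mu]_x f x + \int[mu]_x g x.
Proof. by move=> mf mg f0 g0; rewrite ge0_integralD//. Qed.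

Lemma measurable_fun_ind (b : T -> bool) :
  measurable_fun setT b -> measurable_fun setT (fun x => \1[b x] : R).
Proof.
move=> mb; rewrite (_ : (fun _ => _) = fun x => if b x then 1%R else 0%R).
  by apply: measurable_fun_ifT => //; exact: measurable_cst.
by apply/funext => x; case: (b x).
Qed.

Lemma measurable_fun_mem (A : set T) :
  measurable A -> measurable_fun setT (fun x => x \in A).
Proof.
move=> mA; apply: (measurable_fun_bool true); rewrite setTI.
by rewrite (_ : _ @^-1` _ = A)//; apply/seteqP; split => x /=; [move/set_mem|move/mem_set].
Qed.

Lemma measurable_bool_set (b : T -> bool) :
  measurable_fun setT b -> measurable [set x | b x].
Proof.
move=> mb; rewrite -[X in measurable X]setTI.
exact: (mb measurableT [set true]).
Qed.

Lemma measurable_fun_powRc (f : T -> R) (a : R) :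
  measurable_fun setT f -> measurable_fun setT (fun x => f x `^ a)%R.
Proof. by move=> mf; exact: (measurableT_comp (measurable_powR a)). Qed.

Lemma measurable_fun_norm (f : T -> R) :
  measurable_fun setT f -> measurable_fun setT (fun x => `|f x|)%R.
Proof. by move=> mf; apply: measurableT_comp. Qed.

Lemma measurable_fun_EFin (f : T -> R) :
  measurable_fun setT f -> measurable_fun setT (fun x => (f x)%:E).
Proof. by move=> mf; apply: measurableT_comp. Qed.

End integral_tools.

Section tonelli_tools.
Context d1 d2 (U : measurableType d1) (T : measurableType d2) (R : realType).
Local Open Scope ereal_scope.
Implicit Types mu : {sigma_finite_measure set T -> \bar R}.

Lemma measurable_fun_integral mu (F : U -> T -> \bar R) :
  measurable_fun setT (fun p : U * T => F p.1 p.2) ->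
  (forall u y, 0 <= F u y) ->
  measurable_fun setT (fun u => \int[mu]_y F u y).
Proof.
move=> mF F0.
exact: (measurable_fun_fubini_tonelli_F (fun p : U * T => F p.1 p.2)).
Qed.

Lemma integral_swap (nu : {sigma_finite_measure set U -> \bar R}) mu
    (F : U -> T -> \bar R) :
  measurable_fun setT (fun p : U * T => F p.1 p.2) ->
  (forall u y, 0 <= F u y) ->
  \int[nu]_x \int[mu]_y F x y = \int[mu]_y \int[nu]_x F x y.
Proof.
move=> mF F0.
exact: (fubini_tonelli (fun p : U * T => F p.1 p.2)).
Qed.

Lemma measurable_fun_fst_comp d3 (V : measurableType d3) (a : V -> U * T) :
  measurable_fun setT a -> measurable_fun setT (fun v => (a v).1).
Proof. by move=> ma; exact: (measurableT_comp measurable_fst). Qed.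

Lemma measurable_fun_snd_comp d3 (V : measurableType d3) (a : V -> U * T) :
  measurable_fun setT a -> measurable_fun setT (fun v => (a v).2).
Proof. by move=> ma; exact: (measurableT_comp measurable_snd). Qed.

End tonelli_tools.

Section enorm_theory.
Context {R : realType} {d : nat}.
Implicit Types x y z : 'rV[R]_d.

Lemma enorm_ge0 x : 0 <= enorm x.
Proof. exact: sqrtr_ge0. Qed.

Lemma enorm0 : enorm (0 : 'rV[R]_d) = 0.
Proof.
by rewrite /enorm big1 ?sqrtr0// => i _; rewrite mxE expr0n.
Qed.

Lemma enormN x : enorm (- x) = enorm x.
Proof. by rewrite /enorm; under eq_bigr do rewrite mxE sqrrN. Qed.

Lemma enormC x y : enorm (x - y) = enorm (y - x).
Proof. by rewrite -enormN opprB. Qed.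

Lemma sum_sqr_ge0 x : 0 <= \sum_(i < d) x ord0 i ^+ 2.
Proof. by apply: sumr_ge0 => i _; exact: sqr_ge0. Qed.

Lemma sqr_enorm x : enorm x ^+ 2 = \sum_(i < d) x ord0 i ^+ 2.
Proof. by rewrite sqr_sqrtr// sum_sqr_ge0. Qed.

Lemma le_coord_enorm x i : `|x ord0 i| <= enorm x.
Proof.
rewrite -sqrtr_sqr ler_sqrt ?sum_sqr_ge0// (bigD1 i)//= lerDl.
by apply: sumr_ge0 => j _; exact: sqr_ge0.
Qed.

Lemma enorm_eq0 x : enorm x = 0 -> x = 0.
Proof.
move=> x0; apply/rowP => i; rewrite mxE; apply/eqP.
by rewrite -normr_le0 -x0 le_coord_enorm.
Qed.

Lemma cauchy_schwarz x y :
  \sum_(i < d) x ord0 i * y ord0 i <= enorm x * enorm y.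
Proof.
have [x0|xN0] := eqVneq (enorm x) 0.
  rewrite x0 mul0r big1// => i _.
  by rewrite (enorm_eq0 x0) mxE mul0r.
have [y0|yN0] := eqVneq (enorm y) 0.
  rewrite y0 mulr0 big1// => i _.
  by rewrite (enorm_eq0 y0) mxE mulr0.
have a0 : 0 < enorm x by rewrite lt_neqAle eq_sym xN0 enorm_ge0.
have b0 : 0 < enorm y by rewrite lt_neqAle eq_sym yN0 enorm_ge0.
have : 0 <= \sum_(i < d) (enorm y * x ord0 i - enorm x * y ord0 i) ^+ 2.
  by apply: sumr_ge0 => i _; exact: sqr_ge0.
have -> : \sum_(i < d) (enorm y * x ord0 i - enorm x * y ord0 i) ^+ 2 =
    enorm y ^+ 2 * (\sum_(i < d) x ord0 i ^+ 2) +
    enorm x ^+ 2 * (\sum_(i < d) y ord0 i ^+ 2) -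
    2 * enorm x * enorm y * (\sum_(i < d) x ord0 i * y ord0 i).
  rewrite !mulr_sumr -big_split/= -sumrB; apply: eq_bigr => i _; ring.
rewrite -!sqr_enorm.
have ab : 0 < enorm x * enorm y by rewrite mulr_gt0.
move=> h; rewrite -(ler_pM2l ab).
nra.
Qed.

Lemma enormD x y : enorm (x + y) <= enorm x + enorm y.
Proof.
rewrite -(@ler_pXn2r _ 2)// ?nnegrE ?enorm_ge0 ?addr_ge0 ?enorm_ge0//.
rewrite sqr_enorm.
have -> : \sum_(i < d) (x + y) ord0 i ^+ 2 =
    \sum_(i < d) x ord0 i ^+ 2 + \sum_(i < d) y ord0 i ^+ 2 +
    2 * (\sum_(i < d) x ord0 i * y ord0 i).
  rewrite mulr_sumr -!big_split/=; apply: eq_bigr => i _; rewrite !mxE; ring.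
rewrite -!sqr_enorm; have := cauchy_schwarz x y; nra.
Qed.

Lemma enorm_triangle y x z : enorm (x - z) <= enorm (x - y) + enorm (y - z).
Proof.
by rewrite (_ : x - z = (x - y) + (y - z)) ?enormD// addrA subrK.
Qed.

Lemma enormZ (t : R) x : enorm (t *: x) = `|t| * enorm x.
Proof.
rewrite /enorm -sqrtr_sqr -sqrtrM ?sqr_ge0// mulr_sumr; congr Num.sqrt.
by apply: eq_bigr => i _; rewrite mxE exprMn.
Qed.

Lemma enorm_le_coord x (r : R) : 0 <= r ->
  (forall i, `|x ord0 i| <= r) -> enorm x <= d.+1%:R * r.
Proof.
move=> r0 xr.
rewrite -(@ler_pXn2r _ 2)// ?nnegrE ?enorm_ge0 ?mulr_ge0//.
rewrite sqr_enorm; apply: (@le_trans _ _ (\sum_(i < d) r ^+ 2)).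
  apply: ler_sum => i _; rewrite -[leLHS]real_normK ?num_real//.
  by rewrite ler_pXn2r// nnegrE.
rewrite sumr_const card_ord exprMn -[leLHS]mulr_natl ler_wpM2r ?sqr_ge0//.
rewrite -natrX ler_nat expnS expn1; apply: (@leq_trans d.+1) => //.
by rewrite leq_pmulr.
Qed.

Lemma measurable_fun_enorm d' (U : measurableType d') (a b : U -> 'rV[R]_d) :
  measurable_fun setT a -> measurable_fun setT b ->
  measurable_fun setT (fun u => enorm (a u - b u)).
Proof.
move=> ma mb.
rewrite (_ : (fun _ => _) = fun u =>
    (\sum_(i < d) (a u ord0 i - b u ord0 i) ^+ 2) `^ 2^-1); last first.
  apply/funext => u; rewrite powR12_sqrt; first by
    rewrite /enorm; under eq_bigr do rewrite !mxE.
  by apply: sumr_ge0 => i _; exact: sqr_ge0.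
apply: measurable_fun_powRc; apply: measurable_sum => i.
apply: measurable_funX; apply: measurable_funB.
  exact: (measurableT_comp (measurable_coord i)).
exact: (measurableT_comp (measurable_coord i)).
Qed.

Lemma measurable_fun_enorm1 d' (U : measurableType d') (a : U -> 'rV[R]_d) :
  measurable_fun setT a -> measurable_fun setT (fun u => enorm (a u)).
Proof.
move=> ma; have := measurable_fun_enorm ma (measurable_cst (0 : 'rV[R]_d)).
by congr (measurable_fun _ _); apply/funext => u; rewrite /cst subr0.
Qed.

Lemma enorm_lip_continuous (f : 'rV[R]_d -> R) :
  (forall x y, `|f x - f y| <= enorm (x - y)) -> continuous f.
Proof.
move=> lf x; apply/(@cvgrPdist_lt R R^o _ (nbhs x) (nbhs_filter x)) => e e0.
have e'0 : 0 < e / d.+1%:R / 2 by rewrite !divr_gt0.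
apply/nbhs_ballP; exists (e / d.+1%:R / 2) => //= y [_ xy].
apply: (le_lt_trans (lf _ _)).
have : enorm (x - y) <= d.+1%:R * (e / d.+1%:R / 2).
  apply: enorm_le_coord; first exact: ltW.
  by move=> i; rewrite !mxE; have := xy ord0 i; rewrite /ball/= => /ltW.
move=> /le_lt_trans; apply.
by rewrite mulrA mulrCA divff ?mulr1 ?pnatr_eq0// ltr_pdivrMr// ltr_pMr// ltr1n.
Qed.

End enorm_theory.

(** * Volumes of balls and integrals of kernels *)

Ltac meas_hyp :=
  match goal with H : measurable_fun _ _ |- _ => exact: H | _ => assumption end.

(** Measurability by descent through the expression; variables are found in
    the context. *)
Ltac meas :=
  lazymatch goal with
  | |- measurable_fun _ (fun u => EFin (@?ff u)) =>
      apply: (@measurable_fun_EFin _ _ _ ff); meas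
  | |- measurable_fun _ (fun u => adde (@?ff u) (@?gg u)) =>
      apply: (@emeasurable_funD _ _ _ _ ff gg); meas
  | |- measurable_fun _ (fun u => mule (@?ff u) (@?gg u)) =>
      apply: (@emeasurable_funM _ _ _ _ ff gg); meas
  | |- measurable_fun _ (fun u => GRing.add (@?ff u) (GRing.opp (@?gg u))) =>
      apply: (@measurable_funB _ _ _ _ ff gg); meas
  | |- measurable_fun _ (fun u => GRing.add (@?ff u) (@?gg u)) =>
      first [apply: (@emeasurable_funD _ _ _ _ ff gg)
            | apply: (@measurable_funD _ _ _ _ ff gg)]; meas
  | |- measurable_fun _ (fun u => GRing.mul (@?ff u) (@?gg u)) =>
      apply: (@measurable_funM _ _ _ _ ff gg); meas
  | |- measurable_fun _ (fun u => GRing.opp (@?ff u)) =>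
      apply: (@measurable_funN _ _ _ _ ff); meas
  | |- measurable_fun _ (fun u => Order.max (@?ff u) (@?gg u)) =>
      apply: (@measurable_maxr _ _ _ _ ff gg); meas
  | |- measurable_fun _ (fun u => Order.min (@?ff u) (@?gg u)) =>
      apply: (@measurable_minr _ _ _ _ ff gg); meas
  | |- measurable_fun _ (fun u => enorm (GRing.add (@?ff u) (GRing.opp (@?gg u)))) =>
      apply: (@measurable_fun_enorm _ _ _ _ ff gg); meas
  | |- measurable_fun _ (fun u => enorm (@?ff u)) =>
      apply: (@measurable_fun_enorm1 _ _ _ _ ff); meas
  | |- measurable_fun _ (fun u => powR (@?ff u) _) =>
      apply: (@measurable_fun_powRc _ _ _ ff); meas
  | |- measurable_fun _ (fun u => `| @?ff u |%R) =>
      apply: (@measurable_fun_norm _ _ _ ff); meas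
  | |- measurable_fun _ (fun u => GRing.natmul (GRing.one _) (nat_of_bool (@?bb u))) =>
      apply: (@measurable_fun_ind _ _ _ bb); meas
  | |- measurable_fun _ (fun u => andb (@?ff u) (@?gg u)) =>
      apply: (@measurable_and _ _ _ ff gg); meas
  | |- measurable_fun _ (fun u => orb (@?ff u) (@?gg u)) =>
      apply: (@measurable_or _ _ _ ff gg); meas
  | |- measurable_fun _ (fun u => negb (@?ff u)) =>
      apply: (@measurable_neg _ _ _ ff); meas
  | |- measurable_fun _ (fun u => Order.lt (@?ff u) (@?gg u)) =>
      apply: (@measurable_fun_ltr _ _ _ _ ff gg); meas
  | |- measurable_fun _ (fun u => Order.le (@?ff u) (@?gg u)) =>
      apply: (@measurable_fun_ler _ _ _ _ ff gg); meas
  | |- measurable_fun _ (fun u => fst (@?ff u)) =>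
      apply: (@measurable_fun_fst_comp _ _ _ _ _ _ ff); meas
  | |- measurable_fun _ (fun u => snd (@?ff u)) =>
      apply: (@measurable_fun_snd_comp _ _ _ _ _ _ ff); meas
  | |- measurable_fun _ (fun u => u) => exact: measurable_id
  | |- measurable_fun _ (fun u => in_mem (@?ff u) (mem ?A)) =>
      apply: (@measurableT_comp _ _ _ _ _ _ (fun x => x \in A) _ ff);
      [apply: measurable_fun_mem; try assumption | meas]
  | |- measurable_fun _ (fun u => integral _ _ (fun y => @?F u y)) =>
      apply: (@measurable_fun_integral _ _ _ _ _ _ F); [meas | ]
  | |- measurable_fun _ _ =>
      first [ exact: measurable_cst | meas_hyp
            | lazymatch goal with |- measurable_fun _ (fun u => ?kk (@?ff u)) =>
                apply: (@measurableT_comp _ _ _ _ _ _ kk _ ff); [meas_hyp | meas]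
              end
            | idtac ]
  | |- _ => idtac
  end.

(** Nonnegativity by descent through the expression. *)
Ltac nn :=
  lazymatch goal with
  | |- forall _, _ => move=> ?; nn
  | |- is_true (Order.le _ (EFin _)) => rewrite lee_fin; nn
  | |- is_true (Order.le _ (mule _ _)) => apply: mule_ge0; nn
  | |- is_true (Order.le _ (adde _ _)) => apply: adde_ge0; nn
  | |- is_true (Order.le _ (integral _ _ _)) => apply: integral_ge0 => ? _; nn
  | |- is_true (Order.le _ (GRing.mul _ _)) => apply: mulr_ge0; nn
  | |- is_true (Order.le _ (GRing.add _ (GRing.opp _))) => first [assumption | by []]
  | |- is_true (Order.le _ (GRing.add _ _)) =>
      first [apply: adde_ge0 | apply: addr_ge0]; nn
  | |- is_true (Order.le _ (GRing.exp _ _)) => apply: exprn_ge0; nn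
  | |- is_true (Order.le _ (GRing.inv _)) => rewrite invr_ge0; nn
  | |- is_true (Order.le _ (powR _ _)) => exact: powR_ge0
  | |- is_true (Order.le _ (enorm _)) => exact: enorm_ge0
  | |- is_true (Order.le _ (Num.norm _)) => exact: normr_ge0
  | |- is_true (Order.le _ (GRing.natmul (GRing.one _) _)) => exact: ler0n
  | |- is_true (Order.le _ _) =>
      first [ match goal with H : ?P |- ?P => exact: H end
            | match goal with H : is_true (Order.lt ?a ?b)
                |- is_true (Order.le ?a ?b) => exact: (ltW H) end
            | match goal with H : forall _, is_true _ |- _ => exact: H end
            | match goal with H : forall _ _, is_true _ |- _ => exact: H end
            | by []
            | idtac ]
  | |- _ => idtac
  end.

Ltac int_scale := rewrite integral_scale; [|by meas; nn|by nn|by nn].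
Ltac int_add := rewrite integral_add; [|by meas; nn|by meas; nn|by nn|by nn].

Section volume.
Context {R : realType} {d : nat}.
Implicit Types x y z : 'rV[R]_d.
Local Notation T := 'rV[R]_d.
Local Notation mu := (lebesgue_rV d : {sigma_finite_measure set T -> \bar R}).

Lemma eball_mem x y (r : R) : (y \in eball x r) = (enorm (x - y) < r).
Proof. by apply/idP/idP => [/set_mem|h]; last exact: mem_set. Qed.

Lemma measurable_eball x (r : R) : measurable (eball x r).
Proof.
rewrite -[eball x r]setTI.
rewrite (_ : eball x r = (fun y => enorm (x - y) < r) @^-1` [set true]).
  suff : measurable_fun setT (fun y => enorm (x - y) < r) by exact.
  by meas.
by apply/seteqP; split => y.
Qed.

(** The ball is contained in the cube of side 2 r. *)
Lemma eball_vol_le x (r : R) : 0 <= r ->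
  (mu (eball x r) <= ((2 * r) ^+ d)%:E)%E.
Proof.
move=> r0.
have h := @lebesgue_rV_box R d (x - const_mx r) (x + const_mx r) _.
apply: (@le_trans _ _ (mu [set v : T | forall i,
    (x - const_mx r) ord0 i <= v ord0 i <= (x + const_mx r) ord0 i])).
  apply: le_measure; rewrite ?inE.
  - exact: measurable_eball.
  - rewrite (_ : mkset _ = \bigcap_(i in [set: 'I_d])
        ((fun v : 'rV[R]_d => v ord0 i) @^-1`
          `[(x - const_mx r) ord0 i, (x + const_mx r) ord0 i])).
      apply: fin_bigcap_measurable => // i _.
      rewrite -[X in measurable X]setTI.
      exact: (@measurable_coord R d i measurableT _ (measurable_itv _)).
    apply/seteqP; split=> v /= abv i; last first.
      by have := abv i I; rewrite /= in_itv.
    by move=> _; rewrite /= in_itv; exact: abv.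
  - move=> y /= xy i; have := le_coord_enorm (x - y) i.
    rewrite !mxE => /le_lt_trans /(_ xy); rewrite ltr_norml => /andP[h1 h2].
    by apply/andP; split; lra.
rewrite h; last by move=> i; rewrite !mxE; lra.
rewrite lee_fin; under eq_bigr => i _.
  rewrite !mxE (_ : _ - _ = 2 * r); last by ring.
  over.
by rewrite prodr_const card_ord.
Qed.

(** The ball contains a cube, as the Euclidean norm is at most d + 1 times the
    largest coordinate. *)
Lemma eball_vol_ge x (r : R) : 0 < r ->
  (((r / d.+1%:R) ^+ d)%:E <= mu (eball x r))%E.
Proof.
move=> r0; set a := r / d.+1%:R / 2.
have a0 : 0 < a by rewrite !divr_gt0.
have h := @lebesgue_rV_box R d (x - const_mx a) (x + const_mx a) _.
apply: (@le_trans _ _ (mu [set v : T | forall i,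
    (x - const_mx a) ord0 i <= v ord0 i <= (x + const_mx a) ord0 i])).
  rewrite h; last by move=> i; rewrite !mxE; lra.
  rewrite lee_fin; under eq_bigr => i _.
    rewrite !mxE (_ : _ - _ = 2 * a); last by ring.
    over.
  rewrite prodr_const card_ord (_ : 2 * a = r / d.+1%:R)//.
  by rewrite /a mulrCA divff ?mulr1// pnatr_eq0.
apply: le_measure; rewrite ?inE.
- rewrite (_ : mkset _ = \bigcap_(i in [set: 'I_d])
      ((fun v : 'rV[R]_d => v ord0 i) @^-1`
        `[(x - const_mx a) ord0 i, (x + const_mx a) ord0 i])).
    apply: fin_bigcap_measurable => // i _.
    rewrite -[X in measurable X]setTI.
    exact: (@measurable_coord R d i measurableT _ (measurable_itv _)).
  apply/seteqP; split=> v /= abv i; last first.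
    by have := abv i I; rewrite /= in_itv.
  by move=> _; rewrite /= in_itv; exact: abv.
- exact: measurable_eball.
- move=> y /= xy.
  have : enorm (x - y) <= d.+1%:R * a.
    apply: enorm_le_coord; first exact: ltW.
    move=> i; rewrite !mxE; have := xy i; rewrite !mxE => /andP[h1 h2].
    by rewrite ler_norml; apply/andP; split; lra.
  move=> /le_lt_trans; apply; rewrite /a mulrA mulrCA divff ?pnatr_eq0// mulr1.
  lra.
Qed.

Lemma integral_ind_eball x (r : R) :
  (\int[mu]_y (\1[enorm (x - y) < r])%:E)%E = mu (eball x r).
Proof.
rewrite -[in RHS](setIT (eball x r)) -integral_indic//; last exact: measurable_eball.
by apply: eq_integral => y _; rewrite indicE eball_mem.
Qed.


Lemma nneseries_geometric_le (u : nat -> \bar R) (C q : R) :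
  0 <= C -> 0 < q < 1 -> (forall k, 0 <= u k)%E ->
  (forall k, u k <= (C * q ^+ k)%:E)%E ->
  (\sum_(k <oo) u k <= (C / (1 - q))%:E)%E.
Proof.
move=> C0 /andP[q0 q1] u0 uq.
apply: lime_le; first exact: is_cvg_nneseries.
apply: nearW => n.
apply: (@le_trans _ _ (\sum_(0 <= k < n) (C * q ^+ k)%:E)%E).
  by apply: lee_sum => k _.
rewrite sumEFin lee_fin.
have -> : \sum_(0 <= k < n) C * q ^+ k = series (geometric C q) n by [].
rewrite geometric_seriesE ?lt_eqF//.
apply: ler_wpM2r; first by rewrite invr_ge0 subr_ge0 ltW.
rewrite -[leRHS]mulr1 ler_wpM2l// gerBl exprn_ge0// ltW//.
Qed.

(** The form of the decompositions into dyadic shells: F is at most c k on a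
    part of the ball of radius t k, and these parts cover the support of F. *)
Lemma integral_le_eball_series (F : T -> R) x (c t : nat -> R) (C q : R) :
  0 <= C -> 0 < q < 1 -> (forall k, 0 <= c k) -> (forall k, 0 <= t k) ->
  (forall y, 0 <= F y) ->
  (forall y, F y = 0 \/ exists2 k, enorm (x - y) < t k & F y <= c k) ->
  (forall k, c k * (2 * t k) ^+ d <= C * q ^+ k) ->
  (\int[mu]_y (F y)%:E <= (C / (1 - q))%:E)%E.
Proof.
move=> C0 q01 c0 t0 F0 Fc ct.
pose u k y := (c k * \1[enorm (x - y) < t k])%:E : \bar R.
have u0 k y : (0 <= u k y)%E by rewrite lee_fin mulr_ge0.
have mu_ k : measurable_fun setT (u k) by rewrite /u; meas.
apply: (@le_trans _ _ (\int[mu]_y \sum_(k <oo) u k y)%E).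
  apply: integral_le => y; first by rewrite lee_fin.
  have [->|[k xy Fk]] := Fc y; first exact: nneseries_ge0.
  apply: (@le_trans _ _ (u k y)); first by rewrite /u xy mulr1 lee_fin.
  apply: le_trans (nneseries_lim_ge k.+1 _); last by move=> n _ _.
  rewrite big_nat_recr//=; apply: leeDr.
  by apply: sume_ge0 => i _.
rewrite integral_nneseries//.
apply: nneseries_geometric_le => // k; first by apply: integral_ge0 => y _.
rewrite /u; under eq_integral do rewrite EFinM.
rewrite integral_scale//; [|by meas].
rewrite integral_ind_eball; apply: (@le_trans _ _ ((c k)%:E * ((2 * t k) ^+ d)%:E)%E).
  by apply: lee_pmul => //; [rewrite lee_fin|exact: eball_vol_le].
by rewrite -EFinM lee_fin.
Qed.

Lemma dyadic_bracket (u : R) : 1 <= u -> exists k, 2 ^+ k <= u < 2 ^+ k.+1.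
Proof.
move=> u1.
have : exists k, u < 2 ^+ k.
  exists (Num.truncn u).+1; apply: (lt_trans (truncnS_gt u)).
  by rewrite -natrX ltr_nat ltn_expl.
move=> ex; case: (ex_minnP ex) => -[|k] uk kmin.
  by move: uk; rewrite expr0 ltNge u1.
exists k; rewrite uk andbT leNgt; apply/negP => /kmin.
by rewrite ltnn.
Qed.

Lemma powR_expn (a b : R) k : 0 <= a -> (a ^+ k) `^ b = (a `^ b) ^+ k.
Proof. by move=> a0; rewrite -powR_mulrn// powRAC powR_mulrn// powR_ge0. Qed.

Lemma powR_le_neg (a b e : R) : 0 < a -> a <= b -> e <= 0 -> b `^ e <= a `^ e.
Proof.
move=> a0 ab e0; rewrite -(opprK e) !(powRN _ (- e)).
rewrite lef_pV2 ?posrE ?powR_gt0//; last exact: lt_le_trans ab.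
by apply: ge0_ler_powR; rewrite ?nnegrE ?oppr_ge0// ltW// (lt_le_trans a0).
Qed.

Definition tail_cst (a : R) : R := 4 ^+ d / (1 - 2 `^ (- a)).

Lemma powR2N_lt1 (a : R) : 0 < a -> 0 < (2 : R) `^ (- a) < 1.
Proof.
move=> a0; rewrite powR_gt0//=.
rewrite powRN invf_lt1 ?powR_gt0//.
rewrite -[X in X < _](_ : 1 `^ a = 1); last by rewrite powR1.
by rewrite gt0_ltr_powR// ?nnegrE// ltr1n.
Qed.

Lemma tail_cst_ge0 (a : R) : 0 < a -> 0 <= tail_cst a.
Proof.
move=> /powR2N_lt1/andP[_ h]; rewrite /tail_cst divr_ge0 ?exprn_ge0//.
by rewrite subr_ge0 ltW.
Qed.

(** On the shell of the y with max rho |x - y| in [2^k rho, 2^(k+1) rho) the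
    integral is at most 4^d (2^k rho)^(-a), a geometric sequence. *)
Lemma integral_tail_kernel (a rho : R) x : 0 < a -> 0 < rho ->
  (\int[mu]_y ((Num.max rho (enorm (x - y)) `^ (- (a + d%:R)))%:E) <=
   (tail_cst a * rho `^ (- a))%:E)%E.
Proof.
move=> a0 r0.
rewrite (_ : tail_cst a * _ = (4 ^+ d * rho `^ (- a)) / (1 - 2 `^ (- a))); last first.
  by rewrite /tail_cst mulrAC.
have ad : - (a + d%:R) <= 0 by rewrite oppr_le0 addr_ge0// ltW.
apply: (@integral_le_eball_series _ x
  (fun k => (2 ^+ k * rho) `^ (- (a + d%:R))) (fun k => 2 ^+ k.+1 * rho)).
- by rewrite mulr_ge0 ?powR_ge0.
- exact: powR2N_lt1.
- by move=> k; exact: powR_ge0.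
- by move=> k; rewrite mulr_ge0// ltW.
- by move=> y; exact: powR_ge0.
- move=> y; right; set m := Num.max _ _.
  have rm : rho <= m by rewrite /m le_max lexx.
  have : 1 <= m / rho by rewrite ler_pdivlMr// mul1r.
  move=> /dyadic_bracket[k]; rewrite ler_pdivlMr// ltr_pdivrMr// => /andP[k1 k2].
  exists k; first by apply: le_lt_trans k2; rewrite /m le_max lexx orbT.
  by apply: powR_le_neg => //; rewrite mulr_gt0.
- move=> k; set t := 2 ^+ k * rho.
  have t0 : 0 < t by rewrite mulr_gt0.
  rewrite (_ : 2 * (2 ^+ k.+1 * rho) = 4 * t); last by rewrite /t exprS; ring.
  rewrite opprD powRD ?(gt_eqF t0) ?implybT//.
  rewrite exprMn (powRN t d%:R) powR_mulrn ?(ltW t0)//.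
  rewrite -mulrA [_^-1 * _]mulrCA mulVf ?mulr1 ?expf_neq0 ?gt_eqF//.
  rewrite /t powRM ?(ltW r0)// powR_expn//.
  by rewrite [leRHS](_ : _ = 2 `^ (- a) ^+ k * rho `^ (- a) * 4 ^+ d)//; ring.
Qed.

(** Shells of radius 2^-k rho; the sequence is geometric because p > q. *)
Lemma integral_near_kernel (p q rho : R) x : 0 < q < p -> 0 < rho ->
  (\int[mu]_y ((\1[enorm (x - y) < rho] * enorm (x - y) `^ p *
       enorm (x - y) `^ (- (q + d%:R)))%:E) <=
   (tail_cst (p - q) * 2 `^ p * rho `^ (p - q))%:E)%E.
Proof.
move=> /andP[q0 qp] r0.
rewrite (_ : tail_cst (p - q) * _ * _ =
  (4 ^+ d * 2 `^ p * rho `^ (p - q)) / (1 - 2 `^ (- (p - q)))); last first.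
  by rewrite /tail_cst; ring.
have ad : - (q + d%:R) <= 0 by rewrite oppr_le0 addr_ge0// ltW.
have p0 : 0 < p by exact: lt_trans qp.
have h2 : 0 < 2^-1 :> R by rewrite invr_gt0.
apply: (@integral_le_eball_series _ x
  (fun k => (2 * (2^-1 ^+ k.+1 * rho)) `^ p *
            (2^-1 ^+ k.+1 * rho) `^ (- (q + d%:R)))
  (fun k => 2 * (2^-1 ^+ k.+1 * rho))).
- by rewrite !mulr_ge0 ?powR_ge0.
- by apply: powR2N_lt1; rewrite subr_gt0.
- by move=> k; rewrite mulr_ge0 ?powR_ge0.
- by move=> k; rewrite !mulr_ge0 ?(ltW r0)// exprn_ge0// ltW.
- by move=> y; rewrite !mulr_ge0 ?powR_ge0.
- move=> y; set m := enorm _.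
  have [mr|] := ltP m rho; last by rewrite !mul0r; left.
  have : 0 <= m by exact: enorm_ge0.
  rewrite le_eqVlt => /predU1P[<-|m0].
    by rewrite powR0 ?gt_eqF// mulr0 mul0r; left.
  right.
  have : 1 <= rho / m by rewrite ler_pdivlMr// mul1r ltW.
  move=> /dyadic_bracket[k]; rewrite ler_pdivlMr// ltr_pdivrMr// => /andP[k1 k2].
  have e1 : m * 2 ^+ k <= rho by rewrite mulrC.
  have e2 : 2^-1 ^+ k.+1 * rho < m.
    by rewrite exprVn mulrC ltr_pdivrMr ?exprn_gt0// mulrC.
  have e3 : m <= 2 * (2^-1 ^+ k.+1 * rho).
    rewrite exprS !mulrA divff// mul1r exprVn mulrC ler_pdivlMr ?exprn_gt0//.
  (* The balls are open: a point on the outer sphere of its shell is moved to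
     the preceding shell. *)
  have [e3'|e3'] := eqVneq m (2 * (2^-1 ^+ k.+1 * rho)); last first.
    exists k; first by rewrite lt_neqAle e3' e3.
    rewrite mul1r ler_pM ?powR_ge0//.
      by apply: ge0_ler_powR; rewrite ?nnegrE ?(ltW p0)// ?(ltW m0)// (le_trans (ltW m0)).
    by apply: powR_le_neg => //; [rewrite mulr_gt0// exprn_gt0|exact: ltW].
  have k0 : (0 < k)%N.
    rewrite lt0n; apply/negP => /eqP k0; move: e3' mr.
    by rewrite k0 expr1 mulrA divff// mul1r => ->; rewrite ltxx.
  case: k k0 k1 k2 e1 e2 e3 e3' => // k _ k1 k2 e1 e2 e3 e3'.
  have e4 : m = 2^-1 ^+ k.+1 * rho.
    by rewrite e3' [in LHS]exprS !mulrA divff// mul1r.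
  exists k; first by rewrite -e4 ltr_pMl// ltr1n.
  rewrite -e4 mul1r ler_pM ?powR_ge0//.
  by apply: ge0_ler_powR; rewrite ?nnegrE ?(ltW p0)// ?(ltW m0)// ?mulr_ge0 ?(ltW m0)// ler_pMl// ler1n.
- move=> k; set t := 2^-1 ^+ k.+1 * rho.
  have t0 : 0 < t by rewrite mulr_gt0// exprn_gt0.
  rewrite opprD (@powRD _ t) ?(gt_eqF t0) ?implybT//.
  rewrite (@powRM _ _ _ p) ?(ltW t0)//.
  rewrite (_ : 2 * (2 * t) = 4 * t); last by ring.
  rewrite exprMn (powRN t d%:R) powR_mulrn ?(ltW t0)//.
  rewrite (_ : _ * _ * _ = 4 ^+ d * 2 `^ p * (t `^ p * t `^ (- q))); last first.
    by field; rewrite expf_neq0 ?gt_eqF.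
  rewrite -powRD ?(gt_eqF t0) ?implybT// -!mulrA !ler_wpM2l ?powR_ge0//.
  have pq : 0 <= p - q by rewrite subr_ge0 ltW.
  rewrite /t (@powRM _ _ _ (p - q)) ?(ltW r0) ?exprn_ge0 ?(ltW h2)//.
  rewrite [leRHS]mulrC ler_wpM2r ?powR_ge0//.
  rewrite powR_expn ?(ltW h2)// -powR_inv1// -powRrM mulN1r.
  rewrite exprS ger_pMl ?exprn_gt0 ?powR_gt0//.
  have /powR2N_lt1/andP[_ /ltW//] : 0 < p - q by rewrite subr_gt0.
Qed.

End volume.

(** * Truncated distances and thickness *)

Section distance.
Context {R : realType} {d : nat}.
Local Notation T := 'rV[R]_d.
Local Notation mu := (lebesgue_rV d : {sigma_finite_measure set T -> \bar R}).
Implicit Types (x y z : T) (S : set T) (r : R).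

(** Truncation makes the distance to an arbitrary set, the empty one included,
    a real-valued 1-Lipschitz function. *)
Definition tdist r S x : R := fine (mine (edist_set S x) r%:E).

Lemma edist_set_ge0 S x : (0 <= edist_set S x)%E.
Proof. by apply: le_ereal_inf_tmp => _ [z _ <-]; rewrite lee_fin enorm_ge0. Qed.

Lemma tdistE r S x : 0 <= r -> (tdist r S x)%:E = mine (edist_set S x) r%:E.
Proof.
move=> r0; rewrite fineK//; apply/fin_numPlt/andP; split.
  by apply: (@lt_le_trans _ _ 0%E) => //; rewrite le_min edist_set_ge0 lee_fin.
by apply: (@le_lt_trans _ _ r%:E); rewrite ?ltry// ge_min lexx orbT.
Qed.

Lemma tdist_ge0 r S x : 0 <= r -> 0 <= tdist r S x.
Proof.
by move=> r0; rewrite -lee_fin tdistE// le_min edist_set_ge0 lee_fin.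
Qed.

Lemma tdist_le r S x : 0 <= r -> tdist r S x <= r.
Proof. by move=> r0; rewrite -lee_fin tdistE// ge_min lexx orbT. Qed.

Lemma tdist_le_edist r S x : 0 <= r -> ((tdist r S x)%:E <= edist_set S x)%E.
Proof. by move=> r0; rewrite tdistE// ge_min lexx. Qed.

Lemma tdist_le_enorm r S x z : 0 <= r -> S z -> tdist r S x <= enorm (x - z).
Proof.
move=> r0 Sz; rewrite -lee_fin; apply: le_trans (tdist_le_edist _ _ r0) _.
by apply: ereal_inf_lbound; exists z.
Qed.

Lemma tdist_lt_ex r S x (e : R) : 0 <= r -> tdist r S x < e <= r ->
  exists2 z, S z & enorm (x - z) < e.
Proof.
move=> r0; rewrite -lte_fin tdistE// gt_min => /andP[/orP[|]]; last first.
  by rewrite lte_fin ltNge => /negbTE->.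
by move=> /ereal_inf_lt[_ [z Sz <-]]; rewrite lte_fin => xz _; exists z.
Qed.

Lemma tdist_leD r S x y : 0 <= r -> tdist r S x <= tdist r S y + enorm (x - y).
Proof.
move=> r0; rewrite leNgt; apply/negP => xy.
have [|z Sz yz] := @tdist_lt_ex r S y (tdist r S x - enorm (x - y)) r0.
  by have := tdist_le S x r0; have := enorm_ge0 (x - y); lra.
have := tdist_le_enorm x r0 Sz; have := enorm_triangle y x z; lra.
Qed.

Lemma tdist_lip r S x y : 0 <= r ->
  `|tdist r S x - tdist r S y| <= enorm (x - y).
Proof.
move=> r0; have := tdist_leD S x y r0; have := tdist_leD S y x r0.
by rewrite (enormC y x) ler_norml => ? ?; apply/andP; split; lra.
Qed.

Lemma measurable_tdist r S : 0 <= r -> measurable_fun setT (tdist r S).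
Proof.
move=> r0; apply: continuous_measurable_rV; apply: enorm_lip_continuous.
by move=> x y; exact: tdist_lip.
Qed.

Lemma open_enorm (O : set T) x : open O -> O x ->
  exists2 e : R, 0 < e & forall z, enorm (x - z) < e -> O z.
Proof.
move=> oO Ox; have /nbhs_ballP[e /= e0 eO] := open_nbhs_nbhs (conj oO Ox).
exists e => // z xz; apply: eO; split => // i j; rewrite ord1.
apply: le_lt_trans xz; rewrite /ball/=.
by have := le_coord_enorm (x - z) j; rewrite !mxE.
Qed.

Lemma closure_enorm (O : set T) x :
  (forall e : R, 0 < e -> exists2 z, O z & enorm (x - z) < e) -> closure O x.
Proof.
move=> h B /nbhs_ballP[e /= e0 eB]; have [z Oz xz] := h _ e0.
exists z; split => //; apply: eB; split => // i j; rewrite ord1.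
apply: le_lt_trans xz; rewrite /ball/=.
by have := le_coord_enorm (x - z) j; rewrite !mxE.
Qed.

(** The last point of the segment from y to x up to which it stays in O. *)
Lemma segment_boundary (O : set T) x y : open O -> ~ O x -> O y ->
  exists2 b, boundary O b & enorm (x - b) <= enorm (x - y).
Proof.
move=> oO nOx Oy.
pose phi (t : R) := y + t *: (x - y).
(* phi runs from y in O to x outside O; the sup of A is the exit time. *)
pose A := [set t : R | 0 <= t <= 1 /\ O (phi t)].
have A0 : A 0 by split; rewrite ?lexx ?ler01// /phi scale0r addr0.
have supA : has_sup A by split; [exists 0|exists 1 => t [/andP[_]]].
set s := sup A.
have s0 : 0 <= s by exact: (sup_upper_bound supA).
have s1 : s <= 1 by apply: ge_sup => [|t [/andP[_]]//]; exists 0.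
have phiB t u : phi t - phi u = (t - u) *: (x - y).
  by rewrite /phi opprD addrACA subrr add0r -scalerBl.
have phi1 : phi 1 = x by rewrite /phi scale1r addrC subrK.
set L := enorm (x - y) + 1.
have L0 : 0 < L by rewrite ltr_wpDl ?enorm_ge0.
have Lphi t u : enorm (phi t - phi u) <= `|t - u| * L.
  by rewrite phiB enormZ ler_wpM2l// lerDl.
exists (phi s); last first.
  rewrite -[X in enorm (X - _)]phi1 phiB enormZ ger0_norm ?subr_ge0//.
  by rewrite -[leRHS]mul1r ler_wpM2r ?enorm_ge0// gerBl.
split.
  apply: closure_enorm => e e0.
  have [|t At st] := @sup_adherent _ A (e / L) _ supA; first by rewrite divr_gt0.
  exists (phi t); first by case: At.
  apply: (le_lt_trans (Lphi _ _)); rewrite -ltr_pdivlMr//.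
  have ts : t <= s by exact: (sup_upper_bound supA).
  by rewrite ger0_norm ?subr_ge0//; move: st; rewrite -/s; lra.
move=> /interior_subset Os.
have s1' : s < 1.
  rewrite lt_neqAle s1 andbT; apply/negP => /eqP s1'.
  by apply: nOx; rewrite -phi1 -s1'.
have [e e0 eO] := open_enorm oO Os.
pose t := Num.min 1 (s + e / L / 2).
have eL : 0 < e / L / 2 by rewrite !divr_gt0.
have st : s < t by rewrite /t lt_min s1'/= ltrDl.
have : t <= s.
  apply: (sup_upper_bound supA); split.
    by rewrite (le_trans s0 (ltW st))/= /t ge_min lexx.
  apply: eO; apply: (le_lt_trans (Lphi _ _)).
  rewrite -ltr_pdivlMr// distrC gtr0_norm ?subr_gt0//.
  have : t <= s + e / L / 2 by rewrite /t ge_min lexx orbT.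
  have : e / L = e / L / 2 + e / L / 2 by rewrite -splitr.
  lra.
by rewrite leNgt st.
Qed.

End distance.

Section thickness.
Context {R : realType} {d : nat}.
Local Notation T := 'rV[R]_d.
Local Notation mu := (lebesgue_rV d : {sigma_finite_measure set T -> \bar R}).
Context (O D : set T) (hO : open O) (hD : D `<=` boundary O).
Implicit Types (x y z : T).

Definition thick_part : set T := boundary O `\` D.

Definition gdist : T -> R := tdist 1 thick_part.
(** The truncation at 1/100 keeps the scales in the proof far below 1: a point
    with g < h sees O at scale g < 1/100, and pairs that are moved by a few
    multiples of g stay at distance less than 1. *)
Definition hdist : T -> R := tdist 100^-1 D.

Lemma hdist_cut : (0 <= 100^-1 :> R).
Proof. by rewrite invr_ge0. Qed.

Lemma gdist_ge0 x : 0 <= gdist x. Proof. exact: tdist_ge0. Qed.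
Lemma hdist_le x : hdist x <= 100^-1. Proof. exact: tdist_le hdist_cut. Qed.
Lemma gdist_le x y : gdist x <= gdist y + enorm (x - y).
Proof. exact: tdist_leD. Qed.
Lemma hdist_leD x y : hdist x <= hdist y + enorm (x - y).
Proof. exact: tdist_leD hdist_cut. Qed.
Lemma measurable_gdist : measurable_fun setT gdist.
Proof. exact: measurable_tdist. Qed.
Lemma measurable_hdist : measurable_fun setT hdist.
Proof. exact: measurable_tdist hdist_cut. Qed.

Lemma boundary_notin x : boundary O x -> ~ O x.
Proof. by move=> [_ nOx Ox]; apply: nOx; exact: (open_nbhs_nbhs (conj hO Ox)). Qed.

Lemma tdist_gt0 r S x : 0 < r -> S `<=` boundary O -> O x -> 0 < tdist r S x.
Proof.
move=> r0 SO Ox; have [e e0 eO] := open_enorm hO Ox.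
rewrite ltNge; apply/negP => h.
have [|z Sz xz] := @tdist_lt_ex _ _ r S x (Num.min e r) (ltW r0).
  by rewrite ge_min lexx orbT andbT (le_lt_trans h)// lt_min e0.
apply: (boundary_notin (SO _ Sz)); apply: eO.
by apply: lt_le_trans xz _; rewrite ge_min lexx.
Qed.

Lemma gdist_gt0 x : O x -> 0 < gdist x.
Proof. by move=> Ox; apply: tdist_gt0 => // z []. Qed.

Lemma hdist_gt0 x : O x -> 0 < hdist x.
Proof. by move=> Ox; apply: tdist_gt0 => //; rewrite invr_gt0. Qed.

Lemma cross_boundary x y : ~ O x -> O y ->
  hdist x <= enorm (x - y) \/ gdist x <= enorm (x - y).
Proof.
move=> nOx Oy; have [b Bb xb] := segment_boundary hO nOx Oy.
have [Db|nDb] := pselect (D b); [left|right]; apply: le_trans xb.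
  exact: tdist_le_enorm hdist_cut _.
exact: tdist_le_enorm.
Qed.

Context (c : R) (c0 : 0 < c).
Hypothesis thick : forall x (r : R), (boundary O `\` D) x ->
  0 < r <= 1 -> (c%:E * mu (eball x r) <= mu (eball x r `&` O))%E.

Definition thick_cst : R := c * d.+1%:R^-1 ^+ d.

Lemma thick_cst_gt0 : 0 < thick_cst.
Proof. by rewrite mulr_gt0// exprn_gt0// invr_gt0. Qed.

Lemma measurable_O : measurable O. Proof. exact: open_measurable_rV. Qed.

Lemma thick_ball x p (r : R) s : thick_part p -> 0 < r <= 1 ->
  enorm (x - p) + r <= s ->
  ((thick_cst * r ^+ d)%:E <= mu (eball x s `&` O))%E.
Proof.
move=> Gp r01 xps; have r0 : 0 < r by case/andP: r01.
apply: (@le_trans _ _ (mu (eball p r `&` O))).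
  apply: le_trans (thick Gp r01).
  rewrite /thick_cst -mulrA EFinM lee_wpmul2l ?lee_fin ?(ltW c0)//.
  by rewrite -exprMn mulrC eball_vol_ge.
apply: le_measure; rewrite ?inE.
- by apply: measurableI; [exact: measurable_eball|exact: measurable_O].
- by apply: measurableI; [exact: measurable_eball|exact: measurable_O].
- move=> y [py Oy]; split => //=; rewrite /eball/= in py *.
  by apply: (le_lt_trans (enorm_triangle p x y)); lra.
Qed.

(** A point of the thick part of the boundary lies within 2 g(x) of x, and its
    ball of radius g(x) is in B(x, 3 g(x)). *)
Lemma thick_gdist_ball x : 0 < gdist x < 2^-1 ->
  ((thick_cst * gdist x ^+ d)%:E <= mu (eball x (3 * gdist x) `&` O))%E.
Proof.
move=> /andP[g0 g1].
have [|p Gp xp] := @tdist_lt_ex _ _ 1 thick_part x (2 * gdist x) ler01.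
  by apply/andP; split; rewrite -/(gdist x); lra.
by apply: (@thick_ball _ p) => //; lra.
Qed.

(** The collars shrink to the empty set with t, since gdist > 0 on O; this makes
    the bound of the null set below tend to 0. *)
Definition collar (N : R) (t : R) : set T :=
  [set y | [/\ O y, gdist y < t & enorm y < N]].

Lemma measurable_collar N t : measurable (collar N t).
Proof.
rewrite (_ : collar N t =
   O `&` [set y | (gdist y < t) && (enorm y < N)]).
  apply: measurableI; first exact: measurable_O.
  by apply: measurable_bool_set; move: measurable_gdist => mg; meas.
apply/seteqP; split => y /=.
  by move=> [Oy gy yN]; split; rewrite // gy.
by move=> [Oy /andP[gy]].
Qed.

(** Fubini for the pairs x in the zero set, y in O at distance less than 2 t:
    by thickness each x has many partners y, all of them in the collar, and each
    y has at most a ball of partners. *)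
Lemma gdist_zero_measure_le (N t : R) : 0 < t <= 2^-1 ->
  ((thick_cst * t ^+ d)%:E *
     mu ([set x | gdist x = 0%R] `&` eball 0 N) <=
   ((4 * t) ^+ d)%:E * mu (collar (N + 1) (2 * t)))%E.
Proof.
move=> /andP[t0 t1]; set Z := _ `&` _.
have mZ : measurable Z.
  apply: measurableI; last exact: measurable_eball.
  rewrite -[X in measurable X]setTI.
  exact: (measurable_gdist measurableT (measurable_set1 _)).
pose F x y : \bar R := (\1[x \in Z] * \1[y \in O] *
  \1[enorm (x - y) < 2 * t])%:E.
have mO := measurable_O.
have mF : measurable_fun setT (fun p : T * T => F p.1 p.2).
  by rewrite /F; meas.
have F0 x y : (0 <= F x y)%E by rewrite lee_fin !mulr_ge0.
apply: (@le_trans _ _ (\int[mu]_x \int[mu]_y F x y)%E).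
  have -> : mu Z = (\int[mu]_x (\1[x \in Z])%:E)%E.
    rewrite -[in LHS](setIT Z) -integral_indic//.
  rewrite -integral_scale; last 3 first.
  - by meas.
  - by rewrite mulr_ge0 ?exprn_ge0// ltW// thick_cst_gt0.
  - by move=> x; rewrite lee_fin.
  apply: integral_le => x.
    by rewrite -EFinM lee_fin !mulr_ge0 ?exprn_ge0 ?(ltW t0)// ltW// thick_cst_gt0.
  have [xZ|xZ] := boolP (x \in Z); last first.
    by rewrite mule0; apply: integral_ge0.
  rewrite mule1.
  have gx0 : gdist x = 0 by move: xZ => /set_mem[].
  have [|p Gp xp] := @tdist_lt_ex _ _ 1 thick_part x t ler01.
    by rewrite -/(gdist x) gx0 t0/=; lra.
  apply: (@le_trans _ _ (mu (eball x (2 * t) `&` O))).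
    by apply: (thick_ball Gp); rewrite ?t0/=; lra.
  rewrite -[X in mu X]setIT -integral_indic//; last first.
    by apply: measurableI => //; exact: measurable_eball.
  apply: integral_le => y; first by rewrite lee_fin indicE.
  rewrite /F xZ mul1r indicE in_setI eball_mem lee_fin.
  by case: (_ < _); case: (y \in O); rewrite /= ?mulr1 ?mulr0.
rewrite integral_swap//.
have -> : mu (collar (N + 1) (2 * t)) =
    (\int[mu]_y ((y \in collar (N + 1) (2 * t))%:R)%:E)%E.
  rewrite -[X in mu X]setIT -integral_indic//; exact: measurable_collar.
have mC := measurable_collar (N + 1) (2 * t).
rewrite -integral_scale; last 3 first.
- by meas.
- by rewrite exprn_ge0// mulr_ge0// ltW.
- by move=> x; rewrite lee_fin.
apply: integral_le => y; first by apply: integral_ge0.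
have [Cy|nCy] := boolP (y \in collar _ _).
  rewrite mule1; apply: (@le_trans _ _ (\int[mu]_x (\1[enorm (y - x) < 2 * t])%:E)%E).
    apply: integral_le => // x; rewrite /F lee_fin (enormC y).
    by case: (x \in Z); case: (y \in O); rewrite /= ?mulr1n ?mul1r ?mul0r.
  rewrite integral_ind_eball; apply: le_trans (eball_vol_le _ _) _.
    by rewrite mulr_ge0// ltW.
  by rewrite lee_fin (_ : 2 * (2 * t) = 4 * t)//; ring.
rewrite mule0 integral0_eq// => x _; rewrite /F.
have [xZ|_] := boolP (x \in Z); last by rewrite !mul0r.
have [yO|_] := boolP (y \in O); last by rewrite mulr0 mul0r.
have [xy|_] := ltP (enorm _); last by rewrite mulr0.
move: xZ => /set_mem[/= gx xN].
exfalso; move/negP : nCy; apply; apply/mem_set; split.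
- exact/set_mem.
- by have := gdist_le y x; rewrite enormC gx; lra.
- have := enorm_triangle x 0 y; rewrite !sub0r enormN; move: xN.
  rewrite /eball/= sub0r; lra.
Qed.

Lemma gdist_zero_measure : mu [set x | gdist x = 0%R] = 0%E.
Proof.
have mZ : measurable [set x | gdist x = 0%R].
  rewrite -[X in measurable X]setTI.
  exact: (measurable_gdist measurableT (measurable_set1 _)).
have bounded_null (N : R) : 0 <= N ->
    mu ([set x | gdist x = 0%R] `&` eball 0 N) = 0%E.
  move=> N0; set Z := _ `&` _.
  have Zfin : mu Z \is a fin_num.
    rewrite ge0_fin_numE//; apply: (@le_lt_trans _ _ (mu (eball 0 N))).
      apply: le_measure; rewrite ?inE.
      - by apply: measurableI => //; exact: measurable_eball.
      - exact: measurable_eball.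
      - by move=> y [].
    by apply: le_lt_trans (eball_vol_le _ N0) _; rewrite ltry.
  pose t n : R := 2^-1 * n.+1%:R^-1.
  have t0 n : 0 < t n <= 2^-1.
    by rewrite mulr_gt0// ?invr_gt0//= ler_piMr// invf_le1// ler1n.
  pose C n := collar (N + 1) (2 * t n).
  have cvC : mu (C n) @[n --> \oo] --> mu (\bigcap_n C n).
    apply: nonincreasing_cvg_mu.
    - apply: (@le_lt_trans _ _ (mu (eball 0 (N + 1)))).
        apply: le_measure; rewrite ?inE.
        - exact: measurable_collar.
        - exact: measurable_eball.
        - by move=> y [_ _]; rewrite /eball/= sub0r enormN.
      apply: le_lt_trans (eball_vol_le _ _) _; last by rewrite ltry.
      by rewrite addr_ge0.
    - by move=> n; exact: measurable_collar.
    - by apply: bigcap_measurable => // n _; exact: measurable_collar.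
    - apply/nonincreasing_seqP => n; apply/subsetPset => y [Oy gy yN]; split => //.
      apply: lt_le_trans gy _; rewrite /t ler_wpM2l// ler_wpM2l ?invr_ge0//.
      by rewrite lef_pV2 ?posrE// ler_nat.
  have C0 : \bigcap_n C n = set0.
    apply/seteqP; split => // y Cy.
    have Oy : O y by have [] := Cy 0%N I.
    have gy := gdist_gt0 Oy.
    have [_ h _] := Cy (Num.truncn (gdist y)^-1) I.
    move: h; rewrite /t mulrA divff// mul1r ltNge => /negP; apply.
    rewrite -[leRHS]invrK lef_pV2 ?posrE ?invr_gt0//.
    by apply: ltW; exact: truncnS_gt.
  rewrite C0 measure0 in cvC.
  have le_n n : ((thick_cst / 4 ^+ d)%:E * mu Z <= mu (C n))%E.
    have /andP[tn0 _] := t0 n.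
    have := gdist_zero_measure_le N (t0 n); rewrite -/Z -/(C n).
    have td : 0 < t n ^+ d by rewrite exprn_gt0.
    have td4 : 0 < (4 * t n) ^+ d by rewrite exprn_gt0// mulr_gt0.
    move=> h; rewrite -(@lee_pmul2l _ ((4 * t n) ^+ d)%:E)//.
    apply: le_trans h.
    rewrite muleA -EFinM (_ : (4 * t n) ^+ d * _ = thick_cst * t n ^+ d)//.
    by rewrite exprMn; field; rewrite expf_neq0.
  have : ((thick_cst / 4 ^+ d)%:E * mu Z <= 0)%E.
    apply: (cvge_to_ge cvC); apply: nearW => n; exact: le_n.
  rewrite -(fineK Zfin) -EFinM lee_fin => h.
  have : 0 <= fine (mu Z) by rewrite fine_ge0.
  have : 0 < thick_cst / 4 ^+ d by rewrite divr_gt0 ?exprn_gt0// thick_cst_gt0.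
  move=> k0 Z0; congr EFin; apply/eqP; rewrite eq_le Z0 andbT.
  by rewrite -(pmulr_rle0 _ k0).
apply/eqP; rewrite eq_le measure_ge0 andbT.
have -> : [set x | gdist x = 0%R] =
    \bigcup_n ([set x | gdist x = 0%R] `&` eball 0 n%:R).
  apply/seteqP; split => [x gx|x [n _ []]//].
  exists (Num.truncn (enorm x)).+1 => //; split => //=.
  by rewrite /eball/= sub0r enormN; exact: truncnS_gt.
apply: le_trans (measure_sigma_subadditive _ _ _ (@subset_refl _ _)) _.
- by move=> n; apply: measurableI => //; exact: measurable_eball.
- apply: bigcupT_measurable => n; apply: measurableI => //.
  exact: measurable_eball.
- by rewrite eseries0// => n _ _; apply: bounded_null.
Qed.

End thickness.

(** * Shadows with bounded overlap *)

Section shadows.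
Context {R : realType} {d : nat}.
Local Notation T := 'rV[R]_d.
Local Notation mu := (lebesgue_rV d : {sigma_finite_measure set T -> \bar R}).
Context (O : set T) (g : T -> R) (kappa : R).
Hypothesis mO : measurable O.
Hypothesis mg : measurable_fun setT g.
Hypothesis g_le1 : forall x, g x <= 1.
Hypothesis g_lip : forall x y, g x <= g y + enorm (x - y).
Hypothesis kappa0 : 0 < kappa.
Hypothesis g_thick : forall x, 0 < g x < 2^-1 ->
  ((kappa * g x ^+ d)%:E <= mu (eball x (3 * g x) `&` O))%E.
Implicit Types (x y z w : T) (t : R).

(** The z at a scale below t whose ball B(z, 3 g(z)) contains w, with density
    g(z)^-d: the integral in z counts, in dyadic generations, how many smaller
    balls can use w. *)
Definition crowd_density w t z : R :=
  \1[0 < g z] * \1[g z < t] * \1[enorm (z - w) < 3 * g z] * g z `^ (- d%:R).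

Definition crowd w t : \bar R := (\int[mu]_z (crowd_density w t z)%:E)%E.

(** 72^d / kappa is the mean of crowd over the part of O in a ball, relative to
    the volume kappa g^d of that part; twice it leaves half of the volume. *)
Definition crowd_cap : R := 2 * 72 ^+ d / kappa.

(** The w in O near x that have not been used too much by the balls smaller than
    that of x. *)
Definition shadow x w : bool :=
  [&& w \in O, enorm (x - w) < 3 * g x & (crowd w (g x) <= crowd_cap%:E)%E].

Lemma crowd_cap_gt0 : 0 < crowd_cap.
Proof. by rewrite divr_gt0// mulr_gt0// exprn_gt0. Qed.

Lemma crowd_density_ge0 w t z : 0 <= crowd_density w t z.
Proof. by rewrite !mulr_ge0 ?powR_ge0. Qed.

Lemma measurable_crowd_comp d' (U : measurableType d') (a : U -> T) (b : U -> R) :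
  measurable_fun setT a -> measurable_fun setT b ->
  measurable_fun setT (fun u => crowd (a u) (b u)).
Proof.
move=> ma mb; rewrite /crowd.
have ma' : measurable_fun setT (fun p : U * T => a p.1).
  by apply: (measurableT_comp ma); exact: measurable_fst.
have mb' : measurable_fun setT (fun p : U * T => b p.1).
  by apply: (measurableT_comp mb); exact: measurable_fst.
apply: (@measurable_fun_integral _ _ _ _ _ _ (fun u z => (crowd_density (a u) (b u) z)%:E)).
  by rewrite /crowd_density; meas.
by move=> u y; rewrite lee_fin crowd_density_ge0.
Qed.

Lemma measurable_shadow_comp d' (U : measurableType d') (a b : U -> T) :
  measurable_fun setT a -> measurable_fun setT b ->
  measurable_fun setT (fun u => shadow (a u) (b u)).
Proof.
move=> ma mb; rewrite /shadow.
have mc : measurable_fun setT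
    (fun u => (crowd (b u) (g (a u)) <= crowd_cap%:E)%E).
  apply: (measurable_fun_bool true).
  have mga : measurable_fun setT (fun u => g (a u)) by meas.
  have := emeasurable_fun_infty_c measurableT (measurable_crowd_comp mb mga) crowd_cap%:E.
  by congr (measurable (_ `&` _)); apply/seteqP; split.
by apply: measurable_and; [meas|apply: measurable_and => //; meas].
Qed.

(** Fubini: a z that contributes has g(z) < g(x), thus lies in B(x, 6 g(x)), and
    its ball has volume at most (6 g(z))^d, which cancels the density. *)
Lemma crowd_packing x : 0 < g x ->
  (\int[mu]_w (\1[enorm (x - w) < 3 * g x]%:E * crowd w (g x)) <=
   ((72 * g x) ^+ d)%:E)%E.
Proof.
move=> gx; set t := g x.
pose F w z : \bar R := (\1[enorm (x - w) < 3 * t] * crowd_density w t z)%:E.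
have F0 w z : (0 <= F w z)%E by rewrite lee_fin mulr_ge0// crowd_density_ge0.
have mF : measurable_fun setT (fun p : T * T => F p.1 p.2).
  by rewrite /F /crowd_density; meas.
apply: (@le_trans _ _ (\int[mu]_w \int[mu]_z F w z)%E).
  apply: integral_le => w.
    rewrite mule_ge0 ?lee_fin//; apply: integral_ge0 => z _.
    by rewrite lee_fin crowd_density_ge0.
  rewrite /crowd -integral_scale//; last 2 first.
  - by rewrite /crowd_density; meas.
  - by move=> z; rewrite lee_fin crowd_density_ge0.
rewrite integral_swap//.
pose H z : \bar R := ((6 ^+ d)%:E * (\1[enorm (x - z) < 6 * t])%:E)%E.
apply: (@le_trans _ _ (\int[mu]_z H z)%E).
  apply: integral_le => z; first exact: integral_ge0.
  rewrite /H; have [xz|xz] := ltP (enorm (x - z)) (6 * t); last first.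
    rewrite mule0 integral0_eq// => w _; rewrite /F /crowd_density.
    have [xw|_] := ltP (enorm (x - w)); last by rewrite mul0r.
    have [gz|_] := ltP (g z) t; last by rewrite mulr0 !mul0r mulr0.
    have [zw|_] := ltP (enorm (z - w)); last by rewrite !mulr0 !mul0r mulr0.
    exfalso; have := enorm_triangle w x z; rewrite (enormC w z).
    have : g z < t by []. lra.
  rewrite mule1.
  have [gz|gz] := ltP 0 (g z); last first.
    rewrite integral0_eq ?lee_fin ?exprn_ge0// => w _.
    rewrite /F /crowd_density (_ : (0 < g z) = false) ?mul0r ?mulr0//.
    by apply/negbTE; rewrite -leNgt.
  apply: (@le_trans _ _ (\int[mu]_w ((g z `^ (- d%:R))%:E *
      (\1[enorm (z - w) < 3 * g z])%:E))%E).
    apply: integral_le => // w; rewrite /F /crowd_density -EFinM lee_fin gz mul1r.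
    rewrite (mulrC (g z `^ _)) !mulrA ler_wpM2r ?powR_ge0//.
    by case: (_ < _); case: (_ < _); rewrite /= ?mul1r ?mul0r.
  rewrite integral_scale//; last 2 first.
  - by meas.
  - exact: powR_ge0.
  rewrite integral_ind_eball.
  apply: (@le_trans _ _ ((g z `^ (- d%:R))%:E * ((2 * (3 * g z)) ^+ d)%:E)%E).
    apply: lee_wpmul2l; first by rewrite lee_fin powR_ge0.
    by apply: eball_vol_le; rewrite mulr_ge0// ltW.
  rewrite -EFinM lee_fin powRN powR_mulrn ?(ltW gz)//.
  rewrite (_ : 2 * (3 * g z) = 6 * g z); last by ring.
  by rewrite exprMn mulrCA mulVf ?mulr1// expf_neq0 ?gt_eqF.
rewrite /H integral_scale//; last by meas.
rewrite integral_ind_eball.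
apply: (@le_trans _ _ ((6 ^+ d)%:E * ((2 * (6 * t)) ^+ d)%:E)%E).
  apply: lee_wpmul2l; first by rewrite lee_fin exprn_ge0.
  by apply: eball_vol_le; rewrite mulr_ge0// ltW.
rewrite -EFinM lee_fin -exprMn (_ : 6 * (2 * (6 * t)) = 72 * t)//; ring.
Qed.

Definition shadow_cst : R := kappa / 2.

Lemma shadow_cst_gt0 : 0 < shadow_cst.
Proof. by rewrite divr_gt0. Qed.

(** Markov: crowd exceeds twice its mean on at most half of the available
    volume. *)
Lemma shadow_volume x : 0 < g x < 2^-1 ->
  ((shadow_cst * g x ^+ d)%:E <= \int[mu]_w (\1[shadow x w])%:E)%E.
Proof.
move=> /andP[gx gx2]; set t := g x.
have K0 := crowd_cap_gt0.
have mS : measurable_fun setT (fun w => (\1[shadow x w])%:E : \bar R).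
  have : measurable_fun setT (fun w => shadow x w).
    by apply: measurable_shadow_comp; meas.
  by move=> ms; meas.
have mC : measurable_fun setT (fun w : T => crowd w t).
  by apply: measurable_crowd_comp; meas.
have C0 w : (0 <= crowd w t)%E.
  by apply: integral_ge0 => z _; rewrite lee_fin crowd_density_ge0.
have h1 : ((kappa * t ^+ d)%:E <= \int[mu]_w ((\1[shadow x w])%:E +
    crowd_cap^-1%:E * (\1[enorm (x - w) < 3 * t]%:E * crowd w t)))%E.
  have gx12 : 0 < g x < 2^-1 by rewrite gx.
  apply: (le_trans (g_thick gx12)).
  rewrite -[X in mu X]setIT -integral_indic//; last first.
    by apply: measurableI => //; exact: measurable_eball.
  apply: integral_le => w; first by rewrite lee_fin indicE.
  rewrite indicE in_setI eball_mem /shadow -/t.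
  have [xw|_] := ltP (enorm (x - w)) (3 * t); last first.
    by rewrite /= andbF mul0e mule0 adde0.
  case: (w \in O); last first.
    rewrite /= add0e; apply: mule_ge0; first by rewrite lee_fin invr_ge0 ltW.
    by rewrite mul1e.
  rewrite /= mul1e; have [cK|cK] := leP (crowd w t) crowd_cap%:E.
    apply: leeDl; apply: mule_ge0 => //; rewrite lee_fin invr_ge0; exact: ltW.
  rewrite add0e; apply: (@le_trans _ _ (crowd_cap^-1%:E * crowd_cap%:E)%E).
    by rewrite -EFinM mulVf ?gt_eqF.
  by apply: lee_wpmul2l; [rewrite lee_fin invr_ge0 ltW|exact: ltW].
move: h1; rewrite integral_add//; last 2 first.
- by meas.
- move=> w; rewrite mule_ge0// ?lee_fin ?invr_ge0 ?(ltW K0)//.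
  by rewrite mule_ge0// lee_fin.
rewrite integral_scale//; last 3 first.
- by meas.
- by rewrite invr_ge0 ltW.
- by move=> w; rewrite mule_ge0// lee_fin.
move=> h1.
have : ((kappa * t ^+ d)%:E <= \int[mu]_w (\1[shadow x w])%:E +
    (shadow_cst * t ^+ d)%:E)%E.
  apply: (le_trans h1); apply: leeD => //.
  apply: (@le_trans _ _ (crowd_cap^-1%:E * ((72 * t) ^+ d)%:E)%E).
    apply: lee_wpmul2l; first by rewrite lee_fin invr_ge0 ltW.
    exact: crowd_packing.
  rewrite -EFinM lee_fin /crowd_cap /shadow_cst exprMn.
  rewrite le_eqVlt; apply/orP; left; apply/eqP; field.
  by rewrite expf_neq0 ?gt_eqF.
rewrite -leeBlDr// -EFinB; apply: le_trans.
by rewrite lee_fin /shadow_cst le_eqVlt; apply/orP; left; apply/eqP; field.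
Qed.

Definition overlap_cst : R := crowd_cap + 12 ^+ d.

(** Take x0 with w in its shadow and g(x0) almost the largest possible. The x
    with smaller g are counted by crowd w (g x0), which is capped as w is in the
    shadow of x0; those with larger g have comparable g and lie in one ball. *)
Lemma shadow_overlap w :
  (\int[mu]_x (\1[0 < g x] * \1[shadow x w] * g x `^ (- d%:R))%:E <=
   overlap_cst%:E)%E.
Proof.
pose X := [set x | 0 < g x /\ shadow x w].
have overlap0 : 0 <= overlap_cst.
  by rewrite addr_ge0 ?exprn_ge0// ltW// crowd_cap_gt0.
have [/set0P[x1 Xx1]|] := boolP (X != set0); last first.
  rewrite negbK => /eqP X0; rewrite integral0_eq ?lee_fin// => x _.
  have [gx|_] := ltP 0 (g x); last by rewrite !mul0r.
  have [sx|_] := boolP (shadow x w); last by rewrite mulr0 mul0r.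
  by exfalso; suff : X x by rewrite X0.
have supX : has_sup (g @` X).
  by split; [exists (g x1), x1|exists 1 => _ [x _ <-]].
set t := sup (g @` X).
have t0 : 0 < t.
  case: (Xx1) => g1 _; apply: (lt_le_trans g1).
  by apply: (sup_upper_bound supX); exists x1.
have [|_ [x0 [gx0 sx0] <-] tx0] := @sup_adherent _ (g @` X) (t / 2) _ supX.
  by rewrite divr_gt0.
have {}tx0 : t < 2 * g x0 by move: tx0; rewrite -/t; lra.
have X_le x : X x -> g x <= t.
  by move=> Xx; apply: (sup_upper_bound supX); exists x.
(* The first term counts the x with g x < g x0, the second the others. *)
apply: (@le_trans _ _ (\int[mu]_x ((crowd_density w (g x0) x)%:E +
   (g x0 `^ (- d%:R))%:E * (\1[enorm (w - x) < 6 * g x0])%:E))%E).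
  apply: integral_le => x; first by rewrite lee_fin !mulr_ge0// powR_ge0.
  rewrite -EFinM -EFinD lee_fin.
  have [gx|_] := ltP 0 (g x); last first.
    by rewrite !mul0r addr_ge0 ?crowd_density_ge0// mulr_ge0// powR_ge0.
  have [sx|_] := boolP (shadow x w); last first.
    by rewrite mulr0 mul0r addr_ge0 ?crowd_density_ge0// mulr_ge0// powR_ge0.
  have xw : enorm (x - w) < 3 * g x by case/and3P : sx.
  rewrite !mul1r /crowd_density gx xw !mul1r.
  have [gxx0|gxx0] := ltP (g x) (g x0).
    by rewrite !mul1r lerDl mulr_ge0// powR_ge0.
  rewrite !mul0r add0r; have := X_le x (conj gx sx) => gxt.
  rewrite (_ : _ < _ = true) ?mulr1; last by rewrite enormC; apply/idP; lra.
  by apply: powR_le_neg => //; rewrite oppr_le0.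
rewrite integral_add//; last 4 first.
- by rewrite /crowd_density; meas.
- by meas.
- by move=> x; rewrite lee_fin crowd_density_ge0.
- by move=> x; rewrite -EFinM lee_fin mulr_ge0// powR_ge0.
rewrite /overlap_cst EFinD; apply: leeD.
  by case/and3P : sx0.
rewrite integral_scale//; last 2 first.
- by meas.
- exact: powR_ge0.
rewrite integral_ind_eball.
apply: (@le_trans _ _ ((g x0 `^ (- d%:R))%:E * ((2 * (6 * g x0)) ^+ d)%:E)%E).
  apply: lee_wpmul2l; first by rewrite lee_fin powR_ge0.
  by apply: eball_vol_le; rewrite mulr_ge0// ltW.
rewrite -EFinM lee_fin powRN powR_mulrn ?(ltW gx0)//.
rewrite (_ : 2 * (6 * g x0) = 12 * g x0); last by ring.
by rewrite exprMn mulrCA mulVf ?mulr1// expf_neq0 ?gt_eqF.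
Qed.

End shadows.

(** * Values close to a function in the mean *)

Section powR_facts.
Context {R : realType}.
Implicit Types a b p t m : R.

Lemma powR_normD p a b : 0 < p ->
  `|a + b| `^ p <= 2 `^ p * (`|a| `^ p + `|b| `^ p).
Proof.
move=> p0; set M := Num.max `|a| `|b|.
have M0 : 0 <= M by rewrite le_max normr_ge0.
apply: (@le_trans _ _ ((2 * M) `^ p)).
  apply: ge0_ler_powR; rewrite ?nnegrE ?(ltW p0)//.
    by rewrite mulr_ge0.
  apply: (le_trans (ler_normD _ _)).
  by rewrite mulr_natl mulr2n lerD// /M le_max lexx ?orbT.
rewrite powRM// ler_wpM2l ?powR_ge0// /M.
by case: (leP `|a| `|b|) => _; rewrite ?lerDl ?lerDr powR_ge0.
Qed.

Lemma powR_normB p a b : 0 < p ->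
  `|a - b| `^ p <= 2 `^ p * (`|a| `^ p + `|b| `^ p).
Proof. by move=> p0; rewrite -[in leRHS](normrN b); exact: powR_normD. Qed.

Lemma powR_dist_triangle p c a b : 0 < p ->
  `|a - b| `^ p <= 2 `^ p * (`|a - c| `^ p + `|c - b| `^ p).
Proof.
by move=> p0; rewrite (_ : a - b = (a - c) + (c - b)) ?powR_normD// addrA subrK.
Qed.

(** The tangent of the convex function t^p at m lies below it; this is the
    inequality of Young. *)
Lemma powR_tangent p m t : 1 <= p -> 0 <= m -> 0 <= t ->
  p * m `^ (p - 1) * t <= t `^ p + (p - 1) * m `^ p.
Proof.
rewrite le_eqVlt => /predU1P[<-|p1] m0 t0.
  by rewrite subrr powRr0 mul0r addr0 !mul1r powRr1.
have p0 : 0 < p by exact: lt_trans p1.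
have p10 : 0 < p - 1 by rewrite subr_gt0.
have pp : p^-1 + (p / (p - 1))^-1 = 1 by field; rewrite !gt_eqF.
have := @conjugate_powR _ t (m `^ (p - 1)) p (p / (p - 1)) t0 (powR_ge0 _ _) p0.
rewrite -powRrM (_ : (p - 1) * (p / (p - 1)) = p); last first.
  by field; rewrite gt_eqF.
move=> /(_ (divr_gt0 p0 p10) pp); rewrite -(ler_pM2l p0).
have -> : p * (t `^ p / p + m `^ p / (p / (p - 1))) = t `^ p + (p - 1) * m `^ p.
  by field; rewrite !gt_eqF.
by rewrite mulrA mulrAC.
Qed.

End powR_facts.

Section near_mean.
Context {d} {T : measurableType d} {R : realType}.
Variable mu : {sigma_finite_measure set T -> \bar R}.
Implicit Types (W : set T) (f g : T -> R) (a p : R).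

Definition deviation p W f a : \bar R :=
  (\int[mu]_w (\1[w \in W] * `|a - f w| `^ p)%:E)%E.

Definition oscillation p W f : \bar R :=
  (\int[mu]_w \int[mu]_z
     (\1[w \in W] * \1[z \in W] * `|f w - f z| `^ p)%:E)%E.

(** Averaged over a = f w with w in W the inequality becomes an equality, so that
    some f w satisfies it, whatever p is. *)
Definition near_value p W f : set R :=
  [set a | ((fine (mu W))%:E * deviation p W f a <= oscillation p W f)%E].

(** For p >= 1 the mean, which is linear in f. For p < 1 the choice depends on f
    through the integrals deviation and oscillation alone, so that it is
    invariant under changes of f on null sets. *)
Definition near_mean p W f : R :=
  if 1 <= p then (fine (mu W))^-1 * \int[mu]_(w in W) f w
  else xget 0 (near_value p W f).

Lemma deviation_ge0 p W f a : (0 <= deviation p W f a)%E.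
Proof. by apply: integral_ge0 => w _; rewrite lee_fin mulr_ge0 ?powR_ge0. Qed.

Lemma oscillation_ge0 p W f : (0 <= oscillation p W f)%E.
Proof.
apply: integral_ge0 => w _; apply: integral_ge0 => z _.
by rewrite lee_fin !mulr_ge0 ?powR_ge0.
Qed.

Lemma oscillationE p W f : measurable W -> measurable_fun setT f ->
  oscillation p W f =
  (\int[mu]_w (\1[w \in W]%:E * deviation p W f (f w)))%E.
Proof.
move=> mW mf; apply: eq_integral => w _; rewrite /deviation.
under eq_integral do rewrite -mulrA EFinM.
by int_scale.
Qed.

Lemma integral_mem W : measurable W ->
  (\int[mu]_w (\1[w \in W])%:E)%E = mu W.
Proof.
move=> mW; rewrite -[in RHS](setIT W) -integral_indic//.
Qed.

Section averages.
Variable W : set T.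
Hypothesis mW : measurable W.
Hypothesis W0 : (0 < mu W)%E.
Hypothesis Woo : (mu W < +oo)%E.
Let b := fine (mu W).

Let bE : b%:E = mu W.
Proof. by rewrite fineK// ge0_fin_numE. Qed.

Let b0 : 0 < b.
Proof. by rewrite -lte_fin bE. Qed.

Lemma integrable_of_powR p f : 1 <= p -> measurable_fun setT f ->
  (\int[mu]_w (\1[w \in W] * `|f w| `^ p)%:E < +oo)%E ->
  mu.-integrable W (EFin \o f).
Proof.
move=> p1 mf ifp; apply/integrableP; split.
  by apply/measurable_EFinP; exact: measurable_funTS.
rewrite integral_mkcond.
apply: (@le_lt_trans _ _ (\int[mu]_w ((\1[w \in W] * `|f w| `^ p)%:E + \1[w \in W]%:E))%E).
  apply: integral_le => w.
    by rewrite patchE; case: ifP => _ //.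
  rewrite patchE; case: ifP => wW; last by rewrite -EFinD lee_fin mul0r addr0.
  rewrite /= -EFinD lee_fin mul1r.
  have [h|h] := leP `|f w| 1.
    by rewrite (le_trans h)// lerDr powR_ge0.
  apply: (@le_trans _ _ (`|f w| `^ p)); last by rewrite lerDl.
  by apply: le1r_powR => //; exact: ltW.
int_add.
by rewrite integral_mem// lte_add_pinfty.
Qed.

(** Integrate the tangent inequality at the mean. *)
Lemma jensen_powR p f : 1 <= p -> mu.-integrable W (EFin \o f) ->
  ((b * `|b^-1 * (\int[mu]_(w in W) f w)%R| `^ p)%:E <=
  \int[mu]_(w in W) (`|f w| `^ p)%:E)%E.
Proof.
move=> p1 fi; set m := `|_|.
have m0 : 0 <= m by exact: normr_ge0.
have p0 : 0 < p by exact: lt_le_trans p1.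
have mf : measurable_fun W f by move/integrableP : fi => [/measurable_EFinP].
have nfi := integrable_norm fi.
have bm : b * m <= \int[mu]_(w in W) `|f w|.
  rewrite /m normrM gtr0_norm ?invr_gt0// mulrA divff ?gt_eqF// mul1r.
  exact: le_normr_Rintegral.
have mfp : measurable_fun W (fun w => `|f w| `^ p).
  apply: (measurableT_comp (measurable_powR p)).
  exact: measurableT_comp.
have tang : ((p * m `^ (p - 1))%:E * \int[mu]_(w in W) (`|f w|)%:E <=
    \int[mu]_(w in W) (`|f w| `^ p)%:E + ((p - 1) * m `^ p * b)%:E)%E.
  rewrite -ge0_integralZl//; last 2 first.
  - by apply/measurable_EFinP; exact: measurableT_comp.
  - by rewrite lee_fin mulr_ge0 ?powR_ge0// ltW.
  rewrite (EFinM _ b) bE -integral_cst//.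
  have p10 : 0 <= p - 1 by rewrite subr_ge0.
  rewrite -(ge0_integralD mu mW); last 4 first.
  - by move=> w _; rewrite lee_fin powR_ge0.
  - exact/measurable_EFinP.
  - by move=> w _; rewrite /= lee_fin mulr_ge0 ?powR_ge0.
  - exact: measurable_cst.
  apply: ge0_le_integral => //.
  - by move=> w _; rewrite -EFinM lee_fin !mulr_ge0 ?powR_ge0// ltW.
  - apply/measurable_EFinP; apply: measurable_funM => //.
    exact: measurableT_comp.
  - apply/measurable_EFinP; exact: measurable_funD.
  - by move=> w _; rewrite -EFinM -EFinD lee_fin powR_tangent.
have I_fin : (\int[mu]_(w in W) (`|f w|)%:E \is a fin_num)%E.
  exact: (integrable_fin_num mW nfi).
have : (((p * m `^ (p - 1)) * (b * m))%:E <=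
    \int[mu]_(w in W) (`|f w| `^ p)%:E + ((p - 1) * m `^ p * b)%:E)%E.
  apply: le_trans tang; rewrite EFinM; apply: lee_wpmul2l.
    by rewrite lee_fin mulr_ge0 ?powR_ge0// ltW.
  by rewrite -(fineK I_fin) lee_fin.
rewrite -leeBlDr// -EFinB; congr (_ <= _)%E; congr EFin.
have -> : m `^ p = m `^ (p - 1) * m.
  by rewrite mulrC mulr_powRB1.
by ring.
Qed.

Lemma near_value_mean p f : 1 <= p -> measurable_fun setT f ->
  (\int[mu]_w (\1[w \in W] * `|f w| `^ p)%:E < +oo)%E ->
  near_value p W f (b^-1 * \int[mu]_(w in W) f w).
Proof.
move=> p1 mf fp; have fi := integrable_of_powR p1 mf fp.
rewrite /near_value/= -/b oscillationE// /deviation -integral_scale; last 3 first.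
- by meas.
- exact: ltW.
- by move=> w; rewrite lee_fin mulr_ge0 ?powR_ge0.
apply: integral_le => w.
  by rewrite -EFinM lee_fin !mulr_ge0 ?powR_ge0// ltW.
case: (w \in W); last by rewrite mul0r mule0 mul0e.
rewrite mul1r mul1e -EFinM.
have ci : mu.-integrable W (EFin \o cst (f w)).
  apply: measurable_bounded_integrable => //.
  by exists `|f w|; split; rewrite ?num_real// => M /ltW + z _.
have := @jensen_powR p (fun z => f w - f z) p1 _.
rewrite RintegralB// Rintegral_cst// -/b mulrBr mulrCA mulVf ?gt_eqF// mulr1.
rewrite distrC => h; apply: (le_trans (h _)).
  by apply: (integrableB mW ci fi).
rewrite integral_mkcond; apply: integral_le => z.
  by rewrite patchE; case: ifP => // _; rewrite lee_fin powR_ge0.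
by rewrite patchE; case: ifP => // _; rewrite ?mul1r ?mul0r.
Qed.

(** Some value f w is at most as bad as the average over w in W. Otherwise the
    differences e w of the two sides are positive on W with integral 0. *)
Lemma near_value_nonempty p f : measurable_fun setT f ->
  near_value p W f !=set0.
Proof.
move=> mf.
have [oscy|oscfin] := eqVneq (oscillation p W f) +oo%E.
  by exists 0; rewrite /near_value/= oscy leey.
have ofin : oscillation p W f \is a fin_num.
  by rewrite ge0_fin_numE ?oscillation_ge0// lt_neqAle oscfin leey.
apply/set0P; apply/negP => /eqP NV0.
have lt_osc a : (oscillation p W f < b%:E * deviation p W f a)%E.
  rewrite ltNge; apply/negP => h.
  by suff : near_value p W f a by rewrite NV0.
pose D w := deviation p W f (f w).
have mD : measurable_fun setT D.
  by rewrite /D /deviation; meas => // w z; rewrite lee_fin mulr_ge0 ?powR_ge0.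
have D0 w : (0 <= D w)%E by exact: deviation_ge0.
pose e w : \bar R := (\1[w \in W]%:E * (b%:E * D w - oscillation p W f))%E.
have me : measurable_fun setT e.
  apply: emeasurable_funM; first by meas.
  by apply: emeasurable_funB => //; apply: emeasurable_funM.
have e0 w : (0 <= e w)%E.
  apply: mule_ge0; first by rewrite lee_fin.
  by rewrite sube_ge0; [exact/ltW/lt_osc|rewrite ofin].
have : (\int[mu]_w (\1[w \in W]%:E * (b%:E * D w)) =
    \int[mu]_w (\1[w \in W]%:E * oscillation p W f + e w))%E.
  apply: eq_integral => w _; rewrite /e; case: (w \in W).
    by rewrite !mul1e addeC subeK.
  by rewrite !mul0e adde0.
rewrite integral_add//; last 2 first.
- by apply: emeasurable_funM; [meas|exact: measurable_cst].
- by move=> w; rewrite mule_ge0 ?oscillation_ge0// lee_fin.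
have -> : (\int[mu]_w (\1[w \in W]%:E * (b%:E * D w)) =
    b%:E * oscillation p W f)%E.
  rewrite oscillationE// -integral_scale; last 3 first.
  - by apply: emeasurable_funM => //; meas.
  - exact: ltW.
  - by move=> w; apply: mule_ge0; [nn|exact: D0].
  by apply: eq_integral => w _; rewrite muleCA.
have -> : (\int[mu]_w (\1[w \in W]%:E * oscillation p W f) =
    b%:E * oscillation p W f)%E.
  under eq_integral do rewrite muleC -(fineK ofin).
  have fo0 : 0 <= fine (oscillation p W f) by rewrite fine_ge0// oscillation_ge0.
  int_scale.
  by rewrite integral_mem// -bE muleC (fineK ofin).
have bfin : (b%:E * oscillation p W f \is a fin_num)%E by rewrite fin_numM.
move=> /esym/(congr1 (fun x => x - b%:E * oscillation p W f)%E).
rewrite addeAC subee// add0e => ie.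
have : (\int[mu]_w `|e w| = 0)%E.
  by rewrite -ie; apply: eq_integral => w _; rewrite gee0_abs.
move=> /(ae_eq_integral_abs mu measurableT me)[N [mN N0 eN]].
have : (mu W <= mu N)%E.
  apply: le_measure; rewrite ?inE// => w Ww; apply: eN => /(_ I) /=.
  rewrite /e mem_set// mul1e => h.
  by have := lt_osc (f w); rewrite -/(D w) -sube_gt0 h ltxx.
by rewrite N0 leNgt W0.
Qed.

Lemma near_valueP p f : measurable_fun setT f ->
  (\int[mu]_w (\1[w \in W] * `|f w| `^ p)%:E < +oo)%E ->
  near_value p W f (near_mean p W f).
Proof.
move=> mf fp; rewrite /near_mean; case: ifP => [p1|_].
  exact: near_value_mean.
have [a Wa] := near_value_nonempty p mf; exact: (xgetPex 0 (ex_intro _ a Wa)).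
Qed.

Lemma near_mean_linear p a f g : 1 <= p ->
  measurable_fun setT f -> measurable_fun setT g ->
  (\int[mu]_w (\1[w \in W] * `|f w| `^ p)%:E < +oo)%E ->
  (\int[mu]_w (\1[w \in W] * `|g w| `^ p)%:E < +oo)%E ->
  near_mean p W (fun x => a * f x + g x) =
  a * near_mean p W f + near_mean p W g.
Proof.
move=> p1 mf mg fp gp; rewrite /near_mean p1.
have fi := integrable_of_powR p1 mf fp.
have gi := integrable_of_powR p1 mg gp.
rewrite RintegralD//; last first.
  by apply: eq_integrable (integrableZl mW a fi) => // w _; rewrite /= EFinM.
by rewrite RintegralZl// mulrDr mulrCA.
Qed.

End averages.

Lemma near_mean_ae p W f g : measurable W ->
  measurable_fun setT f -> measurable_fun setT g ->
  {ae mu, forall x, W x -> f x = g x} -> near_mean p W f = near_mean p W g.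
Proof.
move=> mW mf mg fg; rewrite /near_mean; case: (1 <= p).
  have fgi : (\int[mu]_(w in W) (f w)%:E = \int[mu]_(w in W) (g w)%:E)%E.
    apply: ae_eq_integral.
    - exact: mW.
    - by apply/measurable_EFinP; exact: measurable_funTS.
    - by apply/measurable_EFinP; exact: measurable_funTS.
    - by move: fg; apply: filterS => x h Wx /=; rewrite h.
  by rewrite /Rintegral fgi.
have dev_eq a : deviation p W f a = deviation p W g a.
  apply: ge0_ae_eq_integral; first exact: measurableT.
  - by meas.
  - by meas.
  - by move=> x _; rewrite lee_fin mulr_ge0 ?powR_ge0.
  - by move=> x _; rewrite lee_fin mulr_ge0 ?powR_ge0.
  - move: fg; apply: filterS => x h _ /=.
    by have [/set_mem/h ->//|_] := boolP (x \in W); rewrite !mul0r.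
have dev_meas h : measurable_fun setT h -> measurable_fun setT
    (fun w => (\1[w \in W]%:E * deviation p W h (h w))%E).
  by move=> mh; rewrite /deviation; meas; nn.
have osc_eq : oscillation p W f = oscillation p W g.
  rewrite (oscillationE p mW mf) (oscillationE p mW mg).
  apply: ge0_ae_eq_integral; first exact: measurableT.
  - exact: dev_meas.
  - exact: dev_meas.
  - by move=> w _; apply: mule_ge0; [nn|exact: deviation_ge0].
  - by move=> w _; apply: mule_ge0; [nn|exact: deviation_ge0].
  - move: fg; apply: filterS => x h _ /=.
    by have [/set_mem/h ->|_] := boolP (x \in W); rewrite ?dev_eq ?mul0e.
suff -> : near_value p W f = near_value p W g by [].
apply/seteqP; split => a; rewrite /near_value/= dev_eq osc_eq; exact.
Qed.

End near_mean.

(** * Averages at a variable scale *)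

(** The difference of two quotients, arranged so that the second numerator
    appears divided by its own denominator. *)
Lemma quotient_bound (R : realType) (m n u v e D : R) : 0 < m -> 0 < n ->
  0 <= e -> `|u - v| <= e * D -> `|m - n| <= D -> `|v| <= e * n ->
  `|m^-1 * u - n^-1 * v| <= m^-1 * (2 * e * D).
Proof.
move=> m0 n0 e0 uv mn ve.
have -> : m^-1 * u - n^-1 * v = m^-1 * ((u - v) + n^-1 * v * (n - m)).
  by field; rewrite !gt_eqF.
rewrite normrM gtr0_norm ?invr_gt0//; apply: ler_wpM2l.
  by rewrite invr_ge0 ltW.
rewrite (_ : 2 * e * D = e * D + e * D); last by ring.
apply: (le_trans (ler_normD _ _)); apply: lerD => //.
rewrite normrM; apply: ler_pM; rewrite ?normr_ge0 1?distrC//.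
by rewrite normrM gtr0_norm ?invr_gt0// mulrC ler_pdivrMr.
Qed.

Section smoothing.
Context {R : realType} {d : nat}.
Local Notation T := 'rV[R]_d.
Local Notation mu := (lebesgue_rV d : {sigma_finite_measure set T -> \bar R}).
Context (g : T -> R).
Hypothesis mg : measurable_fun setT g.
Hypothesis g_lip : forall x y, g x <= g y + enorm (x - y).
Implicit Types (x y z : T) (A B : T -> R) (W : set T) (a b e : R).

Definition bump x z : R := Num.max 0 (g x / 8 - enorm (x - z)).

Definition bump_mass x : R := \int[mu]_z bump x z.

(** The cone of radius g(x)/8 is Lipschitz in x as g is, and vanishes when
    g(x) = 0. The exponent -1 is a real power for the sake of measurability. *)
Definition smooth A x : R :=
  bump_mass x `^ (-1) * \int[mu]_z (bump x z * A z).

Lemma bump_ge0 x z : 0 <= bump x z.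
Proof. by rewrite le_max lexx. Qed.

Lemma bump_le x z : 0 <= g x -> bump x z <= g x / 8.
Proof.
by move=> gx; rewrite ge_max divr_ge0//= gerBl enorm_ge0.
Qed.

Lemma bump_eq0 x z : g x / 8 <= enorm (x - z) -> bump x z = 0.
Proof. by move=> h; apply/max_idPl; rewrite subr_le0. Qed.

Lemma measurable_bump x : measurable_fun setT (bump x).
Proof. by rewrite /bump; meas. Qed.

Lemma Rintegral_support W (u : T -> R) : (forall z, ~ W z -> u z = 0) ->
  (\int[mu]_z u z = \int[mu]_(z in W) u z)%R.
Proof.
move=> uW; rewrite [RHS]Rintegral_mkcond; apply: eq_Rintegral => z _.
by rewrite patchE; case: ifPn => // /negP zW; rewrite uW// => Wz; apply: zW; exact/mem_set.
Qed.

Lemma eball_fin x (r : R) : 0 <= r -> (mu (eball x r) < +oo)%E.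
Proof. by move=> r0; apply: le_lt_trans (eball_vol_le _ r0) _; exact: ltry. Qed.

Lemma bounded_integrable x (r : R) (u : T -> R) (M : R) : 0 <= r ->
  measurable_fun setT u -> (forall z, enorm (x - z) < r -> `|u z| <= M) ->
  mu.-integrable (eball x r) (EFin \o u).
Proof.
move=> r0 mu_ uM; apply: measurable_bounded_integrable.
- exact: measurable_eball.
- exact: eball_fin.
- exact: measurable_funTS.
- exists M; split; first by rewrite num_real.
  by move=> N /ltW MN z xz; apply: le_trans MN; exact: uM.
Qed.

Lemma abs_Rintegral_le x (r : R) (u : T -> R) (M : R) : 0 <= r -> 0 <= M ->
  measurable_fun setT u -> (forall z, enorm (x - z) < r -> `|u z| <= M) ->
  `|\int[mu]_(z in eball x r) u z| <= M * (2 * r) ^+ d.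
Proof.
move=> r0 M0 mu_ uM.
have mW := @measurable_eball R d x r.
have iu := bounded_integrable r0 mu_ uM.
apply: (le_trans (le_normr_Rintegral mW iu)).
apply: (@le_trans _ _ (\int[mu]_(z in eball x r) M)).
  apply: le_Rintegral => //; first exact: (integrable_norm iu).
  by apply: (bounded_integrable (M := `|M|)) => //; exact: measurable_cst.
rewrite Rintegral_cst// ler_wpM2l// -lee_fin fineK.
  exact: eball_vol_le.
by rewrite ge0_fin_numE// eball_fin.
Qed.

Section at_point.
Variable x : T.
Hypothesis gx : 0 < g x.
Let W := eball x (g x / 2).

Let gx2 : 0 <= g x / 2. Proof. by rewrite divr_ge0// ltW. Qed.
Let gx8 : 0 < g x / 8. Proof. by rewrite divr_gt0. Qed.

Let near_self : enorm (x - x) < g x / 8.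
Proof. by rewrite subrr enorm0. Qed.

(** Within g(x)/8 of x the scales are comparable, and all bumps live in one
    ball, on which the values of the averaged function are compared. *)
Lemma bump_support y z : enorm (x - y) < g x / 8 -> ~ W z -> bump y z = 0.
Proof.
move=> xy nWz; apply: bump_eq0; rewrite leNgt; apply/negP => yz; apply: nWz.
have h1 := enorm_triangle y x z; have h2 := g_lip y x.
rewrite /W/eball/=; rewrite (enormC y x) in h2.
by move: (gx) => ?; lra.
Qed.

Lemma bump_bound y z : enorm (x - y) < g x / 8 -> `|bump y z| <= g x.
Proof.
move=> xy; rewrite ger0_norm ?bump_ge0//.
have := g_lip y x; rewrite (enormC y x) => h.
have h' := g_lip x y.
have gy : 0 <= g y by lra.
by have := bump_le z gy; lra.
Qed.

Lemma bump_massE y : enorm (x - y) < g x / 8 ->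
  bump_mass y = \int[mu]_(z in W) bump y z.
Proof.
by move=> xy; apply: Rintegral_support => z; exact: bump_support.
Qed.

Let mW : measurable W. Proof. exact: measurable_eball. Qed.

Lemma bump_integrable y : enorm (x - y) < g x / 8 ->
  mu.-integrable W (EFin \o bump y).
Proof.
move=> xy; apply: (bounded_integrable (M := g x)) => //.
  exact: measurable_bump.
by move=> z _; exact: bump_bound.
Qed.

(** The bump is at least g(x)/16 on the ball of radius g(x)/16. *)
Definition bump_cst : R := 16 * (16 * d.+1%:R) ^+ d.

Lemma bump_mass_ge : g x ^+ d.+1 / bump_cst <= bump_mass x.
Proof.
have W16 : eball x (g x / 16) `<=` W.
  by move=> z; rewrite /W/eball/= => xz; move: gx xz => ? ?; lra.
rewrite bump_massE// -lee_fin /Rintegral fineK; last first.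
  by apply: integrable_fin_num => //; exact: bump_integrable.
apply: (@le_trans _ _ ((g x / 16)%:E * mu (eball x (g x / 16)))%E).
  apply: (@le_trans _ _ ((g x / 16)%:E * ((g x / 16 / d.+1%:R) ^+ d)%:E)%E).
    rewrite -EFinM lee_fin /bump_cst exprS -mulf_div -expr_div_n.
    by rewrite invfM mulrA.
  apply: lee_wpmul2l; first by rewrite lee_fin divr_ge0// ltW.
  by apply: eball_vol_ge; rewrite divr_gt0.
rewrite -integral_ind_eball -integral_scale; last 3 first.
- by meas.
- by rewrite divr_ge0// ltW.
- by nn.
rewrite [leRHS]integral_mkcond; apply: integral_le => z.
  by apply: mule_ge0; rewrite lee_fin// divr_ge0// ltW.
have [xz|_] := ltP (enorm (x - z)) (g x / 16); last first.
  by rewrite mule0 patchE; case: ifP => // _; rewrite lee_fin bump_ge0.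
rewrite mule1 patchE mem_set//; last by apply: W16.
rewrite lee_fin /bump le_max; apply/orP; right.
by move: (gx) xz => ? ?; lra.
Qed.

Lemma bump_cst_gt0 : 0 < bump_cst.
Proof. by rewrite mulr_gt0// exprn_gt0// mulr_gt0. Qed.

Lemma bump_mass_gt0 : 0 < bump_mass x.
Proof.
apply: lt_le_trans bump_mass_ge; rewrite divr_gt0 ?bump_cst_gt0//.
exact: exprn_gt0.
Qed.

End at_point.

Lemma near_gt0 x y : 0 < g x -> enorm (x - y) < g x / 8 -> 0 < g y.
Proof. by move=> gx xy; have := g_lip x y; lra. Qed.

Section oscillating.
Variables (x : T) (A : T -> R) (b e : R).
Hypothesis gx : 0 < g x.
Hypothesis mA : measurable_fun setT A.
Hypothesis e0 : 0 <= e.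
Hypothesis Ab : forall z, enorm (x - z) < g x / 2 -> `|A z - b| <= e.
Let W := eball x (g x / 2).

Let gx2 : 0 <= g x / 2. Proof. by rewrite divr_ge0// ltW. Qed.
Let mW : measurable W. Proof. exact: measurable_eball. Qed.

Let ibA y : enorm (x - y) < g x / 8 ->
  mu.-integrable W (EFin \o (fun z => bump y z * (A z - b))).
Proof.
move=> xy; apply: (bounded_integrable (M := g x * e)) => //.
  by have := measurable_bump y; move=> mb; meas.
by move=> z xz; rewrite normrM ler_pM//; [exact: bump_bound|exact: Ab].
Qed.

Let F y : R := \int[mu]_(z in W) (bump y z * (A z - b)).

Lemma smoothB y : enorm (x - y) < g x / 8 ->
  smooth A y - b = bump_mass y `^ (-1) * F y.
Proof.
move=> xy; have gy := near_gt0 gx xy.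
have m0 := bump_mass_gt0 gy.
have ib : mu.-integrable W (EFin \o (fun z => b * bump y z)).
  apply: (bounded_integrable (M := `|b| * g x)) => //.
    by move: (measurable_bump y) => mb; meas.
  by move=> z xz; rewrite normrM ler_pM//; exact: bump_bound.
have -> : smooth A y = bump_mass y `^ (-1) * (F y + b * bump_mass y).
  rewrite /smooth; congr (_ * _).
  rewrite (bump_massE gx xy) -RintegralZl//; last exact: bump_integrable.
  rewrite /F -RintegralD//; last exact: ibA.
  rewrite (@Rintegral_support W); last first.
    by move=> z nWz; rewrite (bump_support gx xy nWz) mul0r.
  by apply: eq_Rintegral => z _; ring.
rewrite mulrDr (mulrC b) powR_inv1 ?(ltW m0)// mulKf ?gt_eqF//.
by rewrite addrK.
Qed.

Lemma smooth_F_le y : enorm (x - y) < g x / 8 -> `|F y| <= e * bump_mass y.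
Proof.
move=> xy; have iF := ibA xy.
apply: (le_trans (le_normr_Rintegral mW iF)).
rewrite (bump_massE gx xy) -RintegralZl//; last exact: bump_integrable.
apply: le_Rintegral => //; first exact: (integrable_norm iF).
  apply: (bounded_integrable (M := `|e| * g x)) => //.
    by move: (measurable_bump y) => mb; meas.
  by move=> z xz; rewrite normrM ler_pM//; exact: bump_bound.
move=> z xz; rewrite normrM ger0_norm ?bump_ge0// mulrC.
by rewrite ler_wpM2r ?bump_ge0//; exact: Ab.
Qed.

Lemma smooth_near : `|smooth A x - b| <= e.
Proof.
have xx : enorm (x - x) < g x / 8 by rewrite subrr enorm0 divr_gt0.
have m0 := bump_mass_gt0 gx.
rewrite smoothB// normrM powR_inv1 ?(ltW m0)// gtr0_norm ?invr_gt0//.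
by rewrite mulrC ler_pdivrMr// smooth_F_le.
Qed.

Lemma bump_lip y z : `|bump x z - bump y z| <= 2 * enorm (x - y).
Proof.
have h1 := g_lip x y; have h2 := g_lip y x; rewrite (enormC y x) in h2.
have h3 := enorm_triangle y x z; have h4 := enorm_triangle x y z.
rewrite (enormC y x) in h4.
have h0 := enorm_ge0 (x - y).
rewrite /bump; case: (leP 0 (g x / 8 - _)) => h5; case: (leP 0 (g y / 8 - _)) => h6;
  rewrite ler_norml; apply/andP; split; lra.
Qed.

Definition smooth_cst : R := 4 * bump_cst.

(** Numerator and mass of the average, both relative to b, vary by at most
    |x - y| g^d (times e for the numerator), while the mass is at least a
    multiple of g^(d+1). *)
Lemma smooth_lip y : enorm (x - y) < g x / 8 ->
  `|smooth A x - smooth A y| <= smooth_cst * (enorm (x - y) / g x) * e.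
Proof.
move=> xy; have gy := near_gt0 gx xy.
have xx : enorm (x - x) < g x / 8 by rewrite subrr enorm0 divr_gt0.
have m0 := bump_mass_gt0 gx; have n0 := bump_mass_gt0 gy.
have r0 := enorm_ge0 (x - y).
have gg : 2 * (g x / 2) = g x by rewrite mulrCA divff ?mulr1.
have dF : `|F x - F y| <= 2 * enorm (x - y) * e * g x ^+ d.
  rewrite /F -RintegralB//; [|exact: ibA|exact: ibA].
  rewrite -[in leRHS]gg; apply: abs_Rintegral_le => //.
  - by rewrite !mulr_ge0.
  - by move: (measurable_bump x) (measurable_bump y) => mbx mby; meas.
  - move=> z xz; rewrite -mulrBl normrM ler_pM//; first exact: bump_lip.
    exact: Ab.
have dm : `|bump_mass x - bump_mass y| <= 2 * enorm (x - y) * g x ^+ d.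
  rewrite (bump_massE gx xx) (bump_massE gx xy) -RintegralB//; last 2 first.
  - exact: bump_integrable.
  - exact: bump_integrable.
  rewrite -[in leRHS]gg; apply: abs_Rintegral_le => //.
  - by rewrite !mulr_ge0.
  - by move: (measurable_bump x) (measurable_bump y) => mbx mby; meas.
  - by move=> z xz; exact: bump_lip.
have -> : smooth A x - smooth A y = (smooth A x - b) - (smooth A y - b).
  by rewrite opprB addrA subrK.
rewrite (smoothB xx) (smoothB xy) (powR_inv1 (ltW m0)) (powR_inv1 (ltW n0)).
have Fy := smooth_F_le xy.
have dF' : `|F x - F y| <= e * (2 * enorm (x - y) * g x ^+ d).
  by rewrite (_ : e * _ = 2 * enorm (x - y) * e * g x ^+ d)//; ring.
apply: (le_trans (quotient_bound m0 n0 e0 dF' dm Fy)).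
have gd : 0 < g x ^+ d.+1 / bump_cst.
  by rewrite divr_gt0 ?bump_cst_gt0// exprn_gt0.
apply: (@le_trans _ _ ((g x ^+ d.+1 / bump_cst)^-1 *
    (2 * e * (2 * enorm (x - y) * g x ^+ d)))).
  apply: ler_wpM2r.
    by apply: mulr_ge0; [nn|]; apply: mulr_ge0; [nn|rewrite exprn_ge0// ltW].
  by rewrite lef_pV2; [exact: bump_mass_ge|exact: m0|exact: gd].
rewrite le_eqVlt; apply/orP; left; apply/eqP; rewrite /smooth_cst exprS.
move: (g x) gx (bump_cst) bump_cst_gt0 (enorm (x - y)) => G G0 K K0 r.
by field; rewrite !gt_eqF//= exprn_gt0.
Qed.

End oscillating.

Lemma smooth_linear A B a x (M : R) : 0 < g x ->
  measurable_fun setT A -> measurable_fun setT B ->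
  (forall z, enorm (x - z) < g x / 2 -> `|A z| <= M) ->
  (forall z, enorm (x - z) < g x / 2 -> `|B z| <= M) ->
  smooth (fun z => a * A z + B z) x = a * smooth A x + smooth B x.
Proof.
move=> gx mA mB AM BM; pose W := eball x (g x / 2).
have mW : measurable W by exact: measurable_eball.
have gx2 : 0 <= g x / 2 by rewrite divr_ge0// ltW.
have xx : enorm (x - x) < g x / 8 by rewrite subrr enorm0 divr_gt0.
have iA (C : T -> R) : measurable_fun setT C ->
    (forall z, enorm (x - z) < g x / 2 -> `|C z| <= M) ->
    mu.-integrable W (EFin \o (fun z => bump x z * C z)).
  move=> mC CM; apply: (bounded_integrable (M := g x * M)) => //.
    by move: (measurable_bump x) => mb; meas.
  by move=> z xz; rewrite normrM ler_pM//; [exact: bump_bound|exact: CM].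
have sW (C : T -> R) : (\int[mu]_z (bump x z * C z) = \int[mu]_(z in W) (bump x z * C z))%R.
  by apply: Rintegral_support => z nWz; rewrite (bump_support gx xx nWz) mul0r.
rewrite /smooth !sW mulrCA -mulrDr; congr (_ * _).
rewrite -RintegralZl//; last exact: iA.
rewrite -RintegralD//; last 2 first.
- apply: (bounded_integrable (M := `|a| * (g x * M))) => //.
    by move: (measurable_bump x) => mb; meas.
  move=> z xz; rewrite !normrM ler_wpM2l// ler_pM//; first exact: bump_bound.
  exact: AM.
- exact: iA.
by apply: eq_Rintegral => z _; ring.
Qed.

(** Positive and negative parts of the integrals are measurable in the
    parameter. *)
Lemma measurable_smooth A : measurable_fun setT A ->
  measurable_fun setT (smooth A).
Proof.
move=> mA; have mR (u : T -> T -> R) :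
    measurable_fun setT (fun p : T * T => u p.1 p.2) ->
    measurable_fun setT (fun x => \int[mu]_z u x z)%R.
  move=> mu_; rewrite /Rintegral.
  apply: (measurableT_comp (fine_measurable measurableT)).
  rewrite (_ : (fun x => \int[mu]_z (u x z)%:E)%E =
    fun x => ((\int[mu]_z (Num.max (u x z) 0)%:E) -
              (\int[mu]_z (Num.max (- u x z) 0)%:E))%E); last first.
    apply/funext => x; rewrite integralE; congr (_ - _)%E.
      by apply: eq_integral => z _; rewrite funeposE EFin_max.
    by apply: eq_integral => z _; rewrite funenegE -EFinN EFin_max.
  have m0 (w : T -> T -> R) : measurable_fun setT (fun p : T * T => w p.1 p.2) ->
      measurable_fun setT (fun x => \int[mu]_z (Num.max (w x z) 0)%:E)%E.
    move=> mw.
    apply: (@measurable_fun_integral _ _ _ _ _ _ (fun x z => (Num.max (w x z) 0)%:E)).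
      apply: measurable_fun_EFin; apply: measurable_maxr => //.
    by move=> x z; rewrite lee_fin le_max lexx orbT.
  apply: emeasurable_funB; first exact: m0.
  by apply: (m0 (fun x z => - u x z)); exact: measurable_funN.
rewrite /smooth; apply: measurable_funM.
  apply: measurable_fun_powRc; apply: mR.
  by rewrite /bump; meas.
by apply: (mR (fun x z => bump x z * A z)); rewrite /bump; meas.
Qed.

End smoothing.

(** * The extension outside the open set *)

Lemma lee_pdiv (R : realType) (b : R) (x y : \bar R) :
  0 < b -> (b%:E * x <= y)%E -> (x <= b^-1%:E * y)%E.
Proof.
move=> b0 bxy; rewrite -(@lee_pmul2l _ b%:E)// muleA -EFinM divff ?gt_eqF//.
by rewrite mul1e.
Qed.

(** One constant for the two kinds of pieces in step_dev. *)
Lemma weighted_sum_le (R : realDomainType) (a b k x z y : R) :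
  0 <= a -> 0 <= b -> 0 <= k -> 0 <= x -> 0 <= z -> 0 <= y ->
  a * x + b * y <= (a + b + k) * (x + z + y).
Proof.
move=> a0 b0 k0 x0 z0 y0.
have -> : (a + b + k) * (x + z + y) =
  a * x + b * y + (a * (z + y) + b * (x + z) + k * (x + z + y)) by ring.
by rewrite lerDl !addr_ge0// mulr_ge0// ?addr_ge0.
Qed.

Lemma weighted_tail_le (R : realDomainType) (a b k x z y : R) :
  0 <= a -> 0 <= b -> 0 <= k -> 0 <= x -> 0 <= z -> 0 <= y ->
  k * (z + y) <= (a + b + k) * (x + z + y).
Proof.
move=> a0 b0 k0 x0 z0 y0.
have -> : (a + b + k) * (x + z + y) =
  k * (z + y) + (k * x + (a + b) * (x + z + y)) by ring.
by rewrite lerDl !addr_ge0// mulr_ge0// ?addr_ge0.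
Qed.

Section rational_points.
Context {R : realType} {d : nat}.
Local Notation T := 'rV[R]_d.

(** An enumeration of the rational points, which makes the choice of the nearby
    piece of O measurable. *)
Definition rpoint (n : nat) : T :=
  if @unpickle {ffun 'I_d -> rat} n is Some v then \row_i ratr (v i) else 0.

Lemma rpoint_dense (x : T) (e : R) : 0 < e ->
  exists n, enorm (x - rpoint n) < e.
Proof.
move=> e0; pose a := e / d.+1%:R / 2.
have a0 : 0 < a by rewrite !divr_gt0.
have qP (i : 'I_d) : exists q : rat, `|x ord0 i - ratr q| <= a.
  have [q] := @rat_in_itvoo R (x ord0 i - a) (x ord0 i) ltac:(by rewrite gtrBl).
  rewrite in_itv/= => /andP[q1 q2]; exists q.
  by rewrite ler_norml; apply/andP; split; lra.
pose v := [ffun i => projT1 (cid (qP i))].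
exists (pickle v); rewrite /rpoint pickleK.
apply: (@le_lt_trans _ _ (d.+1%:R * a)).
  apply: enorm_le_coord; first exact: ltW.
  by move=> i; rewrite !mxE ffunE; case: cid.
rewrite /a mulrA mulrCA divff ?pnatr_eq0// mulr1; lra.
Qed.

Context (g : T -> R).
Hypothesis mg : measurable_fun setT g.
Hypothesis g_lip : forall x y, g x <= g y + enorm (x - y).

(** For z in the cell of q the scales g(z) and g(q) are comparable. *)
Definition cell (z : T) n : bool := enorm (z - rpoint n) < g (rpoint n) / 8.

Lemma cell_ex z : 0 < g z -> exists n, cell z n.
Proof.
move=> gz; have [n zn] := @rpoint_dense z (g z / 16) ltac:(by rewrite divr_gt0).
by exists n; rewrite /cell; have := g_lip z (rpoint n); lra.
Qed.

Definition cell_index (z : T) : nat :=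
  if pselect (exists n, cell z n) is left e then ex_minn e else 0%N.

Lemma cell_indexP z : 0 < g z -> cell z (cell_index z).
Proof.
move=> /cell_ex ze; rewrite /cell_index; case: pselect => // e.
by case: ex_minnP.
Qed.

Lemma cell_indexE z n : cell_index z = n <->
  (cell z n /\ forall m, (m < n)%N -> ~~ cell z m) \/
  (n = 0%N /\ forall m, ~~ cell z m).
Proof.
rewrite /cell_index; case: pselect => [e|ne]; last first.
  split=> [<-|[[zn _]|[-> _]//]]; last by exfalso; apply: ne; exists n.
  by right; split => // m; apply/negP => zm; apply: ne; exists m.
case: ex_minnP => k zk kmin; split=> [<-|[[zn nmin]|[_ nz]]].
- by left; split => // m mk; apply/negP => /kmin; rewrite leqNgt mk.
- apply/eqP; rewrite eqn_leq kmin//= leqNgt; apply/negP => /nmin.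
  by rewrite zk.
- by have := nz k; rewrite zk.
Qed.

Lemma measurable_cell n : measurable [set z | cell z n].
Proof. by apply: measurable_bool_set; rewrite /cell; meas. Qed.

Lemma measurable_cell_index n : measurable [set z | cell_index z = n].
Proof.
have -> : [set z | cell_index z = n] =
  ([set z | cell z n] `&` \bigcap_(m in [set m | (m < n)%N]) ~` [set z | cell z m])
  `|` (if n == 0%N then \bigcap_m ~` [set z | cell z m] else set0).
  apply/seteqP; split => z /=.
    move=> /cell_indexE[[zn nmin]|[-> nz]].
      by left; split => // m /= /nmin/negP.
    by right; rewrite eqxx => m _ /=; apply/negP.
  move=> zn; apply/cell_indexE; case: zn => [[zn nmin]|].
    by left; split => // m mn; apply/negP; exact: nmin.
  case: eqP => // -> nz; right; split => // m; apply/negP; exact: (nz m I).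
apply: measurableU.
  apply: measurableI; first exact: measurable_cell.
  by apply: bigcap_measurableType => m _; apply: measurableC; exact: measurable_cell.
case: eqP => _; last exact: measurable0.
by apply: bigcap_measurableType => m _; apply: measurableC; exact: measurable_cell.
Qed.

(** The step function takes countably many values, on the measurable sets where
    the cell index is constant. *)
Lemma measurable_step (a : nat -> R) :
  measurable_fun setT (fun z => a (cell_index z)).
Proof.
move=> _ Y mY; rewrite setTI.
have -> : (fun z => a (cell_index z)) @^-1` Y =
    \bigcup_n (if a n \in Y then [set z | cell_index z = n] else set0).
  apply/seteqP; split => z /=.
    by move=> Yz; exists (cell_index z) => //; rewrite mem_set.
  by move=> [n _]; case: ifPn => // /set_mem Yn /= ->.
apply: bigcupT_measurable => n; case: ifP => _; last exact: measurable0.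
exact: measurable_cell_index.
Qed.

End rational_points.

Section extension.
Context {R : realType} {d : nat}.
Local Notation T := 'rV[R]_d.
Local Notation mu := (lebesgue_rV d : {sigma_finite_measure set T -> \bar R}).
Context (O : set T) (g h : T -> R) (kappa p : R).
Hypothesis mO : measurable O.
Hypothesis mg : measurable_fun setT g.
Hypothesis g_ge0 : forall x, 0 <= g x.
Hypothesis g_lip : forall x y, g x <= g y + enorm (x - y).
Hypothesis h_lip : forall x y, h x <= h y + enorm (x - y).
Hypothesis h_le : forall x, h x <= 100^-1.
Hypothesis kappa0 : 0 < kappa.
Hypothesis g_thick : forall x, 0 < g x < 2^-1 ->
  ((kappa * g x ^+ d)%:E <= mu (eball x (3 * g x) `&` O))%E.
Hypothesis p0 : 0 < p.
Implicit Types (x y z w : T) (f : T -> R) (b : R).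

Definition patch n : set T := eball (rpoint n) (3 * g (rpoint n)) `&` O.

(** The value 0 is given to the pieces that see D at a comparable scale, so
    that the extension vanishes where h <= g (extend_eq0). *)
Definition active n : bool :=
  0 < g (rpoint n) < h (rpoint n) / 4.

Definition patch_value f n : R :=
  if active n then near_mean mu p (patch n) f else 0.

Definition step f z : R := patch_value f (cell_index g z).

Definition extend f : T -> R := smooth g (step f).

Definition local_dev f x b : \bar R :=
  (\int[mu]_w (\1[w \in O] * \1[enorm (x - w) < 6 * g x] *
     `|f w - b| `^ p)%:E)%E.

Definition local_osc f x : \bar R :=
  (\int[mu]_w \int[mu]_z (\1[w \in O] * \1[z \in O] *
     \1[enorm (x - w) < 6 * g x] * \1[enorm (x - z) < 6 * g x] *
     `|f z - f w| `^ p)%:E)%E.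

(** Mean oscillation of f on O near x, plus the mean of |f|^p near the
    transition region where inactive pieces occur (inactive_transition). *)
Definition local_err f x : \bar R :=
  ((g x `^ (- d%:R) * g x `^ (- d%:R))%:E * local_osc f x +
   (\1[h x <= 8 * g x] * g x `^ (- d%:R))%:E * local_dev f x 0)%E.

Lemma measurable_patch n : measurable (patch n).
Proof. by apply: measurableI => //; exact: measurable_eball. Qed.

Lemma measurable_extend f : measurable_fun setT (extend f).
Proof.
apply: measurable_smooth => //; exact: measurable_step.
Qed.

Lemma local_dev_ge0 f x b : (0 <= local_dev f x b)%E.
Proof. by rewrite /local_dev; nn. Qed.

Lemma local_osc_ge0 f x : (0 <= local_osc f x)%E.
Proof. by rewrite /local_osc; nn. Qed.

Lemma local_err_ge0 f x : (0 <= local_err f x)%E.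
Proof.
apply: adde_ge0; apply: mule_ge0; rewrite ?local_osc_ge0 ?local_dev_ge0//; nn.
Qed.

Lemma gpow_inv x : 0 < g x -> g x `^ (- d%:R) = (g x ^+ d)^-1.
Proof. by move=> gx; rewrite powRN powR_mulrn// ltW. Qed.

Lemma cell_geometry x z : 0 < g x -> enorm (x - z) < g x / 2 ->
  let q := rpoint (cell_index g z) in
  [/\ 4 / 9 * g x <= g q, g q <= 12 / 7 * g x & enorm (x - q) <= 5 / 7 * g x].
Proof.
move=> gx xz q.
have gz : 0 < g z by have := g_lip x z; lra.
have := cell_indexP g_lip gz; rewrite /cell -/q => zq.
have h1 := g_lip x q; have h2 := g_lip q x; have h3 := enorm_triangle z x q.
rewrite (enormC q x) in h2.
by split; lra.
Qed.

Lemma patch_subset x z : 0 < g x -> enorm (x - z) < g x / 2 ->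
  patch (cell_index g z) `<=` eball x (6 * g x) `&` O.
Proof.
move=> gx xz w [qw Ow]; split => //.
have [h1 h2 h3] := cell_geometry gx xz; move: qw; rewrite /eball/= => qw.
by have := enorm_triangle (rpoint (cell_index g z)) x w; lra.
Qed.

(** An inactive piece near x has h <= 4 g at its centre, and centre and x are at
    distance comparable to g(x). *)
Lemma inactive_transition x z : 0 < g x -> enorm (x - z) < g x / 2 ->
  ~~ active (cell_index g z) -> h x <= 8 * g x.
Proof.
move=> gx xz; have [q1 q2 q3] := cell_geometry gx xz.
have q0 : 0 < g (rpoint (cell_index g z)).
  by apply: lt_le_trans q1; rewrite mulr_gt0.
rewrite /active q0/= -leNgt => hq.
by have := h_lip x (rpoint (cell_index g z)); lra.
Qed.

Lemma thick_volume_at x : 0 < g x < 2^-1 ->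
  ((kappa * g x ^+ d)%:E <= mu (eball x (6 * g x) `&` O))%E.
Proof.
move=> gx12; apply: (le_trans (g_thick gx12)); apply: le_measure; rewrite ?inE.
- by apply: measurableI => //; exact: measurable_eball.
- by apply: measurableI => //; exact: measurable_eball.
- move=> w [] + Ow; rewrite /eball/= => xw; split => //=.
  by have := g_ge0 x; lra.
Qed.

Lemma active_small n : active n -> 0 < g (rpoint n) < 2^-1.
Proof.
by move=> /andP[-> gh] /=; have := h_le (rpoint n); lra.
Qed.

Lemma patch_volume n : active n ->
  ((kappa * g (rpoint n) ^+ d)%:E <= mu (patch n))%E.
Proof. by move=> /active_small an; exact: g_thick. Qed.

Lemma patch_fin n : (mu (patch n) < +oo)%E.
Proof.
apply: (@le_lt_trans _ _ (mu (eball (rpoint n) (3 * g (rpoint n))))).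
  apply: le_measure; rewrite ?inE.
  - exact: measurable_patch.
  - exact: measurable_eball.
  - by move=> w [].
by apply: eball_fin; rewrite mulr_ge0.
Qed.

Definition patch_cst : R := kappa * (4 / 9) ^+ d.

Lemma patch_cst_gt0 : 0 < patch_cst.
Proof. by rewrite mulr_gt0// exprn_gt0. Qed.

Lemma patch_volume_at x z : 0 < g x -> enorm (x - z) < g x / 2 ->
  active (cell_index g z) ->
  ((patch_cst * g x ^+ d)%:E <= mu (patch (cell_index g z)))%E.
Proof.
move=> gx xz an; apply: le_trans (patch_volume an).
rewrite lee_fin /patch_cst -mulrA -exprMn ler_wpM2l ?(ltW kappa0)//.
have [h1 _ _] := cell_geometry gx xz.
by rewrite lerXn2r ?nnegrE ?g_ge0// mulr_ge0.
Qed.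

Local Opaque patch_cst.

Section estimates.
Variable f : T -> R.
Hypothesis mf : measurable_fun setT f.
Hypothesis fp : (\int[mu]_w (\1[w \in O] * `|f w| `^ p)%:E < +oo)%E.

Lemma patch_Lp n : (\int[mu]_w (\1[w \in patch n] * `|f w| `^ p)%:E < +oo)%E.
Proof.
apply: le_lt_trans fp; apply: integral_le => w; first by nn.
rewrite lee_fin ler_wpM2r ?powR_ge0// /patch in_setI.
by case: (w \in O); rewrite ?andbF// andbT; case: (_ \in _).
Qed.

Lemma patch_value_dev n : active n ->
  ((fine (mu (patch n)))%:E * deviation mu p (patch n) f (patch_value f n) <=
   oscillation mu p (patch n) f)%E.
Proof.
move=> an; rewrite /patch_value an; apply: near_valueP => //.
- exact: measurable_patch.
- apply: lt_le_trans (patch_volume an); rewrite lte_fin mulr_gt0// exprn_gt0//.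
  by case/andP : an.
- exact: patch_fin.
- exact: patch_Lp.
Qed.

Lemma patch_osc_le x z : 0 < g x -> enorm (x - z) < g x / 2 ->
  (oscillation mu p (patch (cell_index g z)) f <= local_osc f x)%E.
Proof.
move=> gx xz; apply: integral_le => w; first by nn.
apply: integral_le => v; first by nn.
rewrite lee_fin (distrC (f w)) ler_wpM2r ?powR_ge0//.
have [/set_mem/(patch_subset gx xz)[Bw Ow]|_] := boolP (w \in patch _); last first.
  by rewrite mul0r; nn.
have [/set_mem/(patch_subset gx xz)[Bv Ov]|_] := boolP (v \in patch _); last first.
  by rewrite mulr0; nn.
rewrite !mem_set//.
have -> : enorm (x - w) < 6 * g x by exact: Bw.
have -> : enorm (x - v) < 6 * g x by exact: Bv.
by rewrite !mulr1.
Qed.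

(** The triangle inequality through f w, averaged over w in W. *)
Lemma average_triangle (W : set T) (m a b : R) : measurable W ->
  (m%:E <= mu W)%E -> 0 <= m ->
  (m%:E * (`|a - b| `^ p)%:E <= (2 `^ p)%:E *
    (\int[mu]_w (\1[w \in W] * `|a - f w| `^ p)%:E +
     \int[mu]_w (\1[w \in W] * `|f w - b| `^ p)%:E))%E.
Proof.
move=> mW mmu m0.
apply: (@le_trans _ _ (mu W * (`|a - b| `^ p)%:E)%E).
  by apply: lee_wpmul2r => //; nn.
rewrite -integral_mem// muleC -integral_scale; [|by meas|by nn|by nn].
rewrite -integral_add; [|by meas|by meas|by nn|by nn].
rewrite -integral_scale; [|by meas|by nn|by nn].
apply: integral_le => w; first by nn.
rewrite -EFinD -!EFinM lee_fin; case: (w \in W).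
  by rewrite mulr1 !mul1r; exact: powR_dist_triangle.
by rewrite !mul0r addr0 !mulr0.
Qed.

Let I : R := fine (\int[mu]_w (\1[w \in O] * `|f w| `^ p)%:E)%E.

Let IE : (\int[mu]_w (\1[w \in O] * `|f w| `^ p)%:E)%E = I%:E.
Proof. by rewrite fineK// ge0_fin_numE//; nn. Qed.

Let I0 : 0 <= I.
Proof. by rewrite -lee_fin -IE; nn. Qed.

Let V x : R := (12 * g x) ^+ d.

Let V0 x : 0 <= V x.
Proof. by rewrite exprn_ge0// mulr_ge0. Qed.

Lemma ball_integral_le x :
  (\int[mu]_w (\1[w \in O] * \1[enorm (x - w) < 6 * g x])%:E <= (V x)%:E)%E.
Proof.
apply: (@le_trans _ _ (mu (eball x (6 * g x)))).
  rewrite -integral_ind_eball; apply: integral_le => w; first by nn.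
  by rewrite lee_fin ler_piMl//; case: (_ \in _).
apply: le_trans (eball_vol_le _ _) _; first by rewrite mulr_ge0.
by rewrite lee_fin /V (_ : 2 * (6 * g x) = 12 * g x)//; ring.
Qed.

Lemma local_dev_le x b :
  (local_dev f x b <= (2 `^ p * (I + `|b| `^ p * V x))%:E)%E.
Proof.
rewrite EFinM EFinD -IE EFinM.
apply: (@le_trans _ _ ((2 `^ p)%:E * (\int[mu]_w (\1[w \in O] * `|f w| `^ p)%:E +
   (`|b| `^ p)%:E * \int[mu]_w (\1[w \in O] * \1[enorm (x - w) < 6 * g x])%:E))%E);
  last first.
  apply: lee_wpmul2l; first by nn.
  by apply: leeD => //; apply: lee_wpmul2l; [nn|exact: ball_integral_le].
rewrite -integral_scale; [|by meas|by nn|by nn].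
rewrite -integral_add; [|by meas|by meas|by nn|by nn].
rewrite -integral_scale; [|by meas|by nn|by nn].
apply: integral_le => w; first by nn.
rewrite -(EFinM (`|b| `^ p)) -EFinD -EFinM lee_fin.
have := powR_normB (f w) b p0.
case: (w \in O); case: (_ < _); rewrite ?mulr1 ?mul1r ?mul0r ?mulr0 ?addr0 ?add0r//.
Qed.

(** Real-valued versions of the local integrals, finite since |f|^p is integrable
    on O; the pointwise estimates are then inequalities between reals. *)
Definition rdev x b : R := fine (local_dev f x b).

Lemma rdevE x b : (rdev x b)%:E = local_dev f x b.
Proof.
apply: fineK; rewrite (ge0_fin_numE (local_dev_ge0 f x b)).
exact: le_lt_trans (local_dev_le x b) (ltry _).
Qed.

Lemma rdev_ge0 x b : 0 <= rdev x b.
Proof. by rewrite -lee_fin rdevE local_dev_ge0. Qed.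

Lemma measurable_local_dev x : measurable_fun setT (fun w => local_dev f x (f w)).
Proof. by rewrite /local_dev; meas; nn. Qed.

Lemma local_oscE x : local_osc f x =
  (\int[mu]_w ((\1[w \in O] * \1[enorm (x - w) < 6 * g x])%:E *
     local_dev f x (f w)))%E.
Proof.
apply: eq_integral => w _; rewrite /local_dev.
rewrite -integral_scale; [|by meas|by nn|by nn].
by apply: eq_integral => z _; rewrite -EFinM; congr EFin; ring.
Qed.

Lemma local_osc_fin x : (local_osc f x < +oo)%E.
Proof.
rewrite local_oscE.
apply: (@le_lt_trans _ _ (2 `^ p * (I * V x + V x * I))%:E); last exact: ltry.
apply: (@le_trans _ _ (\int[mu]_w ((2 `^ p)%:E *
   (I%:E * (\1[w \in O] * \1[enorm (x - w) < 6 * g x])%:E +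
   (V x)%:E * (\1[w \in O] * `|f w| `^ p)%:E)))%E).
  apply: integral_le => w; first by apply: mule_ge0; [nn|exact: local_dev_ge0].
  have h1 := local_dev_le x (f w).
  apply: (@le_trans _ _ ((\1[w \in O] * \1[enorm (x - w) < 6 * g x])%:E *
    (2 `^ p * (I + `|f w| `^ p * V x))%:E)%E); first by apply: lee_wpmul2l; [nn|].
  rewrite -(EFinM I) -(EFinM (V x)) -EFinD -EFinM -EFinM lee_fin.
  case: (w \in O); case: (_ < _); rewrite ?mulr1 ?mul1r ?mul0r ?mulr0 ?add0r.
  - by rewrite (mulrC (V x)).
  - by apply: mulr_ge0; [nn|]; apply: mulr_ge0; [exact: V0|nn].
  - by rewrite mulr0.
  - by rewrite mulr0.
have m1 : measurable_fun setT (fun w => (I%:E *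
    (\1[w \in O] * \1[enorm (x - w) < 6 * g x])%:E : \bar R)%E) by meas.
have m2 : measurable_fun setT (fun w => ((V x)%:E *
    (\1[w \in O] * `|f w| `^ p)%:E : \bar R)%E) by meas.
have n1 w : (0 <= I%:E * (\1[w \in O] * \1[enorm (x - w) < 6 * g x])%:E)%E by nn.
have n2 w : (0 <= (V x)%:E * (\1[w \in O] * `|f w| `^ p)%:E)%E.
  by apply: mule_ge0; [rewrite lee_fin|nn].
rewrite integral_scale; [|exact: emeasurable_funD|by nn|by move=> w; exact: adde_ge0].
rewrite integral_add//.
rewrite integral_scale; [|by meas|exact: I0|by nn].
rewrite integral_scale; [|by meas|exact: V0|by nn].
rewrite IE EFinM EFinD; apply: lee_wpmul2l; first by nn.
apply: leeD; last by rewrite EFinM.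
by rewrite EFinM; apply: lee_wpmul2l; [rewrite lee_fin|exact: ball_integral_le].
Qed.

Definition rosc x : R := fine (local_osc f x).

Lemma roscE x : (rosc x)%:E = local_osc f x.
Proof. by apply: fineK; rewrite (ge0_fin_numE (local_osc_ge0 f x)) local_osc_fin. Qed.

Lemma rosc_ge0 x : 0 <= rosc x.
Proof. by rewrite -lee_fin roscE local_osc_ge0. Qed.

Definition rerr x : R :=
  g x `^ (- d%:R) * g x `^ (- d%:R) * rosc x +
  \1[h x <= 8 * g x] * g x `^ (- d%:R) * rdev x 0.

Lemma unfold_rerr x : rerr x =
  g x `^ (- d%:R) * g x `^ (- d%:R) * rosc x +
  \1[h x <= 8 * g x] * g x `^ (- d%:R) * rdev x 0.
Proof. by []. Qed.

Lemma rerrE x : (rerr x)%:E = local_err f x.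
Proof.
by rewrite /rerr EFinD (EFinM _ (rosc x)) (EFinM _ (rdev x 0)) roscE rdevE.
Qed.

Lemma rerr_ge0 x : 0 <= rerr x.
Proof. by rewrite -lee_fin rerrE local_err_ge0. Qed.

Lemma local_devE x b : local_dev f x b =
  (\int[mu]_w (\1[w \in O] * \1[enorm (x - w) < 6 * g x] *
     `|f w - b| `^ p)%:E)%E.
Proof. by []. Qed.

Local Opaque rdev rosc rerr local_dev local_osc local_err.

Definition step_cst : R :=
  2 `^ p * (patch_cst^-1 * patch_cst^-1 + patch_cst^-1 + kappa^-1).

Lemma step_cst_ge0 : 0 <= step_cst.
Proof. by move: patch_cst_gt0 => k1; rewrite /step_cst; nn. Qed.

(** For an active piece, compare with b through the values of f on the piece: the
    near-mean deviates from them by the oscillation. For an inactive one the value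
    is 0, and the transition term of the error contains |f|^p. *)
Lemma step_dev x z b : 0 < g x < 2^-1 -> enorm (x - z) < g x / 2 ->
  `|step f z - b| `^ p <= step_cst * (rerr x + g x `^ (- d%:R) * rdev x b).
Proof.
move=> /andP[gx gx2] xz; set n := cell_index g z.
have k1 := patch_cst_gt0.
have gd0 : 0 < g x ^+ d by rewrite exprn_gt0.
have G0 : 0 < g x `^ (- d%:R) by rewrite powR_gt0.
have gG : g x ^+ d * g x `^ (- d%:R) = 1.
  by rewrite gpow_inv// divff// gt_eqF.
have X0 := rosc_ge0 x; have Y0 := rdev_ge0 x b; have Z0 := rdev_ge0 x 0.
rewrite /step -/n; have [an|nan] := boolP (active n).
  set m := patch_cst * g x ^+ d.
  have m0 : 0 < m by rewrite mulr_gt0.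
  have volm := patch_volume_at gx xz an.
  set a := patch_value f n.
  have devm : (m%:E * deviation mu p (patch n) f a <= (rosc x)%:E)%E.
    rewrite roscE; apply: le_trans (patch_osc_le gx xz).
    apply: le_trans (patch_value_dev an); apply: lee_wpmul2r.
      exact: deviation_ge0.
    by rewrite fineK ?(ge0_fin_numE (measure_ge0 _ _)) ?patch_fin.
  have devb : (\int[mu]_w (\1[w \in patch n] * `|f w - b| `^ p)%:E <=
      (rdev x b)%:E)%E.
    rewrite rdevE local_devE; apply: integral_le => w; first by nn.
    rewrite lee_fin ler_wpM2r ?powR_ge0//.
    have [/set_mem/(patch_subset gx xz)[Bw Ow]|_] := boolP (w \in patch _); last first.
      by nn.
    rewrite mem_set//; have -> : enorm (x - w) < 6 * g x by exact: Bw.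
    by rewrite mulr1.
  have H := average_triangle a b (@measurable_patch n) volm (ltW m0).
  have : ((m * (m * `|a - b| `^ p))%:E <=
      (2 `^ p * (rosc x + m * rdev x b))%:E)%E.
    rewrite 2!EFinM; apply: (@le_trans _ _ (m%:E * ((2 `^ p)%:E *
       (deviation mu p (patch n) f a + (rdev x b)%:E)))%E).
      apply: lee_wpmul2l; first by rewrite lee_fin ltW.
      apply: (le_trans H); apply: lee_wpmul2l; first by nn.
      exact: leeD.
    rewrite muleCA (EFinM (2 `^ p)) EFinD (EFinM m).
    apply: lee_wpmul2l; first by nn.
    rewrite ge0_muleDr; [|exact: deviation_ge0|by rewrite lee_fin; exact: Y0].
    by apply: leeD.
  rewrite lee_fin => {}H.
  have -> : `|a - b| `^ p = m^-1 * (m^-1 * (m * (m * `|a - b| `^ p))).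
    by rewrite !mulKf ?gt_eqF.
  apply: (@le_trans _ _ (m^-1 * (m^-1 * (2 `^ p * (rosc x + m * rdev x b))))).
    have im : 0 <= m^-1 by rewrite invr_ge0 ltW.
    by apply: ler_wpM2l => //; apply: ler_wpM2l.
  have -> : m^-1 * (m^-1 * (2 `^ p * (rosc x + m * rdev x b))) =
    2 `^ p * (patch_cst^-1 * patch_cst^-1 *
       (g x `^ (- d%:R) * g x `^ (- d%:R) * rosc x) +
       patch_cst^-1 * (g x `^ (- d%:R) * rdev x b)).
    rewrite (gpow_inv gx) /m.
    move: (2 `^ p) (patch_cst) (g x ^+ d) k1 gd0 => P c G c0 Gp.
    by field; rewrite !gt_eqF.
  rewrite /step_cst (unfold_rerr x) -[leRHS]mulrA; apply: ler_wpM2l; first exact: powR_ge0.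
apply: (@weighted_sum_le R (patch_cst^-1 * patch_cst^-1) patch_cst^-1 kappa^-1
  (g x `^ (- d%:R) * g x `^ (- d%:R) * rosc x)
  (\1[h x <= 8 * g x] * g x `^ (- d%:R) * rdev x 0)
  (g x `^ (- d%:R) * rdev x b)).
- by rewrite mulr_ge0// invr_ge0 ltW.
- by rewrite invr_ge0 ltW.
- by rewrite invr_ge0 ltW.
- by rewrite !mulr_ge0// ltW.
- by rewrite !mulr_ge0// ?ltW.
- exact: (mulr_ge0 (ltW G0) Y0).
(* An inactive piece: the ball B(x, 6 g(x)) replaces it in the comparison. *)
have hx := inactive_transition gx xz nan.
rewrite /patch_value (negbTE nan).
have gx12 : 0 < g x < 2^-1 by rewrite gx.
have vol := thick_volume_at gx12.
have mB : measurable (eball x (6 * g x) `&` O).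
  by apply: measurableI => //; exact: measurable_eball.
set m := kappa * g x ^+ d.
have m0 : 0 < m by rewrite mulr_gt0.
have H := average_triangle 0 b mB vol (ltW m0).
have mem_ball w : \1[w \in eball x (6 * g x) `&` O] =
    \1[w \in O] * \1[enorm (x - w) < 6 * g x] :> R.
  by rewrite in_setI eball_mem; case: (_ < _); case: (w \in O); rewrite ?mulr1 ?mulr0.
have : ((m * `|0 - b| `^ p)%:E <= (2 `^ p * (rdev x 0 + rdev x b))%:E)%E.
  rewrite (EFinM m); apply: (le_trans H).
  have -> : (2 `^ p * (rdev x 0 + rdev x b))%:E =
      ((2 `^ p)%:E * (local_dev f x 0 + local_dev f x b))%E.
    rewrite -(rdevE x 0) -(rdevE x b); exact: erefl.
  rewrite (local_devE x 0) (local_devE x b).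
  apply: lee_wpmul2l; first by nn.
  apply: leeD; apply: integral_le => w; rewrite ?mem_ball//; try by nn.
  by rewrite distrC.
rewrite lee_fin => {}H.
have -> : `|0 - b| `^ p = m^-1 * (m * `|0 - b| `^ p) by rewrite mulKf ?gt_eqF.
apply: (@le_trans _ _ (m^-1 * (2 `^ p * (rdev x 0 + rdev x b)))).
  by apply: ler_wpM2l => //; rewrite invr_ge0 ltW.
have -> : m^-1 * (2 `^ p * (rdev x 0 + rdev x b)) =
    2 `^ p * (kappa^-1 * (\1[h x <= 8 * g x] * g x `^ (- d%:R) * rdev x 0 +
       g x `^ (- d%:R) * rdev x b)).
  rewrite (gpow_inv gx) /m hx mulr1n mul1r.
  move: (2 `^ p) (g x ^+ d) gd0 kappa kappa0 (rdev x 0) (rdev x b) => P G Gp c c0 u v.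
  by field; rewrite !gt_eqF.
rewrite /step_cst (unfold_rerr x) -[leRHS]mulrA; apply: ler_wpM2l; first exact: powR_ge0.
apply: (@weighted_tail_le R (patch_cst^-1 * patch_cst^-1) patch_cst^-1 kappa^-1
  (g x `^ (- d%:R) * g x `^ (- d%:R) * rosc x)
  (\1[h x <= 8 * g x] * g x `^ (- d%:R) * rdev x 0)
  (g x `^ (- d%:R) * rdev x b)).
- by rewrite mulr_ge0// invr_ge0 ltW.
- by rewrite invr_ge0 ltW.
- by rewrite invr_ge0 ltW.
- by rewrite !mulr_ge0// ltW.
- by rewrite !mulr_ge0// ?ltW.
- exact: (mulr_ge0 (ltW G0) Y0).
Qed.

Local Opaque step_cst.

Definition dev_cst : R := step_cst * (12 ^+ d + 1).

Lemma dev_cst_ge0 : 0 <= dev_cst.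
Proof. by have := step_cst_ge0; rewrite /dev_cst => c0; nn. Qed.

Lemma rosc_le x : 0 < g x -> g x `^ (- d%:R) * rosc x <= g x ^+ d * rerr x.
Proof.
move=> gx; have G0 : 0 < g x `^ (- d%:R) by rewrite powR_gt0.
have gG : g x ^+ d * g x `^ (- d%:R) = 1.
  by rewrite gpow_inv// divff// expf_neq0// gt_eqF.
have -> : g x `^ (- d%:R) * rosc x =
    g x ^+ d * (g x `^ (- d%:R) * g x `^ (- d%:R) * rosc x).
  by rewrite !mulrA gG mul1r.
apply: ler_wpM2l; first by apply: exprn_ge0; exact: ltW.
rewrite (unfold_rerr x) lerDl; apply: mulr_ge0; [nn|exact: rdev_ge0].
Qed.

(** Take b = f w in step_dev and average over w. *)
Lemma rdev_step x z : 0 < g x < 2^-1 -> enorm (x - z) < g x / 2 ->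
  rdev x (step f z) <= dev_cst * (g x ^+ d * rerr x).
Proof.
move=> gx12 xz; have gx : 0 < g x by case/andP : gx12.
have c0 := step_cst_ge0; have e0 := rerr_ge0 x.
have G0 : 0 <= g x `^ (- d%:R) by exact: powR_ge0.
have ml := measurable_local_dev x.
have l0 w : (0 <= local_dev f x (f w))%E by exact: local_dev_ge0.
pose J w : \bar R := (\1[w \in O] * \1[enorm (x - w) < 6 * g x])%:E.
have J0 w : (0 <= J w)%E by rewrite /J; nn.
have mJ : measurable_fun setT J by rewrite /J; meas.
rewrite -lee_fin rdevE.
apply: (@le_trans _ _ (\int[mu]_w ((step_cst * rerr x)%:E * J w +
   (step_cst * g x `^ (- d%:R))%:E * (J w * local_dev f x (f w))))%E).
  apply: integral_le => w; first by nn.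
  have := step_dev (f w) gx12 xz; rewrite -lee_fin (EFinM step_cst) (EFinD (rerr x)).
  rewrite (EFinM (g x `^ _)) rdevE distrC => H.
  rewrite (EFinM (_ * _)) -/(J w).
  apply: (@le_trans _ _ (J w * (step_cst%:E * ((rerr x)%:E +
      (g x `^ (- d%:R))%:E * local_dev f x (f w))))%E).
    exact: lee_wpmul2l.
  rewrite ge0_muleDr; [|by rewrite lee_fin|by apply: mule_ge0; [nn|]].
  rewrite ge0_muleDr; [| |]; last 2 first.
  - by apply: mule_ge0; rewrite lee_fin.
  - by apply: mule_ge0; [nn|apply: mule_ge0; [nn|]].
  rewrite (EFinM step_cst (rerr x)) (EFinM step_cst (g x `^ _)).
  by rewrite (muleCA (J w)) (muleCA (J w)) (muleC (J w) (rerr x)%:E) (muleCA (J w) (g x `^ _)%:E) !muleA.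
rewrite integral_add; last 4 first.
- by apply: emeasurable_funM => //; exact: measurable_cst.
- by apply: emeasurable_funM; [exact: measurable_cst|exact: emeasurable_funM].
- by move=> w; apply: mule_ge0; [nn|exact: J0].
- by move=> w; apply: mule_ge0; [nn|exact: mule_ge0].
rewrite integral_scale; [|exact: mJ|by nn|exact: J0].
rewrite integral_scale; [|exact: emeasurable_funM|by nn|by move=> w; exact: mule_ge0].
rewrite -local_oscE -roscE.
apply: (@le_trans _ _ ((step_cst * rerr x)%:E * (V x)%:E +
   (step_cst * g x `^ (- d%:R))%:E * (rosc x)%:E)%E).
  apply: leeD => //; apply: lee_wpmul2l; first by nn.
  exact: ball_integral_le.
rewrite -!EFinM -EFinD lee_fin -[X in _ + X]mulrA.
apply: (@le_trans _ _ (step_cst * rerr x * V x + step_cst * (g x ^+ d * rerr x))).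
  by rewrite lerD2l; apply: ler_wpM2l => //; exact: rosc_le.
rewrite /dev_cst /V exprMn le_eqVlt; apply/orP; left; apply/eqP; ring.
Qed.

Local Opaque dev_cst.

Definition near_cst : R := step_cst * (1 + dev_cst).

Lemma near_cst_ge0 : 0 <= near_cst.
Proof.
by have := step_cst_ge0; have := dev_cst_ge0; rewrite /near_cst => a b; nn.
Qed.

(** Take b = step f z' in step_dev and bound its deviation by rdev_step. *)
Lemma step_near x z z' : 0 < g x < 2^-1 -> enorm (x - z) < g x / 2 ->
  enorm (x - z') < g x / 2 ->
  `|step f z - step f z'| `^ p <= near_cst * rerr x.
Proof.
move=> gx12 xz xz'; have gx : 0 < g x by case/andP : gx12.
have e0 := rerr_ge0 x.
apply: (le_trans (step_dev (step f z') gx12 xz)).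
rewrite /near_cst -mulrA; apply: ler_wpM2l; first exact: step_cst_ge0.
rewrite mulrDl mul1r lerD2l.
apply: (@le_trans _ _ (g x `^ (- d%:R) * (dev_cst * (g x ^+ d * rerr x)))).
  by apply: ler_wpM2l; [nn|exact: rdev_step].
rewrite mulrCA; apply: ler_wpM2l; first exact: dev_cst_ge0.
by rewrite gpow_inv// mulKf// expf_neq0// gt_eqF.
Qed.

Local Opaque near_cst.

Let osc_bound x : R := (near_cst * rerr x) `^ p^-1.

Let osc_boundE x : osc_bound x `^ p = near_cst * rerr x.
Proof.
rewrite /osc_bound -powRrM mulVf ?gt_eqF// powRr1//.
by rewrite mulr_ge0 ?near_cst_ge0 ?rerr_ge0.
Qed.

Lemma step_osc x z : 0 < g x < 2^-1 -> enorm (x - z) < g x / 2 ->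
  `|step f z - step f x| <= (near_cst * rerr x) `^ p^-1.
Proof.
move=> gx12 xz; have gx : 0 < g x by case/andP : gx12.
have xx : enorm (x - x) < g x / 2 by rewrite subrr enorm0 divr_gt0.
rewrite -/(osc_bound x); have := step_near gx12 xz xx.
rewrite -osc_boundE -{1}(normr_id (step f z - _)) => H.
rewrite leNgt; apply/negP => lt_.
have := gt0_ltr_powR p0 _ _ lt_; rewrite !nnegrE normr_ge0 powR_ge0.
by move=> /(_ isT isT); rewrite ltNge; move: H; rewrite normr_id => ->.
Qed.

Let measurable_step_f : measurable_fun setT (step f).
Proof. exact: measurable_step. Qed.

Lemma extend_near x : 0 < g x < 2^-1 ->
  `|extend f x - step f x| `^ p <= near_cst * rerr x.
Proof.
move=> gx12; have gx : 0 < g x by case/andP : gx12.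
rewrite -osc_boundE; apply: ge0_ler_powR; rewrite ?nnegrE ?(ltW p0) ?powR_ge0//.
apply: smooth_near => //.
by move=> z xz; exact: step_osc.
Qed.

Definition lip_cst : R := @smooth_cst R d `^ p * near_cst.

Lemma lip_cst_ge0 : 0 <= lip_cst.
Proof. by have := near_cst_ge0; rewrite /lip_cst => c0; nn. Qed.

Lemma extend_lip x y : 0 < g x < 2^-1 -> enorm (x - y) < g x / 8 ->
  `|extend f x - extend f y| `^ p <=
  lip_cst * ((enorm (x - y) / g x) `^ p * rerr x).
Proof.
move=> gx12 xy; have gx : 0 < g x by case/andP : gx12.
have r0 : 0 <= enorm (x - y) / g x by rewrite divr_ge0 ?enorm_ge0// ltW.
have s0 : 0 <= @smooth_cst R d.
  by rewrite mulr_ge0// ltW// bump_cst_gt0.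
have -> : lip_cst * ((enorm (x - y) / g x) `^ p * rerr x) =
    (@smooth_cst R d * (enorm (x - y) / g x) * osc_bound x) `^ p.
  rewrite (powRM p (mulr_ge0 s0 r0) (powR_ge0 _ _)) (powRM p s0 r0) osc_boundE /lip_cst.
  by ring.
apply: ge0_ler_powR; rewrite ?nnegrE ?(ltW p0)//.
  by apply: mulr_ge0; [exact: mulr_ge0|exact: powR_ge0].
apply: (@smooth_lip _ _ _ g_lip x _ (step f x)).
- exact: gx.
- exact: measurable_step_f.
- exact: powR_ge0.
- by move=> z xz; exact: step_osc.
- exact: xy.
Qed.

Definition ext_cst : R := 2 `^ p * (dev_cst + 12 ^+ d * near_cst).

Lemma ext_cst_ge0 : 0 <= ext_cst.
Proof.
by have := dev_cst_ge0; have := near_cst_ge0; rewrite /ext_cst => a b; nn.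
Qed.

Lemma rdev_triangle x b c : rdev x c <= 2 `^ p * (rdev x b + V x * `|b - c| `^ p).
Proof.
rewrite -lee_fin (EFinM (2 `^ p)) (EFinD (rdev x b)) (EFinM (V x)) !rdevE.
apply: (@le_trans _ _ ((2 `^ p)%:E * (local_dev f x b + (`|b - c| `^ p)%:E *
  \int[mu]_w (\1[w \in O] * \1[enorm (x - w) < 6 * g x])%:E))%E); last first.
  apply: lee_wpmul2l; first by nn.
  apply: leeD => //; rewrite muleC; apply: lee_wpmul2r; first by nn.
  exact: ball_integral_le.
rewrite -integral_scale; [|by meas|by nn|by nn].
rewrite !local_devE -integral_add; [|by meas|by meas|by nn|by nn].
rewrite -integral_scale; [|by meas|by nn|by nn].
apply: integral_le => w; first by nn.
rewrite -(EFinM (`|b - c| `^ p)) -EFinD -EFinM lee_fin.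
have := powR_dist_triangle b (f w) c p0.
case: (w \in O); case: (_ < _); rewrite ?mulr1 ?mul1r ?mul0r ?mulr0 ?addr0 ?mulr0//.
Qed.

(** The extension is within the local error of the step function at x, which is
    itself a good approximation of f on average. *)
Lemma extend_dev x : 0 < g x < 2^-1 ->
  rdev x (extend f x) <= ext_cst * (g x ^+ d * rerr x).
Proof.
move=> gx12; have gx : 0 < g x by case/andP : gx12.
have xx : enorm (x - x) < g x / 2 by rewrite subrr enorm0 divr_gt0.
apply: (le_trans (rdev_triangle x (step f x) _)).
rewrite /ext_cst -mulrA; apply: ler_wpM2l; first exact: powR_ge0.
rewrite mulrDl; apply: lerD; first exact: rdev_step.
rewrite /V exprMn.
have -> : 12 ^+ d * near_cst * (g x ^+ d * rerr x) =
    12 ^+ d * g x ^+ d * (near_cst * rerr x) by ring.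
apply: ler_wpM2l; first by apply: mulr_ge0; apply: exprn_ge0; rewrite ?(ltW gx).
by rewrite distrC; exact: extend_near.
Qed.

End estimates.

Lemma extend_eq0 f x : 0 < g x -> h x <= g x -> extend f x = 0.
Proof.
move=> gx hx; apply/eqP; rewrite -normr_le0 -(subr0 (extend f x)).
apply: smooth_near => //; first exact: measurable_step.
move=> z xz; rewrite subr0 /step /patch_value.
suff -> : active (cell_index g z) = false by rewrite normr0.
apply/negP => /andP[g0 gh].
have [q1 q2 q3] := cell_geometry gx xz.
by have := h_lip (rpoint (cell_index g z)) x; rewrite enormC; lra.
Qed.

Lemma extend_g0 f x : g x = 0 -> extend f x = 0.
Proof.
move=> gx; rewrite /extend /smooth.
have b0 z : bump g x z = 0.
  by apply: bump_eq0; rewrite gx mul0r enorm_ge0.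
rewrite /bump_mass (eq_Rintegral _ (g := fun _ => 0)); last first.
  by move=> z _; rewrite b0.
by rewrite /Rintegral integral0 powR0 ?mul0r// oppr_eq0 oner_eq0.
Qed.

Lemma extend_ae f f' : measurable_fun setT f -> measurable_fun setT f' ->
  {ae mu, forall x, O x -> f x = f' x} -> extend f = extend f'.
Proof.
move=> mf mf' ff'; rewrite /extend; suff -> : step f = step f' by exact: erefl.
apply/funext => z; rewrite /step /patch_value.
case: (active (cell_index g z)); last exact: erefl.
apply: near_mean_ae.
- exact: measurable_patch.
- exact: mf.
- exact: mf'.
- by move: ff'; apply: filterS => w fw [_ Ow]; exact: fw.
Qed.

Lemma patch_value_linear a f f' n : 1 <= p ->
  measurable_fun setT f -> measurable_fun setT f' ->
  (\int[mu]_w (\1[w \in O] * `|f w| `^ p)%:E < +oo)%E ->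
  (\int[mu]_w (\1[w \in O] * `|f' w| `^ p)%:E < +oo)%E ->
  patch_value (fun z => a * f z + f' z) n =
  a * patch_value f n + patch_value f' n.
Proof.
move=> p1 mf mf' fp fp'; rewrite /patch_value.
have [an|_] := boolP (active n); last by rewrite mulr0 addr0.
apply: near_mean_linear.
- exact: measurable_patch.
- exact: patch_fin.
- exact: p1.
- exact: mf.
- exact: mf'.
- exact: patch_Lp.
- exact: patch_Lp.
Qed.

Lemma extend_linear a f f' x : 1 <= p ->
  measurable_fun setT f -> measurable_fun setT f' ->
  (\int[mu]_w (\1[w \in O] * `|f w| `^ p)%:E < +oo)%E ->
  (\int[mu]_w (\1[w \in O] * `|f' w| `^ p)%:E < +oo)%E ->
  extend (fun z => a * f z + f' z) x = a * extend f x + extend f' x.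
Proof.
move=> p1 mf mf' fp fp'.
have := g_ge0 x; rewrite le_eqVlt => /predU1P[/esym g0|gx].
  by rewrite !extend_g0// mulr0 addr0.
have [hx|hx] := leP (h x) (g x).
  by rewrite !extend_eq0// mulr0 addr0.
have gx12 : 0 < g x < 2^-1 by rewrite gx/=; have := h_le x; lra.
have stepE : step (fun z => a * f z + f' z) = fun z => a * step f z + step f' z.
  by apply/funext => z; rewrite /step patch_value_linear.
rewrite /extend stepE.
have xx : enorm (x - x) < g x / 2 by rewrite subrr enorm0 divr_gt0.
have bounded_step (u : T -> R) : measurable_fun setT u ->
    (\int[mu]_w (\1[w \in O] * `|u w| `^ p)%:E < +oo)%E ->
    exists M, forall z, enorm (x - z) < g x / 2 -> `|step u z| <= M.
  move=> m_u up.
  exists ((near_cst * rerr u x) `^ p^-1 + `|step u x|) => z xz.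
  apply: (@le_trans _ _ (`|step u z - step u x| + `|step u x|)).
    by rewrite -[X in `|X| <= _](subrK (step u x)); exact: ler_normD.
  by rewrite lerD2r; exact: (step_osc m_u up gx12 xz).
have [M HM] := bounded_step f mf fp.
have [M' HM'] := bounded_step f' mf' fp'.
apply: (@smooth_linear _ _ _ g_lip _ _ _ _ (Num.max M M')).
- exact: gx.
- exact: measurable_step.
- exact: measurable_step.
- by move=> z xz; rewrite le_max HM.
- by move=> z xz; rewrite le_max HM' ?orbT.
Qed.

End extension.

(** * Bounds by the energy *)

Section powers.
Context {R : realType}.

(** Negative powers of the scale b are bounded by those of any a <= c b; this is
    how all distances are traded for one another below. *)
Lemma powR_neg_compare (a b c e : R) :
  0 < c -> 0 < a -> a <= c * b -> 0 <= e -> b `^ (- e) <= c `^ e * a `^ (- e).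
Proof.
move=> c0 a0 acb e0.
have b0 : 0 < b by rewrite -(pmulr_rgt0 _ c0); exact: lt_le_trans acb.
have : (c * b) `^ (- e) <= a `^ (- e) by apply: powR_le_neg; rewrite ?oppr_le0.
rewrite powRM ?(ltW c0) ?(ltW b0)// => H.
have ce : 0 < c `^ e by rewrite powR_gt0.
rewrite -[leLHS](mulKf (lt0r_neq0 ce)) mulrCA ler_wpM2l ?(ltW ce)//.
by rewrite -powRN.
Qed.

Lemma powR_divX (a b e : R) : 0 <= a -> 0 < b ->
  (a / b) `^ e = a `^ e * b `^ (- e).
Proof.
move=> a0 b0; rewrite powRM ?invr_ge0 ?(ltW b0)//.
by rewrite -(powR_inv1 (ltW b0)) -powRrM mulN1r.
Qed.

Lemma lee_cross_sum (a b : R) (u v : \bar R) : 0 <= a -> 0 <= b ->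
  (0 <= u -> 0 <= v -> a%:E * u + b%:E * v <= (a + b)%:E * (u + v))%E.
Proof.
move=> a0 b0 u0 v0; rewrite ge0_muleDr//; apply: leeD; apply: lee_wpmul2r => //.
  by rewrite lee_fin lerDl.
by rewrite lee_fin lerDr.
Qed.

End powers.

Section swap.
Context {R : realType} {d : nat}.
Local Notation T := 'rV[R]_d.
Local Notation mu := (lebesgue_rV d : {sigma_finite_measure set T -> \bar R}).

Lemma integral_swap_le (F : T -> T -> \bar R) (H : T -> \bar R) :
  measurable_fun setT (fun u : T * T => F u.1 u.2) ->
  (forall x y, 0 <= F x y)%E ->
  (forall y, \int[mu]_x F x y <= H y)%E ->
  (\int[mu]_x \int[mu]_y F x y <= \int[mu]_y H y)%E.
Proof.
move=> mF F0 FH; rewrite integral_swap//; apply: integral_le => // y.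
exact: integral_ge0.
Qed.

Lemma integral2_scale_add (c : R) (F H : T -> T -> \bar R) : 0 <= c ->
  measurable_fun setT (fun u : T * T => F u.1 u.2) ->
  measurable_fun setT (fun u : T * T => H u.1 u.2) ->
  (forall x y, 0 <= F x y)%E -> (forall x y, 0 <= H x y)%E ->
  (\int[mu]_x \int[mu]_y (c%:E * (F x y + H x y)) =
   c%:E * (\int[mu]_x \int[mu]_y F x y + \int[mu]_x \int[mu]_y H x y))%E.
Proof.
move=> c0 mF mH F0 H0.
have slice (G : T -> T -> \bar R) x :
    measurable_fun setT (fun u : T * T => G u.1 u.2) -> measurable_fun setT (G x).
  move=> mG; apply: (measurableT_comp mG (measurable_pair1 x)).
have i0 (G : T -> T -> \bar R) x :
    (forall x y, 0 <= G x y)%E -> (0 <= \int[mu]_y G x y)%E.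
  by move=> G0; exact: integral_ge0.
under eq_integral => x _.
  rewrite integral_scale; [|by apply: emeasurable_funD; exact: slice|by []|by move=> y; exact: adde_ge0].
  rewrite integral_add; [|exact: slice|exact: slice|exact: F0|exact: H0].
  over.
rewrite integral_scale; last 3 first.
- by apply: emeasurable_funD; exact: measurable_fun_integral.
- by [].
- by move=> x; apply: adde_ge0; exact: i0.
rewrite integral_add//; try exact: measurable_fun_integral.
- by move=> x; exact: i0.
- by move=> x; exact: i0.
Qed.

Lemma integral2_add (F H : T -> T -> \bar R) :
  measurable_fun setT (fun u : T * T => F u.1 u.2) ->
  measurable_fun setT (fun u : T * T => H u.1 u.2) ->
  (forall x y, 0 <= F x y)%E -> (forall x y, 0 <= H x y)%E ->
  (\int[mu]_x \int[mu]_y (F x y + H x y) =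
   \int[mu]_x \int[mu]_y F x y + \int[mu]_x \int[mu]_y H x y)%E.
Proof.
move=> mF mH F0 H0; have := integral2_scale_add (@ler01 R) mF mH F0 H0.
rewrite mul1e => <-; apply: eq_integral => x _.
by apply: eq_integral => y _; rewrite mul1e.
Qed.

(** A bound of W by J + s + K, where s is used for both orders of the pair. *)
Lemma integral_pair_majorant (P : T -> Prop) (W J s K : T -> T -> R) :
  {ae mu, forall x, P x} ->
  measurable_fun setT (fun u : T * T => W u.1 u.2) ->
  measurable_fun setT (fun u : T * T => J u.1 u.2) ->
  measurable_fun setT (fun u : T * T => s u.1 u.2) ->
  measurable_fun setT (fun u : T * T => K u.1 u.2) ->
  (forall x y, 0 <= W x y) -> (forall x y, 0 <= J x y) ->
  (forall x y, 0 <= s x y) -> (forall x y, 0 <= K x y) ->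
  (forall x y, P x -> P y -> W x y <= J x y + (s x y + s y x) + K x y) ->
  (\int[mu]_x \int[mu]_y (W x y)%:E <=
   \int[mu]_x \int[mu]_y (J x y)%:E +
   (\int[mu]_x \int[mu]_y (s x y)%:E + \int[mu]_x \int[mu]_y (s x y)%:E) +
   \int[mu]_x \int[mu]_y (K x y)%:E)%E.
Proof.
move=> aeP /measurable_fun_EFin mW /measurable_fun_EFin mJ /measurable_fun_EFin ms
  /measurable_fun_EFin mK W0 J0 s0 K0 WP.
have msC : measurable_fun setT (fun u : T * T => (s u.2 u.1)%:E).
  exact: (measurableT_comp ms (measurable_fun_pair measurable_snd measurable_fst)).
have slice (F : T -> T -> \bar R) x :
    measurable_fun setT (fun u : T * T => F u.1 u.2) -> measurable_fun setT (F x).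
  by move=> mF; exact: (measurableT_comp mF (measurable_pair1 x)).
have mss := emeasurable_funD ms msC.
have mJss := emeasurable_funD mJ mss.
have mH := emeasurable_funD mJss mK.
pose H x y : \bar R :=
  ((J x y)%:E + ((s x y)%:E + (s y x)%:E) + (K x y)%:E)%E.
have H0 x y : (0 <= H x y)%E by rewrite /H; nn.
apply: (@le_trans _ _ (\int[mu]_x \int[mu]_y H x y)%E).
  apply: ae_ge0_le_integral => //.
  - by move=> x _; nn.
  - by apply: (@measurable_fun_integral _ _ _ _ _ mu (fun x y => (W x y)%:E)) => //; nn.
  - by move=> x _; exact: integral_ge0.
  - exact: (@measurable_fun_integral _ _ _ _ _ mu H).
  have aePy := aeP.
  apply: filterS aeP => x Px _.
  apply: ae_ge0_le_integral => //.
  - by move=> y _; rewrite lee_fin.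
  - exact: (slice (fun x y => (W x y)%:E) x mW).
  - exact: (slice H x mH).
  by apply: filterS aePy => y Py _; rewrite /H -!EFinD lee_fin; exact: WP.
rewrite /H integral2_add; [|exact: mJss|exact: mK|by nn|by nn].
rewrite integral2_add; [|exact: mJ|exact: mss|by nn|by nn].
rewrite integral2_add; [|exact: ms|exact: msC|by nn|by nn].
by rewrite [X in (_ + (_ + X) + _)%E]integral_swap; [|exact: msC|by nn].
Qed.

End swap.

Section pairs.
Context {R : realType} {d : nat}.
Local Notation T := 'rV[R]_d.
Local Notation mu := (lebesgue_rV d : {sigma_finite_measure set T -> \bar R}).
Context (O : set T) (g h ext err f : T -> R) (S : T -> T -> bool).
Context (p q c1 c2 c3 : R).
Hypothesis mO : measurable O.
Hypothesis mg : measurable_fun setT g.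
Hypothesis mh : measurable_fun setT h.
Hypothesis mext : measurable_fun setT ext.
Hypothesis merr : measurable_fun setT err.
Hypothesis mf : measurable_fun setT f.
Hypothesis mS : forall d' (U : measurableType d') (a b : U -> T),
  measurable_fun setT a -> measurable_fun setT b ->
  measurable_fun setT (fun u => S (a u) (b u)).
Hypothesis g_ge0 : forall x, 0 <= g x.
Hypothesis g_lip : forall x y, g x <= g y + enorm (x - y).
Hypothesis h_lip : forall x y, h x <= h y + enorm (x - y).
Hypothesis h_le : forall x, h x <= 100^-1.
Hypothesis h_gt0 : forall x, O x -> 0 < h x.
Hypothesis cross : forall x y, ~ O x -> O y ->
  h x <= enorm (x - y) \/ g x <= enorm (x - y).
Hypothesis qp : 0 < q < p.
Hypothesis c1_ge0 : 0 <= c1.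
Hypothesis c2_ge0 : 0 <= c2.
Hypothesis c3_ge0 : 0 <= c3.
Hypothesis err_ge0 : forall x, 0 <= err x.
Hypothesis errE : forall x, (err x)%:E = local_err O g h p f x.
Hypothesis ext_shadow : forall x b, 0 < g x < h x ->
  ((`|ext x - b| `^ p)%:E <= c1%:E * ((err x)%:E + (g x `^ (- d%:R))%:E *
     \int[mu]_w (\1[S x w] * `|f w - b| `^ p)%:E))%E.
Hypothesis ext_near : forall x y, 0 < g x < h x -> enorm (x - y) < g x / 8 ->
  `|ext x - ext y| `^ p <= c2 * ((enorm (x - y) / g x) `^ p * err x).
Hypothesis ext_eq0 : forall x, h x <= g x -> ext x = 0.
Hypothesis ext_g0 : forall x, g x = 0 -> ext x = 0.
Hypothesis S_sub : forall x w, S x w -> O w /\ enorm (x - w) < 3 * g x.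
Hypothesis S_overlap : forall w,
  (\int[mu]_x (\1[0 < g x] * \1[S x w] * g x `^ (- d%:R))%:E <= c3%:E)%E.
Implicit Types (x y z w : T).

Let q0 : 0 < q. Proof. by case/andP : qp. Qed.
Let p0 : 0 < p. Proof. by case/andP : qp => *; lra. Qed.
Let qd0 : 0 <= q + d%:R. Proof. by rewrite addr_ge0// ltW. Qed.

(** The set on which the extension is an average rather than 0. *)
Let near_thick x : bool := 0 < g x < h x.

Definition kernel x y : R := enorm (x - y) `^ (- (q + d%:R)).

Lemma kernel_ge0 x y : 0 <= kernel x y. Proof. exact: powR_ge0. Qed.

Lemma kernelC x y : kernel x y = kernel y x.
Proof. by rewrite /kernel enormC. Qed.

(** The p-th power of the seminorm of f on O, plus that of the weighted norm
    with h in place of the distance to D. *)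
Definition energy : \bar R :=
  (\int[mu]_x \int[mu]_y (\1[x \in O] * \1[y \in O] * \1[enorm (x - y) < 1] *
      `|f x - f y| `^ p * kernel x y)%:E +
   \int[mu]_x (\1[x \in O] * `|f x| `^ p * h x `^ (- q))%:E)%E.

Let measurable_kernel d' (U : measurableType d') (a b : U -> T) :
  measurable_fun setT a -> measurable_fun setT b ->
  measurable_fun setT (fun u => kernel (a u) (b u)).
Proof. by move=> ma mb; rewrite /kernel; meas. Qed.

Let measurable_near_thick d' (U : measurableType d') (a : U -> T) :
  measurable_fun setT a -> measurable_fun setT (fun u => near_thick (a u)).
Proof. by move=> ma; rewrite /near_thick; meas. Qed.

Let kernel0 : forall x y, 0 <= kernel x y. Proof. exact: kernel_ge0. Qed.

Ltac ms := meas; nn; try (apply: measurable_near_thick; meas);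
  try (apply: measurable_kernel; meas); try (apply: mS; meas).

Lemma far_kernel x (rho : R) : 0 < rho ->
  (\int[mu]_y (\1[rho <= enorm (x - y)] * kernel x y)%:E <=
   (@tail_cst R d q * rho `^ (- q))%:E)%E.
Proof.
move=> r0; apply: le_trans (integral_tail_kernel x q0 r0).
apply: integral_le => y; first by nn.
rewrite lee_fin /kernel; have [ry|_] := boolP (rho <= enorm (x - y)).
  by rewrite mul1r max_r.
by rewrite mul0r powR_ge0.
Qed.

Definition err_cst : R :=
  12 `^ (q + d%:R + d%:R) * @tail_cst R d (q + d%:R) +
  14 `^ (q + d%:R) * @tail_cst R d q.

(** For fixed w and z the x that see both satisfy g(x) >= |w - z| / 12 and
    g(x) >= |x - w| / 12; the integral in x is a tail, and leaves the kernel at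
    (w, z). *)
Lemma osc_energy :
  (\int[mu]_x ((\1[near_thick x] * g x `^ (- q) *
      (g x `^ (- d%:R) * g x `^ (- d%:R)))%:E * local_osc O g p f x) <=
   (12 `^ (q + d%:R + d%:R) * @tail_cst R d (q + d%:R))%:E *
   \int[mu]_x \int[mu]_y (\1[x \in O] * \1[y \in O] * \1[enorm (x - y) < 1] *
      `|f x - f y| `^ p * kernel x y)%:E)%E.
Proof.
have qd1 : 0 < q + d%:R by rewrite ltr_wpDr.
have t0 := @tail_cst_ge0 R d _ qd1.
pose a x : R := \1[near_thick x] * g x `^ (- q) *
  (g x `^ (- d%:R) * g x `^ (- d%:R)).
have ma : measurable_fun setT a by rewrite /a; ms.
have a0 x : 0 <= a x by rewrite /a; nn.
pose b x w z : R := \1[w \in O] * \1[z \in O] *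
     \1[enorm (x - w) < 6 * g x] * \1[enorm (x - z) < 6 * g x] *
     `|f z - f w| `^ p.
rewrite (_ : (fun x => _) =
  fun x => \int[mu]_w \int[mu]_z (a x * b x w z)%:E)%E; last first.
  apply/funext => x; rewrite -/(a x) /local_osc.
  rewrite -integral_scale; [|by ms|by exact: a0|by nn].
  apply: eq_integral => w _.
  rewrite -integral_scale; [|by ms|by exact: a0|by nn].
  by apply: eq_integral => z _; rewrite -EFinM.
have b0 x w z : 0 <= b x w z by rewrite /b; nn.
apply: (@le_trans _ _ (\int[mu]_w \int[mu]_z
   ((12 `^ (q + d%:R + d%:R) * @tail_cst R d (q + d%:R)) *
    (\1[w \in O] * \1[z \in O] * \1[enorm (w - z) < 1] *
      `|f w - f z| `^ p * kernel w z))%:E)%E); last first.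
  rewrite -integral_scale; [|by ms|by nn|by nn].
  apply: integral_le => w; first by nn.
  by rewrite -integral_scale; [|by ms|by nn|by nn].
apply: integral_swap_le; [by rewrite /b; ms|by nn|move=> w].
apply: integral_swap_le; [by rewrite /b; ms|by nn|move=> z].
(* On the diagonal there is no positive radius for the tail, but f z - f w = 0. *)
have [wz|wz] := eqVneq w z.
  rewrite integral0_eq; first by nn.
  by move=> x _; rewrite /b wz subrr normr0 powR0 ?gt_eqF// !mulr0.
have r0 : 0 < enorm (w - z).
  rewrite lt_neqAle enorm_ge0 andbT eq_sym; apply: contra wz => /eqP/enorm_eq0.
  by move/eqP; rewrite subr_eq0.
pose A : R := 12 `^ (q + d%:R + d%:R) * (\1[w \in O] * \1[z \in O] *
  \1[enorm (w - z) < 1] * `|f w - f z| `^ p).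
have A0 : 0 <= A by rewrite /A; nn.
apply: (@le_trans _ _ (\int[mu]_x (A%:E *
   (Num.max (enorm (w - z)) (enorm (w - x)) `^ (- (q + d%:R + d%:R)))%:E))%E).
  apply: integral_le => x; first by nn.
  rewrite -EFinM lee_fin /a /b /A.
  case: (w \in O); last by rewrite !(mul0r, mulr0); nn.
  case: (z \in O); last by rewrite !(mul0r, mulr0); nn.
  have [/andP[gx gh]|_] := boolP (near_thick x); last by rewrite !mul0r; nn.
  have [xw|_] := boolP (enorm (x - w) < _); last by rewrite !(mul0r, mulr0); nn.
  have [xz|_] := boolP (enorm (x - z) < _); last by rewrite !(mul0r, mulr0); nn.
  have wz12 : enorm (w - z) < 12 * g x.
    by have := enorm_triangle x w z; rewrite (enormC w x); lra.
  have -> : enorm (w - z) < 1 by have := h_le x; lra.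
  rewrite !mul1r distrC [leRHS]mulrAC; apply: ler_wpM2r; first by nn.
  have -> : g x `^ (- q) * (g x `^ (- d%:R) * g x `^ (- d%:R)) =
      g x `^ (- (q + d%:R + d%:R)).
    by rewrite !opprD !powRD ?(gt_eqF gx) ?implybT// mulrA.
  apply: powR_neg_compare => //.
  - by rewrite lt_max r0.
  - by rewrite ge_max (enormC w x); apply/andP; split; lra.
  - by rewrite !addr_ge0// ltW.
rewrite integral_scale; [|by ms|by nn|by nn].
apply: (@le_trans _ _ (A%:E *
    (@tail_cst R d (q + d%:R) * enorm (w - z) `^ (- (q + d%:R)))%:E)%E).
  by apply: lee_wpmul2l; [nn|exact: integral_tail_kernel].
by rewrite -EFinM lee_fin /A /kernel le_eqVlt; apply/orP; left; apply/eqP; ring.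
Qed.

(** In the transition region h(w) <= 14 g(x), and again g(x) >= |x - w| / 14; the
    integral in x is a tail that leaves h(w)^-q. *)
Lemma dev_energy :
  (\int[mu]_x ((\1[near_thick x] * g x `^ (- q) *
      (\1[h x <= 8 * g x] * g x `^ (- d%:R)))%:E * local_dev O g p f x 0) <=
   (14 `^ (q + d%:R) * @tail_cst R d q)%:E *
   \int[mu]_x (\1[x \in O] * `|f x| `^ p * h x `^ (- q))%:E)%E.
Proof.
have t0 := @tail_cst_ge0 R d _ q0.
pose a x : R := \1[near_thick x] * g x `^ (- q) *
  (\1[h x <= 8 * g x] * g x `^ (- d%:R)).
have ma : measurable_fun setT a by rewrite /a; ms.
have a0 x : 0 <= a x by rewrite /a; nn.
pose b x w : R := \1[w \in O] * \1[enorm (x - w) < 6 * g x] * `|f w - 0| `^ p.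
rewrite (_ : (fun x => _) = fun x => \int[mu]_w (a x * b x w)%:E)%E; last first.
  apply/funext => x; rewrite -/(a x) /local_dev.
  rewrite -integral_scale; [|by ms|by exact: a0|by nn].
  by apply: eq_integral => w _; rewrite -EFinM.
have b0 x w : 0 <= b x w by rewrite /b; nn.
rewrite -integral_scale; [|by ms|by nn|by nn].
apply: integral_swap_le; [by rewrite /b; ms|by nn|move=> w].
have [/set_mem Ow|nOw] := boolP (w \in O); last first.
  rewrite integral0_eq; first by nn.
  by move=> x _; rewrite /b (negbTE nOw) !(mul0r, mulr0).
have hw := h_gt0 Ow.
pose A : R := 14 `^ (q + d%:R) * `|f w| `^ p.
have A0 : 0 <= A by rewrite /A; nn.
apply: (@le_trans _ _ (\int[mu]_x (A%:E *
   (Num.max (h w) (enorm (w - x)) `^ (- (q + d%:R)))%:E))%E).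
  apply: integral_le => x; first by nn.
  rewrite -EFinM lee_fin /a /b /A subr0.
  rewrite mem_set// mul1r.
  have [/andP[gx gh]|_] := boolP (near_thick x); last by rewrite !mul0r; nn.
  have [xw|_] := boolP (enorm (x - w) < _); last by rewrite !(mul0r, mulr0); nn.
  have [hg|_] := boolP (h x <= 8 * g x); last by rewrite !(mul0r, mulr0); nn.
  rewrite !mul1r [leRHS]mulrAC; apply: ler_wpM2r; first by nn.
  have -> : g x `^ (- q) * g x `^ (- d%:R) = g x `^ (- (q + d%:R)).
    by rewrite !opprD !powRD ?(gt_eqF gx) ?implybT.
  apply: powR_neg_compare => //.
  - by rewrite lt_max hw.
  - by have := h_lip w x; rewrite ge_max (enormC w x) => ?; apply/andP; split; lra.
rewrite integral_scale; [|by ms|by nn|by nn].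
apply: (@le_trans _ _ (A%:E * (@tail_cst R d q * h w `^ (- q))%:E)%E).
  by apply: lee_wpmul2l; [nn|exact: integral_tail_kernel].
by rewrite -!EFinM lee_fin /A mul1r le_eqVlt; apply/orP; left; apply/eqP; ring.
Qed.

Lemma err_cst_ge0 : 0 <= err_cst.
Proof.
have t0 := @tail_cst_ge0 R d _ q0.
have qd1 : 0 < q + d%:R by rewrite ltr_wpDr.
have t1 := @tail_cst_ge0 R d _ qd1.
by rewrite /err_cst; nn.
Qed.

Lemma err_energy :
  (\int[mu]_x (\1[near_thick x] * g x `^ (- q) * err x)%:E <=
   err_cst%:E * energy)%E.
Proof.
have t0 := @tail_cst_ge0 R d _ q0.
have qd1 : 0 < q + d%:R by rewrite ltr_wpDr.
have t1 := @tail_cst_ge0 R d _ qd1.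
have lo x : (0 <= local_osc O g p f x)%E by exact: local_osc_ge0.
have ld x : (0 <= local_dev O g p f x 0)%E by exact: local_dev_ge0.
have mlo : measurable_fun setT (local_osc O g p f) by rewrite /local_osc; ms.
have mld : measurable_fun setT (fun x => local_dev O g p f x 0).
  by rewrite /local_dev; ms.
rewrite (_ : (fun x => _) = fun x =>
  (\1[near_thick x] * g x `^ (- q) *
      (g x `^ (- d%:R) * g x `^ (- d%:R)))%:E * local_osc O g p f x +
  (\1[near_thick x] * g x `^ (- q) *
      (\1[h x <= 8 * g x] * g x `^ (- d%:R)))%:E * local_dev O g p f x 0)%E; last first.
  apply/funext => x; rewrite EFinM errE /local_err.
  rewrite ge0_muleDr; [|by apply: mule_ge0; [nn|exact: lo]|by apply: mule_ge0; [nn|exact: ld]].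
  by rewrite !muleA -!EFinM.
rewrite integral_add; last 4 first.
- by apply: emeasurable_funM; [ms|exact: mlo].
- by apply: emeasurable_funM; [ms|exact: mld].
- by move=> x; apply: mule_ge0; [nn|exact: lo].
- by move=> x; apply: mule_ge0; [nn|exact: ld].
have J0 : (0 <= \int[mu]_x \int[mu]_y (\1[x \in O] * \1[y \in O] *
  \1[enorm (x - y) < 1] * `|f x - f y| `^ p * kernel x y)%:E)%E by nn.
have B0 : (0 <= \int[mu]_x (\1[x \in O] * `|f x| `^ p * h x `^ (- q))%:E)%E by nn.
apply: (le_trans (leeD osc_energy dev_energy)).
by apply: lee_cross_sum => //; nn.
Qed.


Local Opaque err_cst.

Let energy_oscE : (\int[mu]_x \int[mu]_y (\1[x \in O] * \1[y \in O] *
    \1[enorm (x - y) < 1] * `|f x - f y| `^ p * kernel x y)%:E <= energy)%E.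
Proof. by rewrite /energy leeDl//; nn. Qed.

Let energy_wgtE : (\int[mu]_x (\1[x \in O] * `|f x| `^ p * h x `^ (- q))%:E <=
  energy)%E.
Proof. by rewrite /energy leeDr//; nn. Qed.

Lemma energy_ge0 : (0 <= energy)%E.
Proof. by rewrite /energy; nn. Qed.

Local Opaque energy.

Definition glue x : R := if x \in O then f x else ext x.

Lemma measurable_glue : measurable_fun setT glue.
Proof. by apply: measurable_fun_ifT => //; exact: measurable_fun_mem. Qed.

Definition wgt_cst : R := 1 + c1 * (err_cst + 4 `^ q * c3).

Lemma wgt_cst_ge0 : 0 <= wgt_cst.
Proof. by have := err_cst_ge0; rewrite /wgt_cst => e0; nn. Qed.

(** For w in the shadow of x, h(w) <= 4 h(x); the overlap of the shadows bounds
    the integral in x. *)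
Lemma shadow_wgt :
  (\int[mu]_x \int[mu]_w (\1[near_thick x] * h x `^ (- q) * g x `^ (- d%:R) *
     (\1[S x w] * `|f w| `^ p))%:E <= (4 `^ q * c3)%:E * energy)%E.
Proof.
apply: (@le_trans _ _ (\int[mu]_w ((4 `^ q * c3)%:E *
    (\1[w \in O] * `|f w| `^ p * h w `^ (- q))%:E))%E); last first.
  rewrite integral_scale; [|by ms|by nn|by nn].
  by apply: lee_wpmul2l; [nn|exact: energy_wgtE].
apply: integral_swap_le; [by ms|by nn|move=> w].
pose A : R := 4 `^ q * (\1[w \in O] * `|f w| `^ p * h w `^ (- q)).
have A0 : 0 <= A by rewrite /A; nn.
apply: (@le_trans _ _ (\int[mu]_x (A%:E *
   (\1[0 < g x] * \1[S x w] * g x `^ (- d%:R))%:E))%E).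
  apply: integral_le => x; first by nn.
  rewrite -EFinM lee_fin /A.
  have [/andP[gx gh]|_] := boolP (near_thick x); last by rewrite !mul0r; nn.
  have [Sxw|_] := boolP (S x w); last by rewrite !(mul0r, mulr0); nn.
  have [Ow xw] := S_sub Sxw.
  rewrite gx mem_set// !mul1r.
  set P := `|f w| `^ p; set G := g x `^ _.
  have -> : 4 `^ q * (P * h w `^ (- q)) * G = 4 `^ q * h w `^ (- q) * (G * P).
    by ring.
  rewrite -mulrA; apply: ler_wpM2r; first by rewrite /G /P; nn.
  apply: powR_neg_compare => //; first exact: h_gt0.
    by have := h_lip w x; rewrite (enormC w x); lra.
  exact: ltW.
rewrite integral_scale; [|by ms|by nn|by nn].
apply: (@le_trans _ _ (A%:E * c3%:E)%E).
  by apply: lee_wpmul2l; [nn|exact: S_overlap].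
by rewrite -!EFinM lee_fin /A le_eqVlt; apply/orP; left; apply/eqP; ring.
Qed.

(** Compare the extension with 0 through its shadow. *)
Lemma glue_wgt :
  (\int[mu]_x (`|glue x| `^ p * h x `^ (- q))%:E <= wgt_cst%:E * energy)%E.
Proof.
have e0 := err_cst_ge0; have E0 := energy_ge0.
pose u x : \bar R := (\1[x \in O] * `|f x| `^ p * h x `^ (- q))%:E.
pose v x : \bar R := (\1[near_thick x] * g x `^ (- q) * err x)%:E.
pose z x : \bar R := (\int[mu]_w (\1[near_thick x] * h x `^ (- q) *
  g x `^ (- d%:R) * (\1[S x w] * `|f w| `^ p))%:E)%E.
have mu_ : measurable_fun setT u by rewrite /u; ms.
have mv : measurable_fun setT v by rewrite /v; ms.
have mz : measurable_fun setT z by rewrite /z; ms.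
have u0 x : (0 <= u x)%E by rewrite /u; nn.
have v0 x : (0 <= v x)%E by rewrite /v; nn.
have z0 x : (0 <= z x)%E by rewrite /z; nn.
apply: (@le_trans _ _ (\int[mu]_x (u x + c1%:E * (v x + z x)))%E); last first.
  rewrite integral_add; [|exact: mu_|by ms|exact: u0|by nn].
  rewrite integral_scale; [|by ms|by nn|by nn].
  rewrite integral_add; [|exact: mv|exact: mz|exact: v0|exact: z0].
  apply: (@le_trans _ _ (energy + c1%:E * (err_cst%:E * energy +
     (4 `^ q * c3)%:E * energy))%E).
    apply: leeD; first exact: energy_wgtE.
    apply: lee_wpmul2l; first by nn.
    by apply: leeD; [exact: err_energy|exact: shadow_wgt].
  rewrite -ge0_muleDl; [|by nn|by nn].
  rewrite muleA -EFinD -EFinM -[X in (X + _)%E]mul1e -ge0_muleDl; [|by nn|by nn].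
  exact: lexx.
apply: integral_le => x; first by nn.
rewrite /glue; have [Ox|nOx] := boolP (x \in O).
  rewrite /u Ox mul1r leeDl//; apply: mule_ge0; first by nn.
  by apply: adde_ge0.
rewrite /u (negbTE nOx) !mul0r add0e.
have [xM|] := boolP (near_thick x); last first.
  rewrite /near_thick negb_and => gh.
  have -> : ext x = 0.
    move: gh; have := g_ge0 x; rewrite le_eqVlt => /predU1P[/esym/ext_g0//|->/=].
    by rewrite -leNgt; exact: ext_eq0.
  rewrite normr0 powR0 ?gt_eqF// mul0r; apply: mule_ge0; first by nn.
  by apply: adde_ge0.
have /andP[gx gh] := xM.
have hx : 0 < h x by exact: lt_trans gh.
have zE : z x = ((h x `^ (- q))%:E * ((g x `^ (- d%:R))%:E *
    \int[mu]_w (\1[S x w] * `|f w - 0| `^ p)%:E))%E.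
  rewrite /z xM muleA -EFinM -integral_scale; [|by ms|by nn|by nn].
  by apply: eq_integral => w _; rewrite -EFinM subr0 mul1r.
rewrite zE mulrC EFinM.
apply: (@le_trans _ _ ((h x `^ (- q))%:E * (c1%:E * ((err x)%:E +
   (g x `^ (- d%:R))%:E * \int[mu]_w (\1[S x w] * `|f w - 0| `^ p)%:E)))%E).
  by apply: lee_wpmul2l; [nn|have := ext_shadow 0 xM; rewrite subr0].
rewrite muleCA; apply: lee_wpmul2l; first by nn.
rewrite ge0_muleDr; [|by nn|by nn].
apply: leeD => //; rewrite /v xM mul1r -EFinM lee_fin; apply: ler_wpM2r => //.
apply: powR_le_neg; [exact: gx|exact: ltW|by rewrite oppr_le0 ltW].
Qed.


Local Opaque wgt_cst.

Lemma glue_eq0 x : h x <= 0 -> glue x = 0.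
Proof.
move=> hx; rewrite /glue; case: ifPn => [/set_mem/h_gt0|_].
  by rewrite ltNge hx.
by apply: ext_eq0; exact: le_trans (g_ge0 x).
Qed.

Definition transfer_cst (N : R) : R := N `^ q * @tail_cst R d q * err_cst.

Lemma transfer_cst_ge0 N : 0 <= transfer_cst N.
Proof.
have e0 := err_cst_ge0; have t0 := @tail_cst_ge0 R d _ q0.
by rewrite /transfer_cst; nn.
Qed.

(** The engine for pairs at distance at least g(x)/N. Comparing ext x with b y
    through the shadow of x produces the local error, whose kernel integral over
    the y is at most a multiple of g(x)^-q, and pairs (w, y) with w in the shadow,
    on which the integral in x is bounded by the overlap. *)
Lemma shadow_transfer (C : T -> T -> bool) (b : T -> R) (F : T -> T -> R)
    (N L : R) : 0 < N -> 0 <= L ->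
  measurable_fun setT b ->
  measurable_fun setT (fun u : T * T => C u.1 u.2) ->
  measurable_fun setT (fun u : T * T => F u.1 u.2) ->
  (forall y w, 0 <= F y w) ->
  (forall x y, C x y -> near_thick x /\ g x <= N * enorm (x - y)) ->
  (forall x y w, C x y -> S x w ->
     `|f w - b y| `^ p * kernel x y <= L * F y w) ->
  (\int[mu]_x \int[mu]_y
     (\1[C x y] * `|ext x - b y| `^ p * kernel x y)%:E <=
   c1%:E * ((transfer_cst N)%:E * energy +
     (L * c3)%:E * \int[mu]_y \int[mu]_w (F y w)%:E))%E.
Proof.
move=> N0 L0 mb mC mF F0 CN CL.
have e0 := err_cst_ge0; have E0 := energy_ge0.
have t0 := @tail_cst_ge0 R d _ q0.
have mF' d' (U : measurableType d') (u v : U -> T) : measurable_fun setT u ->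
    measurable_fun setT v -> measurable_fun setT (fun x : U => F (u x) (v x)).
  by move=> mu_ mv; apply: (measurableT_comp mF (measurable_fun_pair mu_ mv)).
have mC' d' (U : measurableType d') (u v : U -> T) : measurable_fun setT u ->
    measurable_fun setT v -> measurable_fun setT (fun x : U => C (u x) (v x)).
  by move=> mu_ mv; apply: (measurableT_comp mC (measurable_fun_pair mu_ mv)).
pose A x y : \bar R := (\1[near_thick x] * err x *
  (\1[N^-1 * g x <= enorm (x - y)] * kernel x y))%:E.
pose B x y : \bar R := (\int[mu]_w (L * F y w *
  (\1[0 < g x] * \1[S x w] * g x `^ (- d%:R)))%:E)%E.
have mA : measurable_fun setT (fun u : T * T => A u.1 u.2) by rewrite /A; ms.
have mB : measurable_fun setT (fun u : T * T => B u.1 u.2).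
  by rewrite /B; ms; try (apply: mF'; meas).
have A0 x y : (0 <= A x y)%E by rewrite /A; nn.
have B0 x y : (0 <= B x y)%E by rewrite /B; nn.
apply: (@le_trans _ _ (\int[mu]_x \int[mu]_y (c1%:E * (A x y + B x y)))%E).
  apply: integral_le => x; first by nn.
  apply: integral_le => y; first by nn.
  have [Cxy|_] := boolP (C x y); last first.
    by rewrite !mul0r; apply: mule_ge0; [nn|exact: adde_ge0].
  have [xM gN] := CN _ _ Cxy; have /andP[gx gh] := xM.
  rewrite mul1r mulrC EFinM.
  apply: (@le_trans _ _ ((kernel x y)%:E * (c1%:E * ((err x)%:E +
     (g x `^ (- d%:R))%:E * \int[mu]_w (\1[S x w] * `|f w - b y| `^ p)%:E)))%E).
    by apply: lee_wpmul2l; [nn|exact: ext_shadow].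
  rewrite muleCA; apply: lee_wpmul2l; first by nn.
  rewrite ge0_muleDr; [|by nn|by nn].
  apply: leeD.
    rewrite /A xM mul1r -EFinM lee_fin.
    have -> : N^-1 * g x <= enorm (x - y) by rewrite ler_pdivrMl.
    by rewrite mul1r mulrC.
  rewrite muleA -EFinM -integral_scale; [|by ms|by nn|by nn].
  apply: integral_le => w; first by nn.
  rewrite -EFinM lee_fin gx mul1r.
  have [Sxw|_] := boolP (S x w); last by rewrite !(mul0r, mulr0); nn.
  rewrite !mul1r [leRHS]mulrC (mulrC (kernel x y)) -mulrA.
  apply: ler_wpM2l; first by nn.
  by rewrite mulrC; exact: CL.
rewrite integral2_scale_add; [|exact: c1_ge0|exact: mA|exact: mB|exact: A0|exact: B0].
apply: lee_wpmul2l; first by nn.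
apply: leeD.
  apply: (@le_trans _ _ (\int[mu]_x ((N `^ q * @tail_cst R d q)%:E *
      (\1[near_thick x] * g x `^ (- q) * err x)%:E))%E); last first.
    rewrite integral_scale; [|by ms|by nn|by nn].
    rewrite /transfer_cst (EFinM _ err_cst) -muleA; apply: lee_wpmul2l; first by nn.
    exact: err_energy.
  apply: integral_le => x; first exact: integral_ge0.
  have [/andP[gx gh]|nM] := boolP (near_thick x); last first.
    rewrite integral0_eq; first by nn.
    by move=> y _; rewrite /A (negbTE nM) !mul0r.
  have Ng : 0 < N^-1 * g x by rewrite mulr_gt0// invr_gt0.
  apply: (@le_trans _ _ ((err x)%:E *
     (@tail_cst R d q * (N^-1 * g x) `^ (- q))%:E)%E).
    apply: le_trans (lee_wpmul2l _ (far_kernel x Ng)); last by nn.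
    rewrite -integral_scale; [|by ms|by nn|by nn].
    apply: integral_le => y; first exact: A0.
    rewrite /A -EFinM lee_fin -mulrA; apply: ler_piMl; first by nn.
    by case: (near_thick x).
  rewrite mul1r -!EFinM lee_fin.
  have -> : N `^ q * @tail_cst R d q * (g x `^ (- q) * err x) =
    err x * (@tail_cst R d q * (N `^ q * g x `^ (- q))) by ring.
  apply: ler_wpM2l; first by nn.
  apply: ler_wpM2l; first by nn.
  by apply: powR_neg_compare; rewrite ?(ltW q0)// mulVKf// gt_eqF.
rewrite -integral_scale; [|by ms; try (apply: mF'; meas)|by nn|by nn].
apply: integral_swap_le; [exact: mB|exact: B0|move=> y].
rewrite -integral_scale; [|by apply: measurable_fun_EFin; apply: mF'; meas|by nn|by nn].
apply: integral_swap_le; [by ms; try (apply: mF'; meas)|by nn|move=> w].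
under eq_integral do rewrite EFinM.
rewrite integral_scale; [|by ms|by nn|by nn].
apply: le_trans (lee_wpmul2l _ (S_overlap w)) _; first by nn.
by rewrite -!EFinM lee_fin le_eqVlt; apply/orP; left; apply/eqP; ring.
Qed.

Definition cross_pair x y : bool :=
  [&& x \notin O, near_thick x, y \in O & enorm (x - y) < 16^-1].

Definition cross_cst : R := c1 * (transfer_cst 1 + 4 `^ (q + d%:R) * c3).

Lemma cross_cst_ge0 : 0 <= cross_cst.
Proof. by have := transfer_cst_ge0 1; rewrite /cross_cst => e0; nn. Qed.

(** The segment from x to y meets the boundary, either in D or outside D, and
    g(x) < h(x). *)
Lemma cross_gdist x y : x \notin O -> near_thick x -> y \in O ->
  g x <= enorm (x - y).
Proof.
move=> /negP nOx /andP[gx gh] /set_mem Oy.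
have nOx' : ~ O x by move=> Ox; apply: nOx; exact: mem_set.
have [|//] := cross nOx' Oy.
by apply: le_trans; exact: ltW.
Qed.

Lemma cross_energy :
  (\int[mu]_x \int[mu]_y
     (\1[cross_pair x y] * `|ext x - f y| `^ p * kernel x y)%:E <=
   cross_cst%:E * energy)%E.
Proof.
pose F y w : R := \1[y \in O] * \1[w \in O] * \1[enorm (y - w) < 1] *
    `|f y - f w| `^ p * kernel y w.
apply: (@le_trans _ _ (c1%:E * ((transfer_cst 1)%:E * energy +
     (4 `^ (q + d%:R) * c3)%:E * \int[mu]_y \int[mu]_w (F y w)%:E))%E); last first.
  have := transfer_cst_ge0 1; have E0 := energy_ge0 => t0.
  rewrite /cross_cst (EFinM c1) -muleA; apply: lee_wpmul2l; first by nn.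
  rewrite (EFinD (transfer_cst 1)) ge0_muleDl; [|by nn|by nn].
  apply: leeD => //; apply: lee_wpmul2l; first by nn.
  exact: energy_oscE.
apply: shadow_transfer => //.
- by rewrite /cross_pair; ms.
- by rewrite /F; ms.
- by move=> y w; rewrite /F; nn.
- by move=> x y /and4P[nOx xM Oy _]; rewrite mul1r; split => //; exact: cross_gdist.
- move=> x y w /and4P[nOx xM Oy xy] Sxw.
  have gr := cross_gdist nOx xM Oy; have [Ow xw] := S_sub Sxw.
  (* The kernel at (y, w) is 0 when w = y, and so is f w - f y. *)
  have [->|wy] := eqVneq w y.
    by rewrite subrr normr0 powR0 ?gt_eqF// mul0r /F; nn.
  have r0 : 0 < enorm (y - w).
    rewrite lt_neqAle enorm_ge0 andbT eq_sym; apply: contra wy => /eqP/enorm_eq0.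
    by move/eqP; rewrite subr_eq0 eq_sym.
  have yw : enorm (y - w) <= 4 * enorm (x - y).
    by have := enorm_triangle x y w; rewrite (enormC y x); lra.
  rewrite /F Oy mem_set//.
  have -> : enorm (y - w) < 1 by lra.
  rewrite !mul1r distrC mulrCA; apply: ler_wpM2l; first by nn.
  exact: powR_neg_compare.
Qed.

Definition both_pair x y : bool :=
  [&& x \notin O, y \notin O, near_thick x, near_thick y &
      8^-1 * g x <= enorm (x - y) < 400^-1].

Definition both_cst : R :=
  c1 * (transfer_cst 8 + 25 `^ (q + d%:R) * c3 * cross_cst).

Lemma both_cst_ge0 : 0 <= both_cst.
Proof.
have := transfer_cst_ge0 8; have := cross_cst_ge0.
by rewrite /both_cst => e0 e1; nn.
Qed.

(** The transfer moves x to a point w of O at distance at most 25 |x - y| from y,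
    which gives a pair of cross_energy. *)
Lemma both_energy :
  (\int[mu]_x \int[mu]_y
     (\1[both_pair x y] * `|ext x - ext y| `^ p * kernel x y)%:E <=
   both_cst%:E * energy)%E.
Proof.
pose F y w : R := \1[cross_pair y w] * `|ext y - f w| `^ p * kernel y w.
have cc0 := cross_cst_ge0.
apply: (@le_trans _ _ (c1%:E * ((transfer_cst 8)%:E * energy +
     (25 `^ (q + d%:R) * c3)%:E * \int[mu]_y \int[mu]_w (F y w)%:E))%E); last first.
  have := transfer_cst_ge0 8; have E0 := energy_ge0 => t0.
  rewrite /both_cst (EFinM c1) -muleA; apply: lee_wpmul2l; first by nn.
  rewrite (EFinD (transfer_cst 8)) ge0_muleDl; [|by nn|by nn].
  rewrite (EFinM _ cross_cst) -muleA.
  apply: leeD => //; apply: lee_wpmul2l; first by nn.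
  exact: cross_energy.
apply: shadow_transfer => //.
- by rewrite /both_pair; ms.
- by rewrite /F /cross_pair; ms.
- by move=> y w; rewrite /F; nn.
- move=> x y /and5P[nOx nOy xM yM /andP[gr _]]; split => //.
  by move: gr; rewrite ler_pdivrMl.
- move=> x y w /and5P[nOx nOy xM yM /andP[gr xy]] Sxw.
  have [Ow xw] := S_sub Sxw.
  move: gr; rewrite ler_pdivrMl// => gr.
  have gy := cross_gdist nOy yM (mem_set Ow).
  have r0 : 0 < enorm (y - w) by apply: lt_le_trans gy; case/andP : yM.
  have yw : enorm (y - w) <= 25 * enorm (x - y).
    by have := enorm_triangle x y w; rewrite (enormC y x); lra.
  rewrite /F /cross_pair nOy yM mem_set//=.
  have -> : enorm (y - w) < 16^-1 by lra.
  rewrite !mul1r distrC mulrCA; apply: ler_wpM2l; first by nn.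
  exact: powR_neg_compare.
Qed.

Definition near_pair x y : bool :=
  near_thick x && (enorm (x - y) < g x / 8).

Definition near_pair_cst : R :=
  c2 * (@tail_cst R d (p - q) * 2 `^ p) * err_cst.

Lemma near_pair_cst_ge0 : 0 <= near_pair_cst.
Proof.
have e0 := err_cst_ge0.
have t0 : 0 <= @tail_cst R d (p - q) by apply: tail_cst_ge0; case/andP : qp; lra.
by rewrite /near_pair_cst; nn.
Qed.

(** The Lipschitz bound at scale g(x) makes the kernel integrable at the
    diagonal, as p > q. *)
Lemma near_energy :
  (\int[mu]_x \int[mu]_y
     (\1[near_pair x y] * `|ext x - ext y| `^ p * kernel x y)%:E <=
   near_pair_cst%:E * energy)%E.
Proof.
have t0 : 0 <= @tail_cst R d (p - q) by apply: tail_cst_ge0; case/andP : qp; lra.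
apply: (@le_trans _ _ (\int[mu]_x ((c2 * (@tail_cst R d (p - q) * 2 `^ p))%:E *
    (\1[near_thick x] * g x `^ (- q) * err x)%:E))%E); last first.
  rewrite integral_scale; [|by ms|by nn|by nn].
  rewrite /near_pair_cst (EFinM _ err_cst) -muleA; apply: lee_wpmul2l; first by nn.
  exact: err_energy.
apply: integral_le => x; first by nn.
have [xM|nM] := boolP (near_thick x); last first.
  rewrite integral0_eq; first by nn.
  by move=> y _; rewrite /near_pair (negbTE nM) !mul0r.
have /andP[gx gh] := xM.
have g8 : 0 < g x / 8 by rewrite divr_gt0.
pose A := c2 * err x * g x `^ (- p).
have A0 : 0 <= A by rewrite /A; nn.
apply: (@le_trans _ _ (A%:E *
   (@tail_cst R d (p - q) * 2 `^ p * (g x / 8) `^ (p - q))%:E)%E).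
  apply: le_trans (lee_wpmul2l _ (integral_near_kernel x qp g8)); last by nn.
  rewrite -integral_scale; [|by ms|by nn|by nn].
  apply: integral_le => y; first by nn.
  rewrite -EFinM lee_fin /near_pair xM /=.
  have [xy|_] := boolP (enorm (x - y) < _); last by rewrite !(mul0r, mulr0).
  rewrite !mul1r mulrA; apply: ler_wpM2r; first by nn.
  apply: (le_trans (ext_near xM xy)).
  rewrite powR_divX ?enorm_ge0// /A le_eqVlt; apply/orP; left; apply/eqP; ring.
rewrite mul1r -!EFinM lee_fin.
have -> : c2 * (@tail_cst R d (p - q) * 2 `^ p) * (g x `^ (- q) * err x) =
    A * (@tail_cst R d (p - q) * 2 `^ p * g x `^ (p - q)).
  have -> : g x `^ (- q) = g x `^ (- p) * g x `^ (p - q).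
    by rewrite -powRD ?(gt_eqF gx) ?implybT// addKr.
  by rewrite /A; ring.
apply: ler_wpM2l; first by nn.
apply: ler_wpM2l; first by nn.
by apply: ge0_ler_powR; rewrite ?nnegrE; case/andP : qp => *; lra.
Qed.

Definition far_pair x y : bool := h x <= 17 * enorm (x - y).

Definition far_cst : R := 17 `^ q * @tail_cst R d q * wgt_cst.

Lemma far_cst_ge0 : 0 <= far_cst.
Proof.
have t0 := @tail_cst_ge0 R d _ q0; have w0 := wgt_cst_ge0.
by rewrite /far_cst; nn.
Qed.

(** The kernel integral over |x - y| >= h(x)/17 is at most a multiple of
    h(x)^-q. *)
Lemma far_energy :
  (\int[mu]_x \int[mu]_y
     (\1[far_pair x y] * `|glue x| `^ p * kernel x y)%:E <=
   far_cst%:E * energy)%E.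
Proof.
have t0 := @tail_cst_ge0 R d _ q0; have mgl := measurable_glue.
apply: (@le_trans _ _ (\int[mu]_x ((17 `^ q * @tail_cst R d q)%:E *
    (`|glue x| `^ p * h x `^ (- q))%:E))%E); last first.
  rewrite integral_scale; [|by ms|by nn|by nn].
  rewrite /far_cst (EFinM _ wgt_cst) -muleA; apply: lee_wpmul2l; first by nn.
  exact: glue_wgt.
apply: integral_le => x; first by nn.
have [hx|hx] := leP (h x) 0.
  rewrite integral0_eq; first by nn.
  by move=> y _; rewrite glue_eq0// normr0 powR0 ?gt_eqF// mulr0 mul0r.
have h17 : 0 < 17^-1 * h x by rewrite mulr_gt0// invr_gt0.
apply: (@le_trans _ _ ((`|glue x| `^ p)%:E *
   (@tail_cst R d q * (17^-1 * h x) `^ (- q))%:E)%E).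
  apply: le_trans (lee_wpmul2l _ (far_kernel x h17)); last by nn.
  rewrite -integral_scale; [|by ms|by nn|by nn].
  apply: integral_le => y; first by nn.
  by rewrite -EFinM lee_fin /far_pair ler_pdivrMl// mulrAC mulrC mulrA.
rewrite -!EFinM lee_fin.
have -> : 17 `^ q * @tail_cst R d q * (`|glue x| `^ p * h x `^ (- q)) =
    `|glue x| `^ p * (@tail_cst R d q * (17 `^ q * h x `^ (- q))) by ring.
apply: ler_wpM2l; first by nn.
apply: ler_wpM2l; first by nn.
by apply: powR_neg_compare; rewrite ?(ltW q0)// mulVKf.
Qed.


(** If both h(x) and h(y) exceed 16 |x - y|, then |x - y| < 1/1600, and a
    point outside O with g < h lies at distance at least g from O. *)
Lemma pair_cases x y : 0 < g x -> 0 < g y ->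
  [|| far_pair x y && far_pair y x, (x \in O) && (y \in O),
      cross_pair x y, cross_pair y x,
      [&& x \notin O, y \notin O & near_pair x y],
      [&& x \notin O, y \notin O & near_pair y x],
      both_pair x y | (glue x == 0) && (glue y == 0)].
Proof.
move=> gx gy; set r := enorm (x - y).
have rC : enorm (y - x) = r by rewrite enormC.
have hxy := h_lip x y; have hyx := h_lip y x; rewrite rC -/r in hyx hxy.
rewrite /far_pair rC -/r.
(* The far pairs, with 17 = 16 + 1 for the other endpoint. *)
have [hx|hx] /= := leP (h x) (16 * r).
  by apply/orP; left; have := enorm_ge0 (x - y); rewrite -/r => r0;
    apply/andP; split; lra.
have [hy|hy] /= := leP (h y) (16 * r).
  by apply/orP; left; have := enorm_ge0 (x - y); rewrite -/r => r0;
    apply/andP; split; lra.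
apply/orP; right.
have lx := h_le x; have ly := h_le y.
have r400 : r < 400^-1 by lra.
have r16 : r < 16^-1 by lra.
have [xO|nxO] := boolP (x \in O); have [yO|nyO] := boolP (y \in O) => //=.
- have nOy : ~ O y by move=> Oy; move/negP : nyO; apply; exact: mem_set.
  have [] := cross nOy (set_mem xO); rewrite rC => ggy; first by exfalso; lra.
  apply/orP; right; apply/orP; left.
  by rewrite /cross_pair nyO xO rC r16 /near_thick gy /=; rewrite !andbT; lra.
- have nOx : ~ O x by move=> Ox; move/negP : nxO; apply; exact: mem_set.
  have [] := cross nOx (set_mem yO); rewrite -/r => ggx; first by exfalso; lra.
  apply/orP; left.
  by rewrite /cross_pair nxO yO r16 /near_thick gx /=; rewrite ?andbT; lra.
have gxy := g_lip x y; have gyx := g_lip y x; rewrite rC -/r in gyx gxy.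
rewrite /cross_pair (negbTE nxO) (negbTE nyO) /= !andbF /=.
rewrite /near_pair /both_pair /near_thick nxO nyO gx gy rC -/r r400 /= !andbT.
have [xM|xM] := ltP (g x) (h x); have [yM|yM] := ltP (g y) (h y) => /=.
- have [//|rx] /= := ltP r (g x / 8); apply/or3P; constructor 2; lra.
- by have [//|rx] := ltP r (g x / 8); exfalso; lra.
- by have [//|rx] := ltP r (g y / 8); exfalso; lra.
by rewrite /glue (negbTE nxO) (negbTE nyO) !ext_eq0// eqxx.
Qed.

(** The contributions that a pair makes in one of its two orders. *)
Definition side x y : R :=
  2 `^ p * (\1[far_pair x y] * `|glue x| `^ p * kernel x y) +
  \1[cross_pair x y] * `|ext x - f y| `^ p * kernel x y +
  \1[near_pair x y] * `|ext x - ext y| `^ p * kernel x y.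

Lemma side_ge0 x y : 0 <= side x y.
Proof. by rewrite /side; nn. Qed.

Let pick_term (W J a b c : R) : 0 <= J -> 0 <= a -> 0 <= b -> 0 <= c ->
  [\/ W <= J, W <= a, W <= b | W <= c] -> W <= J + (a + b) + c.
Proof. by move=> ? ? ? ? []; lra. Qed.

Lemma pair_le x y : 0 < g x -> 0 < g y ->
  \1[enorm (x - y) < 1] * `|glue x - glue y| `^ p * kernel x y <=
  \1[x \in O] * \1[y \in O] * \1[enorm (x - y) < 1] * `|f x - f y| `^ p *
     kernel x y + (side x y + side y x) +
  \1[both_pair x y] * `|ext x - ext y| `^ p * kernel x y.
Proof.
move=> gx gy.
have s0 := side_ge0 x y; have s1 := side_ge0 y x.
have j0 : 0 <= \1[x \in O] * \1[y \in O] * \1[enorm (x - y) < 1] *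
  `|f x - f y| `^ p * kernel x y by nn.
have b0 : 0 <= \1[both_pair x y] * `|ext x - ext y| `^ p * kernel x y by nn.
have [r1|nr1] := boolP (enorm (x - y) < 1); last first.
  rewrite (negbTE nr1) in j0; rewrite !mul0r.
  exact: (addr_ge0 (addr_ge0 j0 (addr_ge0 s0 s1)) b0).
rewrite r1 in j0.
have side_cross u v : cross_pair u v ->
    `|glue u - glue v| `^ p * kernel u v <= side u v.
  move=> uv; rewrite /side uv mul1r; case/and4P : uv => nu _ vO _.
  rewrite /glue (negbTE nu) vO -addrA addrCA lerDl; apply: addr_ge0; nn.
have side_near u v : u \notin O -> v \notin O -> near_pair u v ->
    `|glue u - glue v| `^ p * kernel u v <= side u v.
  move=> nu nv uv; rewrite /side uv mul1r /glue (negbTE nu) (negbTE nv) lerDr.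
  by apply: addr_ge0; nn.
have side_far u v : far_pair u v -> 2 `^ p * (`|glue u| `^ p * kernel u v) <= side u v.
  by move=> uv; rewrite /side uv mul1r -addrA lerDl; apply: addr_ge0; nn.
rewrite mul1r.
move: (pair_cases gx gy) => /orP[/andP[fxy fyx]|cases].
  apply: (@le_trans _ _ (side x y + side y x)); last first.
    by rewrite -[leRHS]addrA addrCA lerDl; exact: addr_ge0.
  apply: (le_trans (ler_wpM2r (kernel_ge0 x y) (powR_normB (glue x) (glue y) p0))).
  rewrite -mulrA mulrDl mulrDr {2}kernelC.
  by apply: lerD; exact: side_far.
apply: pick_term; [exact: j0|exact: s0|exact: s1|exact: b0|].
move: cases => /or4P[|xy|yx|].
- move=> /andP[xO yO]; rewrite /glue xO yO !mul1r; constructor 1; exact: lexx.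
- by constructor 2; exact: side_cross.
- by constructor 3; rewrite distrC kernelC; exact: side_cross.
- move=> /or4P[/and3P[nx ny xy]|/and3P[nx ny yx]|xy|/andP[/eqP x0 /eqP y0]].
  + by constructor 2; exact: side_near.
  + by constructor 3; rewrite distrC kernelC; exact: side_near.
  + constructor 4; rewrite xy mul1r; have /and5P[nx ny _ _ _] := xy.
    rewrite /glue (negbTE nx) (negbTE ny); exact: lexx.
  + constructor 1; rewrite x0 y0 subrr normr0 powR0 ?gt_eqF// mul0r; exact: j0.
Qed.

Hypothesis g_null : mu [set x | g x = 0] = 0%E.

Lemma ae_g_gt0 : {ae mu, forall x, 0 < g x}.
Proof.
have mZ : measurable [set x | g x = 0].
  rewrite (_ : [set x | g x = 0] = [set x | g x <= 0]).
    by apply: measurable_bool_set; meas.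
  apply/seteqP; split => x /= [h0]; first by rewrite h0.
  by apply/eqP; rewrite eq_le h0 g_ge0.
exists [set x | g x = 0]; split => // x /= gx.
by apply/eqP; rewrite eq_le g_ge0 andbT leNgt; apply/negP.
Qed.

Definition pair_cst : R :=
  1 + 2 * (2 `^ p * far_cst + cross_cst + near_pair_cst) + both_cst.

Lemma pair_cst_ge0 : 0 <= pair_cst.
Proof.
have := far_cst_ge0; have := cross_cst_ge0; have := near_pair_cst_ge0.
by have := both_cst_ge0; rewrite /pair_cst => a0 b0 e0 t0; nn.
Qed.

Lemma side_energy :
  (\int[mu]_x \int[mu]_y (side x y)%:E <=
   (2 `^ p * far_cst + cross_cst + near_pair_cst)%:E * energy)%E.
Proof.
have mgl := measurable_glue; have E0 := energy_ge0.
have f0 := far_cst_ge0; have cc0 := cross_cst_ge0; have n0 := near_pair_cst_ge0.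
pose F1 x y : \bar R := (\1[far_pair x y] * `|glue x| `^ p * kernel x y)%:E.
pose G1 x y : \bar R :=
  (2 `^ p * (\1[far_pair x y] * `|glue x| `^ p * kernel x y))%:E.
pose F2 x y : \bar R := (\1[cross_pair x y] * `|ext x - f y| `^ p * kernel x y)%:E.
pose F3 x y : \bar R := (\1[near_pair x y] * `|ext x - ext y| `^ p * kernel x y)%:E.
have m1 : measurable_fun setT (fun u : T * T => G1 u.1 u.2).
  by rewrite /G1 /far_pair; ms.
have m2 : measurable_fun setT (fun u : T * T => F2 u.1 u.2).
  by rewrite /F2 /cross_pair; ms.
have m3 : measurable_fun setT (fun u : T * T => F3 u.1 u.2).
  by rewrite /F3 /near_pair; ms.
have G10 x y : (0 <= G1 x y)%E by rewrite /G1; nn.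
have F20 x y : (0 <= F2 x y)%E by rewrite /F2; nn.
have F30 x y : (0 <= F3 x y)%E by rewrite /F3; nn.
have -> : (\int[mu]_x \int[mu]_y (side x y)%:E =
    \int[mu]_x \int[mu]_y (G1 x y + F2 x y + F3 x y))%E by [].
rewrite integral2_add; [|exact: emeasurable_funD|exact: m3
  |by move=> x y; exact: adde_ge0|exact: F30].
rewrite integral2_add; [|exact: m1|exact: m2|exact: G10|exact: F20].
have -> : (\int[mu]_x \int[mu]_y G1 x y =
    (2 `^ p)%:E * \int[mu]_x \int[mu]_y F1 x y)%E.
  rewrite -integral_scale; [|by rewrite /F1 /far_pair; ms|by nn|by rewrite /F1; nn].
  apply: eq_integral => x _.
  by rewrite -integral_scale; [|by rewrite /F1 /far_pair; ms|by nn|by rewrite /F1; nn].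
rewrite 2!EFinD (EFinM (2 `^ p)) ge0_muleDl; [|by nn|by nn].
rewrite ge0_muleDl; [|by nn|by nn].
apply: leeD; last exact: near_energy.
apply: leeD; last exact: cross_energy.
by rewrite -muleA; apply: lee_wpmul2l; [nn|exact: far_energy].
Qed.

Lemma glue_pairs :
  (\int[mu]_x \int[mu]_y (\1[enorm (x - y) < 1] * `|glue x - glue y| `^ p *
      kernel x y)%:E <= pair_cst%:E * energy)%E.
Proof.
have mgl := measurable_glue; have E0 := energy_ge0.
have f0 := far_cst_ge0; have cc0 := cross_cst_ge0; have n0 := near_pair_cst_ge0.
have bb0 := both_cst_ge0.
pose J x y : R := \1[x \in O] * \1[y \in O] * \1[enorm (x - y) < 1] *
  `|f x - f y| `^ p * kernel x y.
pose K x y : R := \1[both_pair x y] * `|ext x - ext y| `^ p * kernel x y.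
apply: (@le_trans _ _ (\int[mu]_x \int[mu]_y (J x y)%:E +
   (\int[mu]_x \int[mu]_y (side x y)%:E + \int[mu]_x \int[mu]_y (side x y)%:E) +
   \int[mu]_x \int[mu]_y (K x y)%:E)%E).
  apply: (integral_pair_majorant ae_g_gt0).
  - by ms.
  - by rewrite /J; ms.
  - by rewrite /side /far_pair /cross_pair /near_pair; ms.
  - by rewrite /K /both_pair; ms.
  - by nn.
  - by rewrite /J; nn.
  - exact: side_ge0.
  - by rewrite /K; nn.
  - exact: pair_le.
apply: (@le_trans _ _ (1%:E * energy +
  ((2 `^ p * far_cst + cross_cst + near_pair_cst)%:E * energy +
   (2 `^ p * far_cst + cross_cst + near_pair_cst)%:E * energy) +
   both_cst%:E * energy)%E).
  apply: leeD; last exact: both_energy.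
  apply: leeD; first by rewrite mul1e; exact: energy_oscE.
  by apply: leeD; exact: side_energy.
rewrite -ge0_muleDl; [|by nn|by nn].
rewrite -ge0_muleDl; [|by nn|by nn].
rewrite -ge0_muleDl; [|by nn|by nn].
rewrite -!EFinD /pair_cst mulr_natl mulr2n; exact: lexx.
Qed.

End pairs.

(** * The extension operator *)

Section root_norms.
Context {R : realType}.
Local Open Scope ereal_scope.

Lemma ge0_le_poweR (r : R) (x y : \bar R) : (0 <= r)%R -> 0 <= x -> x <= y ->
  x `^ r <= y `^ r.
Proof.
move=> r0 x0 xy; apply: gt0_ler_poweR => //; rewrite in_itv/= ?x0 ?leey//.
by rewrite (le_trans x0 xy).
Qed.

Lemma lee_three_max (x y z : \bar R) : 0 <= x -> 0 <= y -> 0 <= z ->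
  exists2 m, [/\ 0 <= m & [\/ m = x, m = y | m = z]] & x + y + z <= 3%:E * m.
Proof.
have add3 (a b c m : \bar R) : 0 <= m -> a <= m -> b <= m -> c <= m ->
    a + b + c <= 3%:E * m.
  move=> m0 am bm cm; have -> : 3%:E * m = m + m + m.
    have -> : 3%R = (1 + 1 + 1)%R :> R by ring.
    by rewrite !EFinD !ge0_muleDl ?adde_ge0// mul1e.
  by apply: leeD => //; exact: leeD.
move=> x0 y0 z0; have [xy|xy] := leP x y; have [yz|yz] := leP y z.
- exists z; first by split=> //; constructor 3.
  by apply: add3 => //; exact: le_trans yz.
- exists y; first by split=> //; constructor 2.
  by apply: add3 => //; exact: ltW.
- have [xz|xz] := leP x z.
    exists z; first by split=> //; constructor 3.
    by apply: add3.
  exists x; first by split=> //; constructor 1.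
  by apply: add3 => //; exact: ltW.
- exists x; first by split=> //; constructor 1.
  by apply: add3 => //; rewrite ltW// (lt_trans yz).
Qed.

(** A sum of three terms is at most three times the largest, so that the root
    of the sum is bounded by the sum of the roots for every exponent. *)
Lemma le_poweR_sum3 (r K : R) (x y z t : \bar R) : (0 <= r)%R -> (0 <= K)%R ->
  0 <= x -> 0 <= y -> 0 <= z -> 0 <= t ->
  t <= K%:E * (x + y + z) ->
  t `^ r <= ((K * 3) `^ r)%:E * (x `^ r + y `^ r + z `^ r).
Proof.
move=> r0 K0 x0 y0 z0 t0 tK.
have [m [m0 mxyz] mle] := lee_three_max x0 y0 z0.
apply: (@le_trans _ _ (((K * 3)%:E * m) `^ r)).
  apply: ge0_le_poweR => //; apply: (le_trans tK); rewrite EFinM -muleA.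
  exact: lee_wpmul2l.
rewrite poweRM//; last by rewrite lee_fin mulr_ge0.
rewrite poweR_EFin; apply: lee_wpmul2l; first by rewrite lee_fin powR_ge0.
have hx := poweR_ge0 x r; have hy := poweR_ge0 y r; have hz := poweR_ge0 z r.
case: mxyz => ->.
- by rewrite -addeA leeDl// adde_ge0.
- by rewrite (addeC (x `^ r)) -addeA leeDl// adde_ge0.
- by rewrite leeDr// adde_ge0.
Qed.

Lemma lee_weighted_sum (k : R) (x y z : \bar R) : (0 <= k)%R ->
  0 <= x -> 0 <= y -> 0 <= z ->
  y + (z + k%:E * x) <= (1 + k)%:E * (x + y + z).
Proof.
move=> k0 x0 y0 z0; have le1 u : 0 <= u -> u <= (1 + k)%:E * u.
  by move=> u0; rewrite -[leLHS]mul1e lee_wpmul2r// lee_fin lerDl.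
have kle : k%:E * x <= (1 + k)%:E * x by rewrite lee_wpmul2r// lee_fin lerDr.
have -> : y + (z + k%:E * x) = k%:E * x + y + z by rewrite addeA addeC addeA.
rewrite !ge0_muleDr ?adde_ge0//.
by apply: leeD; [apply: leeD => //|]; exact: le1.
Qed.

End root_norms.

Section norm_integrals.
Context {R : realType} {d : nat}.
Local Notation T := 'rV[R]_d.
Local Notation mu := (lebesgue_rV d : {sigma_finite_measure set T -> \bar R}).
Implicit Types (O U D : set T) (f : T -> R) (p s : R).

Definition Lp_integral p U f : \bar R := (\int[mu]_(x in U) (`|f x| `^ p)%:E)%E.

Definition Wsp_integral s p U f : \bar R :=
  (\int[mu]_(x in U) \int[mu]_(y in U `&` eball x 1)
     (`|f x - f y| `^ p / enorm (x - y) `^ (s * p + d%:R))%:E)%E.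

Definition weighted_integral s p D U f : \bar R :=
  (\int[mu]_(x in U) ((`|f x| `^ p)%:E * (edist_set D x `^ (s * p))^-1))%E.

Lemma Lp_integral_ge0 p U f : (0 <= Lp_integral p U f)%E.
Proof. by rewrite /Lp_integral; nn. Qed.

Lemma Wsp_integral_ge0 s p U f : (0 <= Wsp_integral s p U f)%E.
Proof.
apply: integral_ge0 => x _; apply: integral_ge0 => y _.
by rewrite lee_fin divr_ge0 ?powR_ge0.
Qed.

Lemma weighted_integral_ge0 s p D U f : (0 <= weighted_integral s p D U f)%E.
Proof.
apply: integral_ge0 => x _.
by apply: mule_ge0; [nn|rewrite inve_ge0 poweR_ge0].
Qed.

Lemma integrals_ge0 s p D U f :
  (0 <= Lp_integral p U f + Wsp_integral s p U f + weighted_integral s p D U f)%E.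
Proof.
apply: adde_ge0; last exact: weighted_integral_ge0.
by apply: adde_ge0; [exact: Lp_integral_ge0|exact: Wsp_integral_ge0].
Qed.

Lemma WspD_normE s p D U f : WspD_norm s p D U f =
  (Lp_integral p U f `^ p^-1 + Wsp_integral s p U f `^ p^-1 +
   weighted_integral s p D U f `^ p^-1)%E.
Proof. by []. Qed.

Lemma integral_restrict_ind U (F : T -> \bar R) :
  (\int[mu]_(x in U) F x = \int[mu]_x ((\1[x \in U])%:E * F x))%E.
Proof.
rewrite integral_mkcond; apply: eq_integral => x _; rewrite patchE.
by case: (x \in U); rewrite ?mul1e ?mul0e.
Qed.

Lemma Lp_integralE p U f :
  (Lp_integral p U f = \int[mu]_x (\1[x \in U] * `|f x| `^ p)%:E)%E.
Proof.
by rewrite /Lp_integral integral_restrict_ind; apply: eq_integral => x _; rewrite EFinM.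
Qed.

Lemma Wsp_integralE s p U f : measurable U -> measurable_fun setT f ->
  (Wsp_integral s p U f =
   \int[mu]_x \int[mu]_y (\1[x \in U] * \1[y \in U] * \1[enorm (x - y) < 1] *
     `|f x - f y| `^ p * kernel (s * p) x y)%:E)%E.
Proof.
move=> mU mf; rewrite /Wsp_integral integral_restrict_ind; apply: eq_integral => x _.
rewrite integral_restrict_ind -integral_scale; last 3 first.
- have mI : measurable (U `&` eball x 1).
    by apply: measurableI => //; exact: measurable_eball.
  apply: emeasurable_funM; first by meas.
  apply: measurable_fun_EFin; apply: measurable_funM; first by meas.
  rewrite (_ : (fun y => _) = fun y => enorm (x - y) `^ (- (s * p + d%:R))).
    by meas.
  by apply/funext => y; rewrite powRN.
- by [].
- by move=> y; apply: mule_ge0; rewrite lee_fin// divr_ge0 ?powR_ge0.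
apply: eq_integral => y _; rewrite -!EFinM in_setI eball_mem /kernel powRN.
by congr EFin; case: (x \in U); case: (y \in U); case: (_ < _);
  rewrite ?(mul0r, mulr0, mul1r, mulr1).
Qed.

Lemma edist_weight_le D q x : 0 <= q -> 0 < hdist D x ->
  ((edist_set D x `^ q)^-1 <= (hdist D x `^ (- q))%:E)%E.
Proof.
move=> q0 hx; have hq : 0 < hdist D x `^ q by rewrite powR_gt0.
have -> : (hdist D x `^ (- q))%:E = (((hdist D x)%:E `^ q)^-1)%E.
  by rewrite poweR_EFin inver gt_eqF// powRN.
rewrite lee_pV2 ?inE ?poweR_ge0//; apply: ge0_le_poweR => //.
  by rewrite lee_fin ltW.
exact: tdist_le_edist.
Qed.

Lemma edist_weight_eq D q x : 0 < hdist D x < 100^-1 ->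
  ((edist_set D x `^ q)^-1 = (hdist D x `^ (- q))%:E)%E.
Proof.
move=> /andP[hx hlt]; have := @tdistE _ _ 100^-1 D x (hdist_cut).
rewrite -/(hdist D x); have [eh|he] := leP (edist_set D x) (100^-1)%:E.
  by move=> <-; rewrite poweR_EFin inver gt_eqF ?powR_gt0// powRN.
by case=> hE; move: hlt; rewrite hE ltxx.
Qed.

End norm_integrals.

Section extension_operator.
Context {R : realType} {d : nat}.
Local Notation T := 'rV[R]_d.
Local Notation mu := (lebesgue_rV d : {sigma_finite_measure set T -> \bar R}).
Context (O D : set T) (p s c : R).
Hypothesis hO : open O.
Hypothesis hD : D `<=` boundary O.
Hypothesis p0 : 0 < p.
Hypothesis s01 : 0 < s < 1.
Hypothesis c0 : 0 < c.
Hypothesis thick : forall x (r : R), (boundary O `\` D) x ->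
  0 < r <= 1 -> (c%:E * mu (eball x r) <= mu (eball x r `&` O))%E.
Implicit Types (f : T -> R) (x y w : T).

Local Notation q := (s * p).
Local Notation g := (gdist O D).
Local Notation h := (hdist D).
Local Notation kappa := (@thick_cst R d c).

(** Functions on O are extended by 0 before averaging, which makes the operator
    depend on the restriction to O alone. *)
Definition outer f : T -> R := extend O g h p (f \_ O).

Definition extension f : T -> R := glue O (outer f) (f \_ O).

Let mO : measurable O. Proof. exact: measurable_O. Qed.
Let g_ge0 x : 0 <= g x. Proof. exact: gdist_ge0. Qed.
Let g_lip x y : g x <= g y + enorm (x - y). Proof. exact: gdist_le. Qed.
Let h_lip x y : h x <= h y + enorm (x - y). Proof. exact: hdist_leD. Qed.
Let h_le x : h x <= 100^-1. Proof. exact: hdist_le. Qed.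
Let kappa0 : 0 < kappa. Proof. exact: thick_cst_gt0. Qed.
Let mg : measurable_fun setT g. Proof. exact: measurable_gdist. Qed.
Let mh : measurable_fun setT h. Proof. exact: measurable_hdist. Qed.
Let g_le1 x : g x <= 1. Proof. exact: tdist_le. Qed.
Let g_thick x : 0 < g x < 2^-1 ->
  ((kappa * g x ^+ d)%:E <= mu (eball x (3 * g x) `&` O))%E.
Proof. exact: thick_gdist_ball. Qed.
Let qp : 0 < q < p.
Proof. by case/andP : s01 => s0 s1; rewrite mulr_gt0//= gtr_pMl. Qed.
Let h_gt0 x : O x -> 0 < h x. Proof. exact: hdist_gt0. Qed.

Let small x : 0 < g x < h x -> 0 < g x < 2^-1.
Proof. by move=> /andP[gx gh]; rewrite gx /=; have := h_le x; lra. Qed.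

Lemma outer_eq0 f x : h x <= g x -> outer f x = 0.
Proof.
move=> hg; have := g_ge0 x; rewrite le_eqVlt => /predU1P[/esym g0|gx].
  exact: extend_g0.
exact: extend_eq0.
Qed.

Definition shadow_dev_cst : R :=
  2 `^ p * (@shadow_cst R kappa)^-1 * (@ext_cst R d kappa p + 1).

Lemma shadow_dev_cst_ge0 : 0 <= shadow_dev_cst.
Proof.
have e0 := @ext_cst_ge0 R d _ p kappa0; have k0 := shadow_cst_gt0 kappa0.
by rewrite /shadow_dev_cst; nn.
Qed.

Local Opaque ext_cst shadow_cst.

Lemma overlap_ge0 : 0 <= @overlap_cst R d kappa.
Proof. by rewrite /overlap_cst addr_ge0 ?exprn_ge0// ltW// crowd_cap_gt0. Qed.

Section function.
Variable f : T -> R.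
Hypothesis mf : measurable_fun setT (f \_ O).
Hypothesis fp : (\int[mu]_w (\1[w \in O] * `|(f \_ O) w| `^ p)%:E < +oo)%E.

Local Notation f0 := (f \_ O).
Local Notation S := (shadow O g kappa).

(** Both the value at x and b are compared with f on the shadow of x; there the
    deviation from the value at x is at most the local deviation. *)
Lemma outer_shadow x b : 0 < g x < h x ->
  ((`|outer f x - b| `^ p)%:E <= shadow_dev_cst%:E * ((rerr O g h p f0 x)%:E +
     (g x `^ (- d%:R))%:E * \int[mu]_w (\1[S x w] * `|f0 w - b| `^ p)%:E))%E.
Proof.
move=> xM; have gx2 := small xM; have /andP[gx _] := xM.
have gd : 0 < g x ^+ d by rewrite exprn_gt0.
have k0 := shadow_cst_gt0 kappa0; have e0 := @ext_cst_ge0 R d _ p kappa0.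
have mS : measurable_fun setT (fun w => S x w).
  by apply: measurable_shadow_comp => //; meas.
set v := outer f x; set I := (\int[mu]_w (\1[S x w] * `|f0 w - b| `^ p)%:E)%E.
have I0 : (0 <= I)%E by rewrite /I; nn.
have er0 := rerr_ge0 h mO g_ge0 p0 mf fp x.
set e := rerr _ _ _ _ _ _ in er0 *.
set m := shadow_cst kappa * g x ^+ d.
have m0 : 0 < m by rewrite mulr_gt0.
have dev : (\int[mu]_w (\1[S x w] * `|v - f0 w| `^ p)%:E <=
    (@ext_cst R d kappa p * (g x ^+ d * e))%:E)%E.
  apply: (@le_trans _ _ (local_dev O g p f0 x v)).
    apply: integral_le => w; first by nn.
    rewrite lee_fin distrC; apply: ler_wpM2r; first by nn.
    have [/and3P[Ow xw _]|_] := boolP (S x w); last by nn.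
    have -> : enorm (x - w) < 6 * g x by lra.
    by rewrite Ow mulr1.
  rewrite -(rdevE mO g_ge0 p0 mf fp) lee_fin.
  exact: (extend_dev mO g_ge0 g_lip h_lip h_le kappa0 g_thick p0 mf fp gx2).
have H : (m%:E * (`|v - b| `^ p)%:E <= (2 `^ p)%:E *
    ((@ext_cst R d kappa p * (g x ^+ d * e))%:E + I))%E.
  apply: (@le_trans _ _ ((2 `^ p)%:E *
     (\int[mu]_w (\1[S x w] * `|v - f0 w| `^ p)%:E + I))%E); last first.
    by apply: lee_wpmul2l; [nn|exact: leeD].
  apply: (@le_trans _ _ ((`|v - b| `^ p)%:E * \int[mu]_w (\1[S x w])%:E)%E).
    rewrite muleC; apply: lee_wpmul2l; first by nn.
    exact: (shadow_volume mO mg kappa0 g_thick gx2).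
  rewrite -integral_scale; [|by meas|by nn|by nn].
  rewrite -integral_add; [|by meas|by meas|by nn|by nn].
  rewrite -integral_scale; [|by meas|by nn|by nn].
  apply: integral_le => w; first by nn.
  rewrite -EFinD -!EFinM lee_fin; case: (S x w).
    by rewrite mulr1 !mul1r; exact: powR_dist_triangle.
  by rewrite !mul0r addr0 !mulr0.
apply: (le_trans (lee_pdiv m0 H)).
rewrite muleA -EFinM.
apply: (@le_trans _ _ ((m^-1 * 2 `^ p)%:E * ((@ext_cst R d kappa p + 1)%:E *
    ((g x ^+ d)%:E * (e%:E + (g x `^ (- d%:R))%:E * I))))%E); last first.
  rewrite !muleA -!EFinM; apply: lee_wpmul2r.
    by apply: adde_ge0; [rewrite lee_fin|apply: mule_ge0; [nn|]].
  rewrite lee_fin /shadow_dev_cst /m le_eqVlt; apply/orP; left; apply/eqP.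
  move: (shadow_cst kappa) k0 (g x ^+ d) gd => k k0' G G0.
  by field; rewrite !gt_eqF.
apply: lee_wpmul2l; first by nn.
rewrite (ge0_muleDr (g x ^+ d)%:E); [|by rewrite lee_fin|by apply: mule_ge0; [nn|]].
rewrite muleA -!EFinM.
have -> : g x ^+ d * g x `^ (- d%:R) = 1.
  by rewrite powRN powR_mulrn ?(ltW gx)// divff// gt_eqF.
rewrite mul1e ge0_muleDr; [|by rewrite lee_fin mulr_ge0// ltW|exact: I0].
apply: leeD.
  rewrite -EFinM lee_fin; apply: ler_wpM2r; first by rewrite mulr_ge0// ltW.
  by rewrite lerDl.
rewrite -[X in (X <= _)%E]mul1e; apply: lee_wpmul2r => //.
by rewrite lee_fin lerDr.
Qed.

Lemma measurable_rerr : measurable_fun setT (rerr O g h p f0).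
Proof.
rewrite (_ : rerr O g h p f0 = fine \o local_err O g h p f0); last first.
  by apply/funext => x /=; rewrite -(rerrE h mO g_ge0 p0 mf fp).
apply: measurableT_comp; first exact: fine_measurable.
by rewrite /local_err /local_osc /local_dev; meas; nn.
Qed.

Let merr := measurable_rerr.
Let mout : measurable_fun setT (outer f).
Proof. exact: measurable_extend. Qed.

Let mS d' (U : measurableType d') (a b : U -> T) :
  measurable_fun setT a -> measurable_fun setT b ->
  measurable_fun setT (fun u => S (a u) (b u)).
Proof. exact: measurable_shadow_comp. Qed.

Let S_sub x w : S x w -> O w /\ enorm (x - w) < 3 * g x.
Proof. by move=> /and3P[/set_mem]. Qed.

Let err0 := rerr_ge0 h mO g_ge0 p0 mf fp.
Let errE := rerrE h mO g_ge0 p0 mf fp.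
Let outer_g0 x : g x = 0 -> outer f x = 0.
Proof. exact: extend_g0. Qed.

Let overlap := shadow_overlap O mg g_le1 kappa0.

Definition weight_cst : R := @wgt_cst R d q shadow_dev_cst (@overlap_cst R d kappa).

Lemma extension_weight :
  (\int[mu]_x (`|extension f x| `^ p * h x `^ (- q))%:E <=
   weight_cst%:E * energy O h f0 p q)%E.
Proof.
exact: (glue_wgt mO mg mh merr mf mS g_ge0 h_lip h_le h_gt0 qp shadow_dev_cst_ge0
  overlap_ge0 err0 errE outer_shadow (@outer_eq0 f) outer_g0 S_sub overlap).
Qed.

Definition difference_cst : R := @pair_cst R d p q shadow_dev_cst
  (@lip_cst R d kappa p) (@overlap_cst R d kappa).

Lemma extension_difference :
  (\int[mu]_x \int[mu]_y (\1[enorm (x - y) < 1] *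
     `|extension f x - extension f y| `^ p * kernel q x y)%:E <=
   difference_cst%:E * energy O h f0 p q)%E.
Proof.
have ext_near x y : 0 < g x < h x -> enorm (x - y) < g x / 8 ->
    `|outer f x - outer f y| `^ p <=
    @lip_cst R d kappa p * ((enorm (x - y) / g x) `^ p * rerr O g h p f0 x).
  move=> /small gx2.
  exact: (extend_lip mO g_ge0 g_lip h_lip h_le kappa0 g_thick p0 mf fp).
exact: (glue_pairs mO mg mh mout merr mf mS g_ge0 g_lip h_lip h_le h_gt0
  (cross_boundary D hO) qp shadow_dev_cst_ge0 (lip_cst_ge0 p kappa0)
  overlap_ge0 err0 errE outer_shadow ext_near (@outer_eq0 f) outer_g0 S_sub overlap
  (gdist_zero_measure hO c0 thick)).
Qed.

End function.

Lemma measurable_extension f : measurable_fun setT (f \_ O) ->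
  measurable_fun setT (extension f).
Proof. by move=> mf; apply: measurable_glue => //; exact: measurable_extend. Qed.

Lemma energyE f : energy O h (f \_ O) p q =
  (\int[mu]_x \int[mu]_y (\1[x \in O] * \1[y \in O] * \1[enorm (x - y) < 1] *
      `|(f \_ O) x - (f \_ O) y| `^ p * kernel q x y)%:E +
   \int[mu]_x (\1[x \in O] * `|(f \_ O) x| `^ p * h x `^ (- q))%:E)%E.
Proof. by []. Qed.

Lemma weight_cst_ge0 : 0 <= weight_cst.
Proof.
exact: (wgt_cst_ge0 qp shadow_dev_cst_ge0 overlap_ge0).
Qed.

Lemma difference_cst_ge0 : 0 <= difference_cst.
Proof.
exact: (pair_cst_ge0 qp shadow_dev_cst_ge0 (lip_cst_ge0 p kappa0) overlap_ge0).
Qed.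

Local Opaque weight_cst difference_cst energy.

Definition extension_cst : R := (weight_cst + difference_cst) * (1 + 100 `^ q).

Lemma extension_cst_ge0 : 0 <= extension_cst.
Proof.
have := weight_cst_ge0; have := difference_cst_ge0.
by rewrite /extension_cst => a0 b0; nn.
Qed.

Let restrictE f x : O x -> (f \_ O) x = f x.
Proof. by move=> Ox; rewrite patchE mem_set. Qed.

Lemma WspD_measurable f : WspD s p D O f -> measurable_fun setT (f \_ O).
Proof. by move=> [[[mf _] _] _]; exact/(measurable_restrictT f mO). Qed.

Lemma WspD_Lp f : WspD s p D O f ->
  (\int[mu]_w (\1[w \in O] * `|(f \_ O) w| `^ p)%:E < +oo)%E.
Proof.
move=> [[[_ Lf] _] _]; rewrite -Lp_integralE.
have pN0 : p^-1 != 0 by rewrite invr_neq0// gt_eqF.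
apply: le_lt_trans (lty_poweRy pN0 Lf); rewrite le_eqVlt; apply/orP; left.
by apply/eqP; apply: eq_integral => x /set_mem Ox; rewrite restrictE.
Qed.

(** Where h < 1/100 it is the distance to D, and elsewhere its power is the
    constant 100^q. *)
Lemma energy_le f : WspD s p D O f ->
  (energy O h (f \_ O) p q <=
   (1 + 100 `^ q)%:E * (Lp_integral p O f + Wsp_integral s p O f +
      weighted_integral s p D O f))%E.
Proof.
move=> Df; have mf := WspD_measurable Df.
have q0 : 0 < q by case/andP : qp.
have SE : (\int[mu]_x \int[mu]_y (\1[x \in O] * \1[y \in O] *
    \1[enorm (x - y) < 1] * `|(f \_ O) x - (f \_ O) y| `^ p *
    kernel q x y)%:E = Wsp_integral s p O f)%E.
  rewrite -(Wsp_integralE s p mO mf); apply: eq_integral => x /set_mem Ox.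
  by apply: eq_integral => y /set_mem[Oy _]; rewrite !restrictE.
have WE : (\int[mu]_x (\1[x \in O] * `|(f \_ O) x| `^ p * h x `^ (- q))%:E <=
    weighted_integral s p D O f + (100 `^ q)%:E * Lp_integral p O f)%E.
  rewrite Lp_integralE.
  have E1 : (\int[mu]_x (\1[x \in O] * `|f x| `^ p)%:E =
      \int[mu]_x (\1[x \in O] * `|(f \_ O) x| `^ p)%:E)%E.
    apply: eq_integral => x _; rewrite patchE.
    by case: (x \in O); rewrite ?mul0r.
  rewrite E1 -integral_scale; [|by meas|by nn|by nn].
  apply: (@le_trans _ _ (\int[mu]_x ((\1[h x < 100^-1] *
     (\1[x \in O] * `|(f \_ O) x| `^ p * h x `^ (- q)))%:E +
     (100 `^ q)%:E * (\1[x \in O] * `|(f \_ O) x| `^ p)%:E))%E).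
    apply: integral_le => x; first by nn.
    rewrite -EFinM -EFinD lee_fin; have [hx|hx] := ltP (h x) 100^-1.
      by rewrite mul1r lerDl; nn.
    have -> : h x = 100^-1 by apply/eqP; rewrite eq_le h_le.
    rewrite mul0r add0r mulrC; apply: ler_wpM2r; first by nn.
    by rewrite -powR_inv1// -powRrM mulrN mulN1r opprK.
  rewrite integral_add; [|by meas|by meas|by nn|by nn].
  apply: leeD; last exact: lexx.
  rewrite /weighted_integral integral_restrict_ind.
  apply: integral_le => x; first by nn.
  have [/set_mem Ox|nO] := boolP (x \in O); last first.
    by rewrite !(mul0r, mulr0) mul0e.
  rewrite mul1r mul1e (restrictE f Ox); have [hx|hx] := ltP (h x) 100^-1.
    rewrite edist_weight_eq; last by rewrite hx (h_gt0 Ox).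
    by rewrite mul1r EFinM.
  by rewrite mul0r; apply: mule_ge0; [nn|rewrite inve_ge0 poweR_ge0].
rewrite energyE SE; apply: (le_trans (leeD (lexx _) WE)).
by apply: lee_weighted_sum; [exact: powR_ge0|exact: Lp_integral_ge0|exact: Wsp_integral_ge0|exact: weighted_integral_ge0].
Qed.

Lemma extension_weight_le f : WspD s p D O f ->
  (\int[mu]_x (`|extension f x| `^ p * h x `^ (- q))%:E <=
   extension_cst%:E * (Lp_integral p O f + Wsp_integral s p O f +
      weighted_integral s p D O f))%E.
Proof.
move=> Df.
have w0 := weight_cst_ge0; have d0 := difference_cst_ge0.
apply: (le_trans (extension_weight (WspD_measurable Df) (WspD_Lp Df))).
apply: (le_trans (lee_wpmul2l _ (energy_le Df))); first by nn.
rewrite muleA -EFinM; apply: lee_wpmul2r.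
  exact: integrals_ge0.
by rewrite lee_fin; apply: ler_wpM2r; [nn|rewrite lerDl].
Qed.

Lemma extension_difference_le f : WspD s p D O f ->
  (Wsp_integral s p setT (extension f) <=
   extension_cst%:E * (Lp_integral p O f + Wsp_integral s p O f +
      weighted_integral s p D O f))%E.
Proof.
move=> Df.
have w0 := weight_cst_ge0; have d0 := difference_cst_ge0.
have mE : measurable_fun setT (extension f).
  exact: measurable_extension (WspD_measurable Df).
rewrite (Wsp_integralE s p measurableT mE).
under eq_integral => x _.
  under eq_integral => y _ do rewrite !in_setT !mul1r.
  over.
apply: (le_trans (extension_difference (WspD_measurable Df) (WspD_Lp Df))).
apply: (le_trans (lee_wpmul2l _ (energy_le Df))); first by nn.
rewrite muleA -EFinM; apply: lee_wpmul2r.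
  exact: integrals_ge0.
by rewrite lee_fin; apply: ler_wpM2r; [nn|rewrite lerDr].
Qed.

Lemma extension_eq0 f x : h x <= 0 -> extension f x = 0.
Proof. exact: (glue_eq0 _ g_ge0 h_gt0 (@outer_eq0 f)). Qed.

(** Since h <= 1, and the extension vanishes where h = 0. *)
Lemma extension_Lp_le f :
  (Lp_integral p setT (extension f) <=
   \int[mu]_x (`|extension f x| `^ p * h x `^ (- q))%:E)%E.
Proof.
apply: integral_le => x; first by nn.
rewrite lee_fin; have [hx|hx] := leP (h x) 0.
  by rewrite extension_eq0// normr0 powR0 ?gt_eqF// mul0r.
apply: ler_peMr; first by nn.
have q0 : 0 < q by case/andP : qp.
have -> : 1 = (1 : R) `^ (- q) by rewrite powR1.
apply: powR_le_neg => //; first by have := h_le x; lra.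
by rewrite oppr_le0 ltW.
Qed.

Lemma extension_weighted_le f :
  (weighted_integral s p D setT (extension f) <=
   \int[mu]_x (`|extension f x| `^ p * h x `^ (- q))%:E)%E.
Proof.
have q0 : 0 < q by case/andP : qp.
apply: integral_le => x.
  by apply: mule_ge0; [nn|rewrite inve_ge0 poweR_ge0].
have [hx|hx] := leP (h x) 0.
  by rewrite extension_eq0// normr0 powR0 ?gt_eqF// mul0r mul0e.
rewrite EFinM; apply: lee_wpmul2l; first by nn.
by apply: edist_weight_le => //; exact: ltW.
Qed.

Lemma WspD_integral_fin f : WspD s p D O f ->
  (Lp_integral p O f + Wsp_integral s p O f +
      weighted_integral s p D O f < +oo)%E.
Proof.
have pN0 : p^-1 != 0 by rewrite invr_neq0// gt_eqF.
move=> [[[_ Lf] Sf] Wf]; apply: lte_add_pinfty; last exact: (lty_poweRy pN0 Wf).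
by apply: lte_add_pinfty; [exact: (lty_poweRy pN0 Lf)|exact: (lty_poweRy pN0 Sf)].
Qed.

Lemma extension_WspD f : WspD s p D O f -> WspD s p D setT (extension f).
Proof.
move=> Df; have fin := WspD_integral_fin Df.
have cfin : (extension_cst%:E * (Lp_integral p O f + Wsp_integral s p O f +
      weighted_integral s p D O f) < +oo)%E.
  apply: lte_mul_pinfty => //; rewrite lee_fin; exact: extension_cst_ge0.
have wfin := le_lt_trans (extension_weight_le Df) cfin.
split; [split; [split|]|].
- exact: measurable_extension (WspD_measurable Df).
- apply: poweR_lty; exact: le_lt_trans (extension_Lp_le f) wfin.
- apply: poweR_lty; exact: le_lt_trans (extension_difference_le Df) cfin.
- apply: poweR_lty; exact: le_lt_trans (extension_weighted_le f) wfin.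
Qed.

Lemma extension_norm_le f : WspD s p D O f ->
  (WspD_norm s p D setT (extension f) <=
   (3 * (extension_cst * 3) `^ p^-1)%:E * WspD_norm s p D O f)%E.
Proof.
move=> Df; have ip : 0 <= p^-1 by rewrite invr_ge0 ltW.
have e0 := extension_cst_ge0.
have l0 := Lp_integral_ge0 p O f; have s0 := Wsp_integral_ge0 s p O f.
have w0 := weighted_integral_ge0 s p D O f.
have wle := extension_weight_le Df.
have root t := @le_poweR_sum3 R _ _ _ _ _ t ip e0 l0 s0 w0.
have r1 := root _ (Lp_integral_ge0 _ _ _) (le_trans (extension_Lp_le f) wle).
have r2 := root _ (Wsp_integral_ge0 _ _ _ _) (extension_difference_le Df).
have r3 := root _ (weighted_integral_ge0 _ _ _ _ _)
  (le_trans (extension_weighted_le f) wle).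
rewrite !WspD_normE; apply: (le_trans (leeD (leeD r1 r2) r3)).
rewrite EFinM -muleA; set m := (_ * (_ + _ + _))%E.
have m0 : (0 <= m)%E.
  apply: mule_ge0; first by nn.
  by apply: adde_ge0; [apply: adde_ge0|]; exact: poweR_ge0.
have -> : (3%:E : \bar R) = (1 + 1 + 1)%:E by congr EFin; ring.
by rewrite !EFinD !ge0_muleDl ?adde_ge0// mul1e.
Qed.

Lemma extension_ae f f' : WspD s p D O f -> WspD s p D O f' ->
  f = f' %[ae mu in O] -> extension f = extension f' %[ae mu].
Proof.
move=> Df Df' ff'.
have ff0 : f \_ O = f' \_ O %[ae mu in O].
  by apply: filterS ff' => x fx Ox; rewrite !restrictE//; exact: fx.
have oE := extend_ae g h p mO (WspD_measurable Df) (WspD_measurable Df') ff0.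
apply: filterS ff0 => x fx _; rewrite /extension /glue /outer oE.
by have [/set_mem/fx|_] := boolP (x \in O); last exact: erefl.
Qed.

Lemma extension_linear f f' (a : R) : 1 <= p -> WspD s p D O f -> WspD s p D O f' ->
  extension (fun x => a * f x + f' x) =
  (fun x => a * extension f x + extension f' x).
Proof.
move=> p1 Df Df'.
have lE : (fun x => a * f x + f' x) \_ O = (fun x => a * (f \_ O) x + (f' \_ O) x).
  apply/funext => x; rewrite !patchE.
  by case: (x \in O) => //; rewrite mulr0 addr0.
apply/funext => x; rewrite /extension /glue /outer lE.
case: (x \in O); first by [].
exact: (extend_linear mO g_ge0 g_lip h_lip h_le kappa0 g_thick p0 a x p1
  (WspD_measurable Df) (WspD_measurable Df') (WspD_Lp Df) (WspD_Lp Df')).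
Qed.

End extension_operator.

Theorem theorem1p1 (R : realType) (d : nat) (O D : set 'rV[R]_d) (p s : R)
    (hO : open O) (hD : D `<=` boundary O) (hp : 0 < p) (hs : 0 < s < 1)
    (hOD : interior_thick O D) :
  exists E : ('rV[R]_d -> R) -> ('rV[R]_d -> R),
    [/\ forall f, WspD s p D O f -> WspD s p D setT (E f),
        forall f g, WspD s p D O f -> WspD s p D O g ->
          f = g %[ae lebesgue_rV d in O] -> E f = E g %[ae lebesgue_rV d],
        forall f, WspD s p D O f -> E f = f %[ae lebesgue_rV d in O],
        exists2 C : R, 0 <= C & forall f, WspD s p D O f ->
          (WspD_norm s p D setT (E f) <= C%:E * WspD_norm s p D O f)%E
      & 1 <= p -> forall (a : R) f g, WspD s p D O f -> WspD s p D O g ->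
          E (fun x => a * f x + g x) = (fun x => a * E f x + E g x)
            %[ae lebesgue_rV d]].
Proof.
case: hOD => c c0 thick.
exists (extension O D p); split.
- by move=> f Df; exact: (extension_WspD hO hD hp hs c0 thick Df).
- by move=> f g Df Dg; exact: (extension_ae hO Df Dg).
- move=> f _; apply: aeW => x Ox.
  by rewrite /extension /glue mem_set// patchE mem_set.
- exists (3 * (@extension_cst R d p s c * 3) `^ p^-1).
    by rewrite mulr_ge0 ?powR_ge0.
  by move=> f Df; exact: (extension_norm_le hO hD hp hs c0 thick Df).
- move=> p1 a f g Df Dg; apply: aeW => x _.
  by rewrite (extension_linear hO hp c0 thick a p1 Df Dg).
Qed.
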